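(* Let $n \ge 1$, let $\Omega \subset \mathbb{R}^n$ be an open set, let $\sigma \in (0,1]$, $p \in [1,\infty]$ and $\alpha > 0$. Let $f \in W^{\sigma,p}(\Omega)$ satisfy $$\int_\Omega |f|^{-\alpha} < \infty ,$$ and let $$\Sigma := \Big\{x \in \Omega : \ \lim_{r \to 0} \frac{1}{|B_r(x)|}\int_{B_r(x)} |f| = 0\Big\}.$$ Then $\mathcal{H}^t(\Sigma) = 0$ whenever $t > s := \max\big\{0,\ n-\sigma\frac{p\alpha}{p+\alpha}\big\}$ (for $p=\infty$ the quotient $\frac{p\alpha}{p+\alpha}$ is read as $\alpha$).
   Context: $\mathcal{H}^t$ is the $t$-dimensional Hausdorff measure on $\mathbb{R}^n$, $B_r(x)$ is the ball of radius $r$ centered at $x$, and $|A|$ is the Lebesgue measure of $A$. The function $|f|^{-\alpha}$ is taken to be $+\infty$ where $f=0$. For an open set $\Omega\subset\mathbb{R}^n$, the homogeneous seminorms are: for $\sigma = 1$, $[f]_{\dot W^{1,p}(\Omega)} := \|\nabla f\|_{L^p(\Omega)}$ (weak gradient); for $\sigma\in(0,1)$ and $p \in [1,\infty)$, $$[f]_{\dot W^{\sigma,p}(\Omega)} := \left(\int_\Omega\int_\Omega \left(\frac{|f(x)-f(y)|}{|x-y|^\sigma}\right)^p \frac{dx\,dy}{|x-y|^n}\right)^{1/p};$$ for $\sigma \in (0,1)$ and $p=\infty$, $[f]_{\dot W^{\sigma,\infty}(\Omega)} := \sup_{x\ne y}\frac{|f(x)-f(y)|}{|x-y|^\sigma}$.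 The space $W^{\sigma,p}(\Omega)$, $\sigma\in(0,1]$, $p\in[1,\infty]$, consists of all functions $f:\Omega\to\mathbb{R}$ with finite norm $\|f\|_{W^{\sigma,p}(\Omega)} := \|f\|_{L^p(\Omega)} + [f]_{\dot W^{\sigma,p}(\Omega)}$. *)

(* Defs.v *)
From HB Require Import structures.
From mathcomp Require Import all_boot all_order all_algebra.
From mathcomp Require Import all_classical all_reals all_analysis.

Set Implicit Arguments.
Unset Strict Implicit.
Unset Printing Implicit Defensive.

Import Order.TTheory GRing.Theory Num.Theory.
Import numFieldNormedType.Exports.

Local Open Scope classical_set_scope.
Local Open Scope ring_scope.

(** * Lebesgue measure on R^n

    R^n is ['rV[R]_n].  It gets the sigma-algebra generated by the
    coordinates, on which [lebesgue_borel R n] is the n-fold product of the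
    one-dimensional Lebesgue measure.  The measure used everywhere below is its
    completion [lebesgue_rV R n], which lives on the type [leb_rV R n]: this is
    ['rV[R]_n] equipped with the Lebesgue measurable sets. *)

Definition rV_display : measure_display -> measure_display.
Proof. exact. Qed.

Section measurable_rV.
Context {R : realType} (n : nat).

Definition rV_coord (i : 'I_n) (v : 'rV[R]_n) : R := v 0 i.

Let rV_set0 : g_sigma_preimage rV_coord set0.
Proof. exact: sigma_algebra0. Qed.

Let rV_setC A : g_sigma_preimage rV_coord A -> g_sigma_preimage rV_coord (~` A).
Proof. exact: sigma_algebraC. Qed.

Let rV_bigcup (F : (set 'rV[R]_n)^nat) :
  (forall i, g_sigma_preimage rV_coord (F i)) ->
  g_sigma_preimage rV_coord (\bigcup_i (F i)).
Proof. exact: sigma_algebra_bigcup. Qed.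

HB.instance Definition _ :=
  @isMeasurable.Build (rV_display default_measure_display)
    'rV[R]_n (g_sigma_preimage rV_coord) rV_set0 rV_setC rV_bigcup.

Lemma measurable_rV_coord (i : 'I_n) : measurable_fun [set: 'rV[R]_n] (rV_coord i).
Proof.
move=> _ Y mY; rewrite setTI; apply: sub_sigma_algebra => /=.
rewrite -bigcup_seq/=; exists i => /=; first by rewrite mem_index_enum.
by exists Y => //; rewrite setTI.
Qed.

Lemma measurable_fun_rVP d (T : measurableType d) (f : T -> 'rV[R]_n) :
  (forall i, measurable_fun [set: T] (rV_coord i \o f)) ->
  measurable_fun [set: T] f.
Proof.
move=> mf _ Y mY; rewrite setTI.
have [sA sB] : sigma_algebra [set: 'rV[R]_n] [set A | measurable (f @^-1` A)] /\
  \big[setU/set0]_(i < n) preimage_set_system setT (rV_coord i) measurable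
    `<=` [set A | measurable (f @^-1` A)].
  split.
    split; first by rewrite /= preimage_set0.
      by move=> A /= mA; rewrite setTD preimage_setC; exact: measurableC.
    move=> F /= mF; rewrite preimage_bigcup.
    exact: bigcupT_measurable.
  move=> A; rewrite -bigcup_seq => -[i _ [B mB <-]] /=.
  rewrite setTI -comp_preimage -[X in measurable X]setTI.
  exact: mf.
exact: (mY _ (conj sA sB)).
Qed.

End measurable_rV.

Definition rV_cons {R : realType} (n : nat) (p : R * 'rV[R]_n) : 'rV[R]_n.+1 :=
  row_mx p.1%:M p.2.

Section rV_cons.
Context {R : realType} (n : nat).

Lemma rV_cons0 (p : R * 'rV[R]_n) : rV_coord 0 (rV_cons p) = p.1.
Proof.
have e : (0 : 'I_n.+1) = lshift n (0 : 'I_1) by exact: val_inj.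
rewrite /rV_coord e; apply: etrans (row_mxEl p.1%:M p.2 0 0) _.
by rewrite mxE.
Qed.

Lemma rV_consS (p : R * 'rV[R]_n) (i : 'I_n) :
  rV_coord (lift 0 i) (rV_cons p) = rV_coord i p.2.
Proof.
have e : lift (0 : 'I_n.+1) i = rshift 1 i by exact: val_inj.
by rewrite /rV_coord e; exact: (row_mxEr p.1%:M p.2 0 i).
Qed.

Definition rV_uncons (v : 'rV[R]_n.+1) : R * 'rV[R]_n :=
  (v 0 0, \row_i v 0 (lift 0 i)).

Lemma rV_unconsK : cancel rV_uncons (@rV_cons R n).
Proof.
move=> v; apply/rowP => i; have := unliftP 0 i; case=> [j|] ->.
  by have := rV_consS (rV_uncons v) j; rewrite /rV_coord /= mxE.
by have := rV_cons0 (rV_uncons v).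
Qed.

Lemma rV_consK : cancel (@rV_cons R n) rV_uncons.
Proof.
case=> x v; rewrite /rV_uncons; congr pair; first exact: (rV_cons0 (x, v)).
by apply/rowP => i; rewrite mxE; exact: (rV_consS (x, v)).
Qed.

Lemma measurable_rV_cons :
  measurable_fun [set: R * 'rV[R]_n] (@rV_cons R n).
Proof.
apply: measurable_fun_rVP => i; have := unliftP 0 i; case=> [j|] ->.
  rewrite (_ : _ \o _ = rV_coord j \o snd); last first.
    by apply/funext => p /=; rewrite rV_consS.
  by apply: measurableT_comp => //; exact: measurable_rV_coord.
rewrite (_ : _ \o _ = fst); last by apply/funext => p /=; rewrite rV_cons0.
exact: measurable_fst.
Qed.

Lemma measurable_rV_uncons : measurable_fun [set: 'rV[R]_n.+1] rV_uncons.
Proof.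
apply: measurable_fun_pair; first exact: measurable_rV_coord.
apply: measurable_fun_rVP => i.
rewrite (_ : _ \o _ = rV_coord (lift 0 i)); first exact: measurable_rV_coord.
by apply/funext => v; rewrite /rV_coord /= mxE.
Qed.

Variable mu : {sigma_finite_measure set 'rV[R]_n -> \bar R}.

Definition measure_rV_cons : set 'rV[R]_n.+1 -> \bar R :=
  pushforward (@lebesgue_measure R \x mu)%E (@rV_cons R n).

Let cons0 : measure_rV_cons set0 = 0%E.
Proof. by rewrite /measure_rV_cons /pushforward preimage_set0 measure0. Qed.

Let cons_ge0 A : (0 <= measure_rV_cons A)%E.
Proof. exact: (measure_ge0 (@lebesgue_measure R \x mu)%E). Qed.

Let cons_sigma_additive : semi_sigma_additive measure_rV_cons.
Proof.
move=> F mF tF mUF; rewrite /measure_rV_cons /pushforward preimage_bigcup.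
apply: measure_semi_sigma_additive.
- by move=> k; rewrite -[X in measurable X]setTI; exact: measurable_rV_cons.
- apply/trivIsetP => /= i j _ _ ij; rewrite -preimage_setI.
  by move/trivIsetP : tF => /(_ _ _ _ _ ij) ->//; rewrite preimage_set0.
- by rewrite -preimage_bigcup -[X in measurable X]setTI; exact: measurable_rV_cons.
Qed.

HB.instance Definition _ := isMeasure.Build _ _ _
  measure_rV_cons cons0 cons_ge0 cons_sigma_additive.

Let cons_sigma_finite : sigma_finite setT measure_rV_cons.
Proof.
have /sigma_finiteP[F [TF ndF Foo]] := sigma_finiteT (@lebesgue_measure R).
have /sigma_finiteP[G [TG ndG Goo]] := sigma_finiteT mu.
exists (fun k => rV_uncons @^-1` (F k `*` G k)).
  apply/seteqP; split => // v _.
  have : [set: R] (rV_uncons v).1 by [].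
  have : [set: 'rV[R]_n] (rV_uncons v).2 by [].
  rewrite TF TG => -[j _ Gj] [i _ Fi]; exists (maxn i j) => //; split.
  - by move: Fi; apply/subsetPset/ndF/leq_maxl.
  - by move: Gj; apply/subsetPset/ndG/leq_maxr.
move=> k; have [mF muF] := Foo k; have [mG muG] := Goo k; split.
  rewrite -[X in measurable X]setTI; apply: measurable_rV_uncons => //.
  exact: measurableX.
rewrite /measure_rV_cons /pushforward -comp_preimage.
rewrite (_ : _ \o _ = id); last by apply/funext => p; exact: rV_consK.
rewrite preimage_id product_measure1E//.
by rewrite lte_mul_pinfty// ge0_fin_numE.
Qed.

HB.instance Definition _ := Measure_isSigmaFinite.Build _ _ _
  measure_rV_cons cons_sigma_finite.

End rV_cons.

Fixpoint lebesgue_borel (R : realType) (n : nat) :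
    {sigma_finite_measure set 'rV[R]_n -> \bar R} :=
  match n with
  | 0 => \d_(0 : 'rV[R]_0)
  | n'.+1 => measure_rV_cons (lebesgue_borel R n')
  end.

Definition leb_rV (R : realType) (n : nat) :=
  caratheodory_type (mu_ext (lebesgue_borel R n)).

HB.instance Definition _ (R : realType) (n : nat) := Measurable.on (leb_rV R n).

Definition lebesgue_rV (R : realType) (n : nat) : set (leb_rV R n) -> \bar R :=
  @completed_measure_extension _ 'rV[R]_n R (lebesgue_borel R n).

HB.instance Definition _ (R : realType) (n : nat) :=
  Measure.on (@lebesgue_rV R n).

Lemma lebesgue_rV_sigma_finite (R : realType) (n : nat) :
  sigma_finite setT (@lebesgue_rV R n).
Proof. exact/completed_measure_extension_sigma_finite/sigma_finiteT. Qed.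

HB.instance Definition _ (R : realType) (n : nat) :=
  @Measure_isSigmaFinite.Build _ _ _ (@lebesgue_rV R n)
    (@lebesgue_rV_sigma_finite R n).

Arguments lebesgue_rV {R n}.

Lemma measurable_rV_box (R : realType) n (A : 'I_n -> set R) :
  (forall i, measurable (A i)) ->
  measurable [set v : 'rV[R]_n | forall i, A i (v 0 i)].
Proof.
move=> mA.
rewrite (_ : mkset _ =
  \big[setI/setT]_(i < n) (rV_coord i @^-1` A i)).
  apply: bigsetI_measurable => i _.
  rewrite -[X in measurable X]setTI; exact: measurable_rV_coord.
apply/seteqP; split => v.
  by move=> h; rewrite -bigcap_seq => i _; exact: h.
rewrite -bigcap_seq => h i; move: (h i); apply; exact: mem_index_enum.
Qed.

Lemma lebesgue_borel_box (R : realType) n (A : 'I_n -> set R) :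
  (forall i, measurable (A i)) ->
  lebesgue_borel R n [set v : 'rV[R]_n | forall i, A i (v 0 i)] =
  (\prod_i lebesgue_measure (A i))%E.
Proof.
elim: n A => [|n IH] A mA.
  by rewrite big_ord0 /= diracE mem_set // => -[].
rewrite big_ord_recl -(IH (A \o lift 0)) => [|i]; last exact: mA.
rewrite /= /measure_rV_cons /pushforward.
have mB : measurable [set v : 'rV[R]_n | forall i, (A \o lift 0) i (v 0 i)].
  by apply: (@measurable_rV_box R n (A \o lift 0)) => i; exact: mA.
have E := @product_measure1E _ _ (measurableTypeR R) _ R (@lebesgue_measure R)
  (lebesgue_borel R n) _ _ (mA 0) mB.
rewrite -[RHS]E.
congr (_ _); apply/seteqP; split=> [[x v]/=h|[x v]/= [Ax Av] i].
  split; first by have := h 0; rewrite -/(rV_coord _ _) rV_cons0.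
  by move=> i; have := h (lift 0 i); rewrite -/(rV_coord _ _) rV_consS.
have := unliftP 0 i; case=> [j|] ->; rewrite -/(rV_coord _ _).
  by rewrite rV_consS; exact: Av.
by rewrite rV_cons0.
Qed.

Lemma lebesgue_rV_box (R : realType) n (A : 'I_n -> set R) :
  (forall i, measurable (A i)) ->
  lebesgue_rV ([set v : 'rV[R]_n | forall i, A i (v 0 i)] : set (leb_rV R n)) =
  (\prod_i lebesgue_measure (A i))%E.
Proof.
move=> mA; rewrite -lebesgue_borel_box//.
by apply: measurable_mu_extE; exact: measurable_rV_box.
Qed.

(** * Euclidean norm and balls

    The library norm on ['rV[R]_n] is the sup norm; it induces the same
    topology, so [open], [compact], [continuous] are the library's. *)

Definition enorm {R : realType} {n : nat} (v : 'rV[R]_n) : R :=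
  Num.sqrt (\sum_(i < n) v 0 i ^+ 2).

Definition eball {R : realType} {n : nat} (x : 'rV[R]_n) (r : R) :
  set 'rV[R]_n := [set y | enorm (y - x) < r].

(** * Hausdorff measure

    The normalisation is that of the gauge [diam ^ t], without the constant
    [omega_t / 2 ^ t]. *)

Definition ediam {R : realType} {n : nat} (A : set 'rV[R]_n) : \bar R :=
  ereal_sup [set (enorm (x - y))%:E | x in A & y in A].

(* The empty set has gauge 0 also when [t = 0], a point has [0 `^ 0 = 1]. *)
Definition hausdorff_gauge {R : realType} {n : nat} (t : R)
    (A : set 'rV[R]_n) : \bar R :=
  if `[< A = set0 >] then 0%E else (ediam A `^ t)%E.

Definition hausdorff_content {R : realType} {n : nat} (t delta : R)
    (A : set 'rV[R]_n) : \bar R :=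
  ereal_inf [set (\sum_(k <oo) hausdorff_gauge t (E k))%E |
    E in [set E : (set 'rV[R]_n)^nat |
      (forall k, (ediam (E k) <= delta%:E)%E) /\ A `<=` \bigcup_k E k]].

(* The content increases as [delta] decreases, so that the supremum is the
   limit as [delta] tends to 0. *)
Definition hausdorff_measure {R : realType} {n : nat} (t : R)
    (A : set 'rV[R]_n) : \bar R :=
  ereal_sup [set hausdorff_content t delta A | delta in [set d : R | 0 < d]].

(** * Sobolev spaces

    A function on [Omega] is a total function of which only the values on
    [Omega] are used. *)

Definition Lnorm_on {R : realType} {n : nat} (Omega : set 'rV[R]_n)
    (p : \bar R) (f : 'rV[R]_n -> R) : \bar R :=
  Lnorm (@lebesgue_rV R n) p ((EFin \o f) \_ Omega).

Definition loc_integrable_on {R : realType} {n : nat} (Omega : set 'rV[R]_n)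
    (f : 'rV[R]_n -> R) : Prop :=
  measurable_fun (Omega : set (leb_rV R n)) (f : leb_rV R n -> R) /\
  forall K : set 'rV[R]_n, compact K -> K `<=` Omega ->
    (\int[lebesgue_rV]_(x in (K : set (leb_rV R n))) `|f x|%:E < +oo)%E.

Definition partial {R : realType} {n : nat} (i : 'I_n) (f : 'rV[R]_n -> R) :
  'rV[R]_n -> R := fun x => 'D_(delta_mx 0 i) f x.

Definition smooth {R : realType} {n : nat} (f : 'rV[R]_n -> R) : Prop :=
  forall s : seq 'I_n,
    continuous (foldr partial f s) /\
    forall (i : 'I_n) (x : 'rV[R]_n),
      derivable (foldr partial f s) x (delta_mx 0 i).

Definition test_function {R : realType} {n : nat} (Omega : set 'rV[R]_n)
    (phi : 'rV[R]_n -> R) : Prop :=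
  smooth phi /\ exists K : set 'rV[R]_n,
    [/\ compact K, K `<=` Omega & forall x, ~ K x -> phi x = 0].

Definition weak_gradient {R : realType} {n : nat} (Omega : set 'rV[R]_n)
    (f : 'rV[R]_n -> R) (g : 'rV[R]_n -> 'rV[R]_n) : Prop :=
  [/\ loc_integrable_on Omega f,
      forall i, loc_integrable_on Omega (fun x => g x 0 i) &
      forall (phi : 'rV[R]_n -> R) (i : 'I_n), test_function Omega phi ->
        (\int[lebesgue_rV]_(x in (Omega : set (leb_rV R n)))
           (f x * partial i phi x)%:E =
         - \int[lebesgue_rV]_(x in (Omega : set (leb_rV R n)))
           (g x 0 i * phi x)%:E)%E].

(* The weak gradient is unique up to a null set, so the infimum is over at most
   one value; it is +oo when [f] has no weak gradient. *)
Definition gradient_seminorm {R : realType} {n : nat} (Omega : set 'rV[R]_n)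
    (p : \bar R) (f : 'rV[R]_n -> R) : \bar R :=
  ereal_inf [set Lnorm_on Omega p (enorm \o g) |
    g in [set g | weak_gradient Omega f g]].

(* On the diagonal, division by 0 gives the integrand the value 0. *)
Definition gagliardo_seminorm {R : realType} {n : nat} (Omega : set 'rV[R]_n)
    (sigma p : R) (f : 'rV[R]_n -> R) : \bar R :=
  ((\int[lebesgue_rV]_(y in (Omega : set (leb_rV R n)))
    \int[lebesgue_rV]_(x in (Omega : set (leb_rV R n)))
      ((`|f x - f y| / enorm (x - y) `^ sigma) `^ p
        / enorm (x - y) ^+ n)%:E) `^ p^-1)%E.

(* The maximum with 0 only matters when [Omega] is empty. *)
Definition holder_seminorm {R : realType} {n : nat} (Omega : set 'rV[R]_n)
    (sigma : R) (f : 'rV[R]_n -> R) : \bar R :=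
  maxe 0%E (ereal_sup [set (`|f z.1 - f z.2| / enorm (z.1 - z.2) `^ sigma)%:E |
    z in [set z : 'rV[R]_n * 'rV[R]_n |
      [/\ Omega z.1, Omega z.2 & z.1 <> z.2]]]).

(* Only used for [0 < sigma <= 1] and [1 <= p]. *)
Definition sobolev_seminorm {R : realType} {n : nat} (Omega : set 'rV[R]_n)
    (sigma : R) (p : \bar R) (f : 'rV[R]_n -> R) : \bar R :=
  if sigma == 1 then gradient_seminorm Omega p f
  else match p with
       | q%:E => gagliardo_seminorm Omega sigma q f
       | _ => holder_seminorm Omega sigma f
       end.

Definition sobolev_norm {R : realType} {n : nat} (Omega : set 'rV[R]_n)
    (sigma : R) (p : \bar R) (f : 'rV[R]_n -> R) : \bar R :=
  (Lnorm_on Omega p f + sobolev_seminorm Omega sigma p f)%E.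

Definition sobolev_space {R : realType} {n : nat} (Omega : set 'rV[R]_n)
    (sigma : R) (p : \bar R) : set ('rV[R]_n -> R) :=
  [set f | measurable_fun (Omega : set (leb_rV R n)) (f : leb_rV R n -> R) /\
           (sobolev_norm Omega sigma p f < +oo)%E].

Definition abs_powN {R : realType} (alpha y : R) : \bar R :=
  if y == 0 then +oo%E else (`|y| `^ (- alpha))%:E.

Definition abs_average {R : realType} {n : nat} (f : 'rV[R]_n -> R)
    (A : set 'rV[R]_n) : \bar R :=
  ((lebesgue_rV (A : set (leb_rV R n)))^-1 *
   \int[lebesgue_rV]_(y in (A : set (leb_rV R n))) `|f y|%:E)%E.

Definition zero_average_set {R : realType} {n : nat} (Omega : set 'rV[R]_n)
    (f : 'rV[R]_n -> R) : set 'rV[R]_n :=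
  [set x | Omega x /\
    abs_average f (eball x r) @[r --> (0 : R)^'+] --> (0 : \bar R)].

(* [p alpha / (p + alpha)], read as [alpha] for [p = +oo]. *)
Definition integrability_quotient {R : realType} (p : \bar R) (alpha : R) : R :=
  match p with
  | q%:E => q * alpha / (q + alpha)
  | _ => alpha
  end.

Definition critical_dim {R : realType} (n : nat) (sigma : R) (p : \bar R)
    (alpha : R) : R :=
  Num.max 0 (n%:R - sigma * integrability_quotient p alpha).

(* Main.v *)
Require Import Defs.
From mathcomp Require Import all_boot all_order all_algebra.
From mathcomp Require Import all_classical all_reals all_analysis measurable_realfun.
From mathcomp Require Import ess_sup_inf.
From mathcomp Require Import zify ring lra.

(** Write [l = 2^-k] for the side of a dyadic cube [Q] and choose [t'] strictly
    between [n - sigma p alpha / (p + alpha)] and [min(t, n)].  Let [h] be [|f|^-alpha] plus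
    the density of the Sobolev energy of [f] (for [p = +oo], just [|f|^-alpha]);
    it is integrable on [Omega].  Call [Q] bad if [int_Q h >= l^t'].

    On a good cube the Sobolev energy bounds the mean oscillation of [f] by
    [C l^beta], [beta = sigma - (n - t')/p].  Suppose that [x] is in [Sigma] and
    lies in no bad cube of small side.  The averages of [|f|] over the cubes at
    [x] tend to 0 and successive ones differ by [O(l^beta)], so they are
    [O(l^beta)].  But [1 <= |f|/M + M^alpha |f|^-alpha] with [M = l^gamma],
    [(n - t')/alpha < gamma < beta], integrated over a good cube, gives
    [1 <= O(l^(beta - gamma)) + l^(alpha gamma + t' - n)], which fails for small
    [l].  Hence [Sigma] is covered by bad cubes of arbitrarily small side, and
    the cubes of side [l] among them number at most [l^-t' int h]; as [t > t'],
    the sums of the gauges [diam^t] tend to 0.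

    For [sigma = 1] the oscillation bound is a Poincare inequality, derived
    directly from the definition of the weak gradient: testing it against a
    tent function in one variable times cut-offs in the others compares the
    integrals of [f] over the two halves of a dyadic box. *)

Set Implicit Arguments.
Unset Strict Implicit.
Unset Printing Implicit Defensive.

Import Order.TTheory GRing.Theory Num.Theory.
Import numFieldNormedType.Exports.

Local Open Scope classical_set_scope.
Local Open Scope ring_scope.

(** * Dyadic boxes *)

(** The exponents fit because, with [d = n - t'], the window [d / alpha < gamma < sigma - d / p] is
    nonempty exactly when [d (1 / alpha + 1 / p) < sigma], that is, when
    [t' > n - sigma p alpha / (p + alpha)].

    The halving inequality compares the integrals of [f] over two half boxes, but says nothing
    directly about [|f - c|]. Therefore the quantity bounded first is the integral of [f - c] over
    [Q] intersected with a union [U] of dyadic cubes of one generation, [c] being the mean over [Q].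
    It is linear in [f]: when a box is halved, the deviations of the halves add up, and the change
    of the mean costs one application of the halving inequality. These costs are paid by the
    decrease of the sum of the sides. Once the boxes are finer than the cubes of [U], each is
    contained in [U] or disjoint from it, and its deviation is 0. The recursion is thus finite, and
    neither differentiation of integrals nor smoothing of [f] is involved. Approximating the set
    where [f > c], and its complement, by such [U] then gives the integral of [|f - c|]. *)

Section dyadic_box.
Context {R : realType}.
Implicit Types (k : nat) (m : int) (x a : R).

(** Encoding the cell by the floor makes the cells of one generation a partition of the line by
    definition, and turns passing to the parent into an integer division. *)
Definition dyadic_itv k m : set R := [set x | Num.floor (2 ^+ k * x) = m].

Lemma dyadic_itvE k m :
  dyadic_itv k m = `[m%:~R / 2 ^+ k, (m + 1)%:~R / 2 ^+ k[%classic.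
Proof.
have k0 : 0 < 2 ^+ k :> R by rewrite exprn_gt0.
apply/seteqP; split => x; rewrite /= in_itv /= ler_pdivrMr// ltr_pdivlMr//.
  by move=> <-; rewrite mulrC floor_itv.
by rewrite mulrC => /floor_def.
Qed.

Lemma measurable_dyadic_itv k m : measurable (dyadic_itv k m).
Proof. by rewrite dyadic_itvE; exact: measurable_itv. Qed.

Lemma lebesgue_dyadic_itv k m :
  lebesgue_measure (dyadic_itv k m) = (2 ^- k : R)%:E.
Proof.
rewrite dyadic_itvE lebesgue_measure_itv /= lte_fin.
rewrite ltr_pM2r ?invr_gt0 ?exprn_gt0// ltr_int ltzD1 lexx -EFinB.
by rewrite intrD mulrDl addrAC subrr add0r mul1r.
Qed.

Lemma floor_half k x : Num.floor (2 ^+ k * x) = (Num.floor (2 ^+ k.+1 * x) %/ 2)%Z.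
Proof.
apply: floor_def; set m := Num.floor (2 ^+ k.+1 * x).
have /andP[] : m%:~R <= 2 ^+ k.+1 * x < (m + 1)%:~R by exact: floor_itv.
rewrite exprS -mulrA => h1 h2.
have := divz_eq m 2; have := modz_ge0 m (erefl : 2%:Z != 0).
have := ltz_pmod m (erefl : 0 < 2%:Z); set q := (m %/ 2)%Z; set r := (m %% 2)%Z.
move=> r2 r0 mE.
have : (q * 2)%:~R <= m%:~R :> R by rewrite ler_int mE lerDl.
have : (m + 1)%:~R <= ((q + 1) * 2)%:~R :> R by rewrite ler_int mE; lia.
rewrite !intrM => h3 h4; apply/andP; split.
  by have := le_trans h4 h1; rewrite mulrC ler_pM2l.
by have := lt_le_trans h2 h3; rewrite [ltRHS]mulrC ltr_pM2l.
Qed.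

Lemma floor_coarse k l (x y : R) : (k <= l)%N ->
  Num.floor (2 ^+ l * x) = Num.floor (2 ^+ l * y) ->
  Num.floor (2 ^+ k * x) = Num.floor (2 ^+ k * y).
Proof.
move=> /subnK <-; elim: (l - k)%N => // i IH; rewrite addSn => h.
by apply: IH; rewrite (floor_half _ x) (floor_half _ y) h.
Qed.

Lemma dyadic_itv_split k m :
  dyadic_itv k m = dyadic_itv k.+1 (m * 2) `|` dyadic_itv k.+1 (m * 2 + 1).
Proof.
apply/seteqP; split => x; rewrite /dyadic_itv /= (floor_half k x); last first.
  by case=> ->; rewrite ?divzMDl// ?mulzK// divz_small ?addr0.
set q := Num.floor (2 ^+ k.+1 * x) => <-.
have := divz_eq q 2; have := modz_ge0 q (erefl : 2%:Z != 0).
have := ltz_pmod q (erefl : 0 < 2%:Z).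
move: (q %/ 2)%Z (q %% 2)%Z => a [[|[|r]]|r] //= _ _ ->.
  by left; rewrite addr0.
by right.
Qed.

End dyadic_box.

(** * Dyadic boxes and Lebesgue measure *)

Section leb_rV_basic.
Context {R : realType} {n : nat}.
Implicit Types (e : 'I_n -> nat) (A : set 'rV[R]_n) (x : 'rV[R]_n).

Lemma measurable_leb_rV A : measurable A -> measurable (A : set (leb_rV R n)).
Proof. exact: caratheodory_measurable_mu_ext. Qed.

Lemma measurable_leb_rV_coord (i : 'I_n) :
  measurable_fun [set: leb_rV R n] (rV_coord i : leb_rV R n -> R).
Proof.
move=> _ Y mY; rewrite setTI; apply: measurable_leb_rV.
by rewrite -[X in measurable X]setTI; exact: measurable_rV_coord.
Qed.

(** The exponent depends on the coordinate because the Poincare inequality is proved by halving one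
    side at a time. *)
Definition dyadic_box e (z : 'I_n -> int) : set 'rV[R]_n :=
  [set v | forall i, dyadic_itv (e i) (z i) (v 0 i)].

Lemma measurable_dyadic_box_borel e (z : 'I_n -> int) : measurable (dyadic_box e z).
Proof.
apply: (measurable_rV_box (A := fun i => dyadic_itv (e i) (z i))) => i.
exact: measurable_dyadic_itv.
Qed.

Lemma measurable_dyadic_box e z :
  measurable (dyadic_box e z : set (leb_rV R n)).
Proof. by apply: measurable_leb_rV; exact: measurable_dyadic_box_borel. Qed.

Lemma lebesgue_dyadic_box e z :
  lebesgue_rV (dyadic_box e z : set (leb_rV R n)) = (\prod_i 2 ^- e i : R)%:E.
Proof.
rewrite (lebesgue_rV_box (A := fun i => dyadic_itv (e i) (z i))); last first.
  by move=> i; exact: measurable_dyadic_itv.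
rewrite (eq_bigr (fun i => (2 ^- e i)%:E)) ?prodEFin// => i _.
exact: lebesgue_dyadic_itv.
Qed.

Definition dyadic_index k (x : 'rV[R]_n) : 'rV[int]_n :=
  \row_i Num.floor (2 ^+ k * x 0 i).

Definition cube k (z : 'rV[int]_n) : set 'rV[R]_n :=
  dyadic_box (fun=> k) (fun i => z 0 i).

Lemma cubeP k z x : cube k z x <-> dyadic_index k x = z.
Proof.
split=> [h|<- i]; first by apply/rowP => i; rewrite mxE; exact: h.
by rewrite /dyadic_itv /= mxE.
Qed.

Lemma lebesgue_cube k (z : 'rV[int]_n) :
  lebesgue_rV (cube k z : set (leb_rV R n)) = (2 ^- (k * n) : R)%:E.
Proof.
by rewrite lebesgue_dyadic_box prodr_const card_ord -exprVn -exprM exprVn.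
Qed.

Lemma cube_coord_lt k z x y i : cube k z x -> cube k z y ->
  `|x 0 i - y 0 i| < 2 ^- k.
Proof.
move=> /(_ i) + /(_ i); rewrite dyadic_itvE /= !in_itv /=.
rewrite intrD mulrDl mul1r => /andP[x1 x2] /andP[y1 y2].
by rewrite ltr_norml; lra.
Qed.

Lemma open_cube_sub (Omega : set 'rV[R]_n) x : open Omega -> Omega x ->
  exists r : R, 0 < r /\ forall y : 'rV[R]_n, (forall i, `|x 0 i - y 0 i| < r) -> Omega y.
Proof.
move=> oO Ox; have := oO; rewrite openE => /(_ _ Ox).
case/nbhs_ballP => r /= r0 h; exists r; split => // y xy; apply: h.
by split => // i j; rewrite (ord1 i); exact: xy.
Qed.

Lemma exp2V_lt (r : R) : 0 < r -> exists K, forall k, (K <= k)%N -> 2 ^- k < r.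
Proof.
move=> r0; exists (Num.truncn r^-1).+1 => k Kk.
have kr : r^-1 < k%:R by apply: lt_le_trans (truncnS_gt _) _; rewrite ler_nat.
rewrite -[ltRHS]invrK ltf_pV2 ?posrE ?exprn_gt0 ?invr_gt0//.
by apply: (lt_trans kr); rewrite -natrX ltr_nat ltn_expl.
Qed.

Lemma open_cubes (Omega : set 'rV[R]_n) x : open Omega -> Omega x ->
  exists K, forall k, (K <= k)%N ->
    forall y : 'rV[R]_n, (forall i, `|x 0 i - y 0 i| <= 2 ^- k) -> Omega y.
Proof.
move=> oO Ox; have [r [r0 rO]] := open_cube_sub oO Ox.
have [K hK] := exp2V_lt r0; exists K => k Kk y xy; apply: rO => i.
exact: le_lt_trans (xy i) (hK _ Kk).
Qed.

(** The sigma-algebra comes from the coordinates rather than from the topology; an open set belongs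
    to it as the countable union of the dyadic cubes that it contains. *)
Lemma open_measurable_leb_rV (Omega : set 'rV[R]_n) : open Omega ->
  measurable (Omega : set (leb_rV R n)).
Proof.
move=> oO.
have -> : Omega = \bigcup_(k in [set: nat])
    \bigcup_(z in [set z | cube k z `<=` Omega]) cube k z.
  apply/seteqP; split => [x Ox|x [k _ [z zO] /zO//]].
  have [K hK] := open_cubes oO Ox; exists K => //.
  exists (dyadic_index K x); last exact/cubeP.
  move=> y yK /=; apply: (hK K) => // i.
  by apply/ltW/(cube_coord_lt (k := K) (z := dyadic_index K x)) => //; exact/cubeP.
apply: bigcup_measurable => k _; rewrite bigcup_mkcond.
apply: countable_bigcupT_measurable => [|z]; first exact: countableP.
by case: ifP => // _; exact: measurable_dyadic_box.
Qed.

End leb_rV_basic.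

(** * Hausdorff null sets *)

Section hausdorff_null.
Context {R : realType} {n : nat}.

(** The factor [n] in place of the sharp [sqrt n] costs only a constant. *)
Lemma enorm_le (v : 'rV[R]_n) (r : R) : 0 <= r ->
  (forall i, `|v 0 i| <= r) -> enorm v <= n%:R * r.
Proof.
move=> r0 vr; rewrite /enorm.
rewrite -[leRHS](ger0_norm (mulr_ge0 _ r0))// -sqrtr_sqr ler_wsqrtr//.
apply: (@le_trans _ _ (\sum_(i < n) r ^+ 2)).
  by apply: ler_sum => i _; rewrite -[X in X <= _]real_normK ?num_real// lerXn2r ?nnegrE.
rewrite sumr_const card_ord exprMn -[leLHS]mulr_natl ler_wpM2r ?sqr_ge0// -natrX ler_nat.
by case: (n) => // m; rewrite expnS expn1 leq_pmulr.
Qed.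

Lemma ediam_cube_le k (z : 'rV[int]_n) :
  (ediam (cube k z : set 'rV[R]_n) <= (n%:R * 2 ^- k)%:E)%E.
Proof.
apply: ge_ereal_sup => _ [x kx [y ky <-]]; rewrite lee_fin.
apply: enorm_le => [|i]; first by rewrite invr_ge0 exprn_ge0.
by rewrite !mxE; apply: ltW; exact: (cube_coord_lt i kx ky).
Qed.

(** This default value lets the empty pieces of a cover satisfy every bound on the diameter; their
    gauge is 0 by definition. *)
Lemma ediam_set0 : ediam (set0 : set 'rV[R]_n) = -oo%E.
Proof.
rewrite /ediam -[RHS](@ereal_sup0 R); congr ereal_sup.
by rewrite -subset0 => x [].
Qed.

Lemma ediam_ge0 (A : set 'rV[R]_n) : A !=set0 -> (0 <= ediam A)%E.
Proof.
move=> [x Ax]; apply: le_ereal_sup_tmp; exists (enorm (x - x))%:E.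
  by exists x => //; exists x.
by rewrite lee_fin sqrtr_ge0.
Qed.

Lemma hausdorff_gauge_ge0 t (A : set 'rV[R]_n) : (0 <= hausdorff_gauge t A)%E.
Proof. by rewrite /hausdorff_gauge; case: ifP => // _; exact: poweR_ge0. Qed.

Lemma hausdorff_gauge_cube_le t k (z : 'rV[int]_n) : 0 <= t ->
  (hausdorff_gauge t (cube k z : set 'rV[R]_n)
    <= ((n%:R * 2 ^- k) `^ t)%:E)%E.
Proof.
move=> t0; rewrite /hausdorff_gauge; case: ifPn => [|/asboolPn/eqP/set0P ne].
  by rewrite lee_fin powR_ge0.
rewrite -poweR_EFin; apply: gt0_ler_poweR (ediam_cube_le k z) => //.
  by rewrite in_itv /= ediam_ge0 //= leey.
by rewrite in_itv /= leey andbT lee_fin mulr_ge0// invr_ge0 exprn_ge0.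
Qed.

(** Covers in the Hausdorff content are sequences, while bad cubes are indexed by a generation and a
    position. Numbers that encode no such pair contribute 0. *)
Lemma esum_pickle (T : countType) (a : T -> \bar R) : (forall x, 0 <= a x)%E ->
  (\sum_(j <oo) (if @pickle_inv T j is Some x then a x else 0)
   = \esum_(x in [set: T]) a x)%E.
Proof.
move=> a0; rewrite nneseries_esumT; last by move=> j; case: pickle_inv.
pose g j := (if @pickle_inv T j is Some x then a x else 0)%E.
rewrite -[LHS]/(\esum_(j in setT) g j)%E.
transitivity (\esum_(j in range (@pickle T)) g j)%E.
  rewrite [RHS]esum_mkcond; apply: eq_esum => j _; case: ifPn => // /negP jr.
  rewrite /g; have := @pickle_invK T j; case: pickle_inv => //= x xj.
  by exfalso; apply: jr; rewrite inE; exists x.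
rewrite esum_image; first by apply: eq_esum => x _; rewrite /g pickleK_inv.
by move=> x y _ _; exact: (pcan_inj pickleK).
Qed.

Lemma geometric_tail_le (r : R) (K N : nat) : 0 < r < 1 ->
  \sum_(0 <= k < N) (if (K <= k)%N then r ^+ k else 0) <= r ^+ K / (1 - r).
Proof.
move=> /andP[r0 r1]; have r1' : 0 < 1 - r by rewrite subr_gt0.
(* The induction carries the exact partial sum; [maxn K N] makes it 0 as long as [N <= K]. *)
suff : \sum_(0 <= k < N) (if (K <= k)%N then r ^+ k else 0) <=
    (r ^+ K - r ^+ maxn K N) / (1 - r).
  move=> /le_trans; apply; rewrite ler_pM2r ?invr_gt0// gerBl.
  by rewrite exprn_ge0 ?ltW.
elim: N => [|N IH]; first by rewrite big_geq// maxn0 subrr mul0r.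
rewrite big_nat_recr//=; case: leqP => KN; last first.
  by rewrite addr0 (le_trans IH)// !(maxn_idPl _)// ltnW.
apply: (le_trans (lerD IH (lexx _))); rewrite !(maxn_idPr _)//; last exact: leqW.
rewrite -[X in _ + X](mulfK (lt0r_neq0 r1')) -mulrDl ler_pM2r ?invr_gt0// exprS.
by nra.
Qed.

Lemma powR_half_lt1 (s : R) : 0 < s -> 2^-1 `^ s < 1 :> R.
Proof.
move=> s0; rewrite -[ltRHS](_ : 1 `^ s = 1 :> R); last by rewrite powR1.
by apply: gt0_ltr_powR; rewrite ?nnegrE ?invr_ge0// invf_lt1// ltr1n.
Qed.

Lemma powR_expVn (s : R) (k : nat) : (2 ^- k : R) `^ s = (2^-1 `^ s) ^+ k.
Proof.
rewrite -powR_mulrn ?powR_ge0// -powRrM mulrC powRrM powR_mulrn ?invr_ge0//.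
by rewrite exprVn.
Qed.

(** Here [m] is an abstract mass of cubes, of total at most [L] in each generation. The cover takes
    the bad cubes of all generations from [K] on at once: overlaps between generations are paid for
    by the geometric series of ratio [r = 2 ^ (t' - t)], so no maximal cubes are selected. *)
Lemma hausdorff_content_le0 (S : set 'rV[R]_n) (t t' L : R)
    (m : nat -> 'rV[int]_n -> \bar R) (d : R) :
  0 < t -> t' < t -> 0 < d ->
  (forall k z, 0 <= m k z)%E ->
  (forall k (s : seq 'rV[int]_n), uniq s -> (\sum_(z <- s) m k z <= L%:E)%E) ->
  (forall x, S x -> forall K, exists2 k, (K <= k)%N &
     (((2 ^- k) `^ t')%:E <= m k (dyadic_index k x))%E) ->
  (hausdorff_content t d S <= 0)%E.
Proof.
move=> t0 tt' d0 m0 mL SP.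
pose r : R := 2^-1 `^ (t - t').
have r01 : 0 < r < 1.
  rewrite powR_gt0 ?invr_gt0//=.
  by apply: powR_half_lt1; rewrite subr_gt0.
pose C : R := n%:R `^ t * L / (1 - r).
apply/lee_addgt0Pr => eps eps0; rewrite add0e.
have [K [Kd Ke]] : exists K, (forall k, (K <= k)%N -> n%:R * 2 ^- k <= d) /\
    C * r ^+ K < eps.
  have [K1 hK1] : exists K1, forall k, (K1 <= k)%N -> 2 ^- k < d / n.+1%:R :> R.
    by apply: exp2V_lt; rewrite divr_gt0.
  have : `|r| < 1 by rewrite gtr0_norm; case/andP: r01.
  move=> /(cvg_geometric C) /cvgrPdist_lt /(_ _ eps0)[K2 _ hK2].
  exists (maxn K1 K2); split => [k|].
    rewrite geq_max => /andP[/hK1 Kk _]; rewrite ltr_pdivlMr// in Kk.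
    apply: le_trans (ltW Kk); rewrite mulrC ler_wpM2l ?invr_ge0 ?exprn_ge0//.
    by rewrite ler_nat.
  have := hK2 (maxn K1 K2); rewrite /= leq_maxr => /(_ isT).
  by rewrite sub0r normrN; apply: le_lt_trans; exact: ler_norm.
pose bad k z := (K <= k)%N && (((2 ^- k) `^ t')%:E <= m k z)%E.
pose E j : set 'rV[R]_n := if @pickle_inv (nat * 'rV[int]_n)%type j is Some p
  then (if bad p.1 p.2 then cube p.1 p.2 else set0) else set0.
pose a (p : nat * 'rV[int]_n) : \bar R := if bad p.1 p.2 then
  ((n%:R * 2 ^- p.1) `^ t)%:E else 0%E.
have a0 p : (0 <= a p)%E by rewrite /a; case: ifP => // _; rewrite lee_fin powR_ge0.
apply: (@le_trans _ _ (\sum_(k <oo) hausdorff_gauge t (E k))%E).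
  apply: ereal_inf_lbound; exists E => //; split.
    move=> j; rewrite /E; case: pickle_inv => [[k z]/=|].
      case: ifPn => [/andP[/Kd Kk _]|_].
        by apply: (le_trans (ediam_cube_le _ _)); rewrite lee_fin.
      by rewrite ediam_set0 leNye.
    by rewrite ediam_set0 leNye.
  move=> x /SP /(_ K)[k Kk mk]; exists (pickle (k, dyadic_index k x)) => //.
  by rewrite /E pickleK_inv /= /bad Kk mk; exact/cubeP.
apply: (@le_trans _ _ (\sum_(j <oo) (if pickle_inv j is Some x then a x else 0))%E).
  apply: lee_nneseries => [j _ _|j _]; first exact: hausdorff_gauge_ge0.
  rewrite /E; case: pickle_inv => [[k z]/=|].
    rewrite /a/=; case: ifP => _; first by apply: hausdorff_gauge_cube_le; exact: ltW.
    by rewrite /hausdorff_gauge asboolT.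
  by rewrite /hausdorff_gauge asboolT.
rewrite esum_pickle//.
have -> : [set: nat * 'rV[int]_n] = [set: nat] `*`` (fun=> [set: 'rV[int]_n]).
  by apply/seteqP; split.
rewrite -(@esum_esum _ _ _ [set: nat] (fun=> setT) (fun k z => a (k, z)))//.
apply: (@le_trans _ _ (\esum_(k in [set: nat])
   ((n%:R `^ t * L) * (if (K <= k)%N then r ^+ k else 0))%:E)%E).
  apply: le_esum => k _; apply: ge_ereal_sup => _ [X [finX _] <-].
  rewrite fsbig_finite//=.
  case: (leqP K k) => Kk; last first.
    by rewrite mulr0 big1// => z _; rewrite /a /bad /= leqNgt Kk.
  (* On a bad cube of side [l], [l ^ t = l ^ (t - t') * l ^ t'], the first factor is [r ^+ k] and
     the second is at most the mass. *)
  have aH (z : 'rV[int]_n) : (a (k, z) <= (n%:R `^ t * r ^+ k)%:E * m k z)%E.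
    rewrite /a /bad /= Kk /=; case: ifPn => [mz|_]; last first.
      by rewrite mule_ge0// lee_fin mulr_ge0 ?powR_ge0// exprn_ge0 ?powR_ge0.
    rewrite powRM ?invr_ge0 ?exprn_ge0// EFinM EFinM -muleA.
    rewrite lee_pmul ?lee_fin ?powR_ge0//.
    have -> : (2 ^- k : R) `^ t = r ^+ k * (2 ^- k) `^ t'.
      rewrite -powR_expVn -powRD ?subrK//.
      by apply/implyP => _; rewrite invr_eq0 expf_neq0.
    by rewrite EFinM lee_pmul2l// lte_fin exprn_gt0//; case/andP: r01.
  apply: (le_trans (lee_sum _ (fun z _ => aH z))).
  rewrite -ge0_sume_distrr//.
  have sL := mL k _ (finmap.fset_uniq (fset_set X)).
  rewrite mulrAC [leRHS]EFinM; apply: lee_pmul => //; last by apply: sume_ge0.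
  by rewrite lee_fin mulr_ge0 ?powR_ge0// exprn_ge0 ?powR_ge0.
have L0 : 0 <= L by have := mL 0%N [::] isT; rewrite big_nil lee_fin.
rewrite -nneseries_esumT; last first.
  move=> k; rewrite lee_fin mulr_ge0// ?mulr_ge0 ?powR_ge0//.
  by case: ifP => // _; rewrite exprn_ge0 ?powR_ge0.
apply: lime_le.
  apply: is_cvg_nneseries => k _ _; rewrite lee_fin mulr_ge0// ?mulr_ge0 ?powR_ge0//.
  by case: ifP => // _; rewrite exprn_ge0 ?powR_ge0.
apply: nearW => N; rewrite sumEFin -mulr_sumr lee_fin.
apply: (le_trans _ (ltW Ke)); rewrite /C -[leRHS]mulrA [_^-1 * _]mulrC.
by apply: ler_wpM2l; [rewrite mulr_ge0 ?powR_ge0|exact: geometric_tail_le].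
Qed.

Lemma hausdorff_measure_null (S : set 'rV[R]_n) (t t' L : R)
    (m : nat -> 'rV[int]_n -> \bar R) :
  0 < t -> t' < t ->
  (forall k z, 0 <= m k z)%E ->
  (forall k (s : seq 'rV[int]_n), uniq s -> (\sum_(z <- s) m k z <= L%:E)%E) ->
  (forall x, S x -> forall K, exists2 k, (K <= k)%N &
     (((2 ^- k) `^ t')%:E <= m k (dyadic_index k x))%E) ->
  hausdorff_measure t S = 0%E.
Proof.
move=> t0 tt' m0 mL SP; apply/eqP; rewrite eq_le; apply/andP; split.
  apply: ge_ereal_sup => _ [d d0 <-].
  exact: (hausdorff_content_le0 t0 tt' d0 m0 mL SP).
apply: le_ereal_sup_tmp; exists (hausdorff_content t 1 S); first by exists 1 => /=.
apply: le_ereal_inf_tmp => _ [E _ <-].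
by apply: nneseries_ge0 => k _ _; exact: hausdorff_gauge_ge0.
Qed.

End hausdorff_null.

(** * Mean oscillation *)

Section mean_oscillation.
Context d (T : measurableType d) (R : realType) (mu : {measure set T -> \bar R}).

Lemma integral_le_osc (Q : set T) (f : T -> R) (c v w : R) :
  measurable Q -> measurable_fun Q f ->
  mu Q = v%:E ->
  (\int[mu]_(x in Q) `|f x - c|%:E <= w%:E)%E ->
  (\int[mu]_(x in Q) `|f x|%:E <= (w + `|c| * v)%:E)%E.
Proof.
move=> mQ mf Qv fw.
have mfc : measurable_fun Q (fun x : T => `|f x - c|%:E).
  by apply/measurable_EFinP; apply: measurableT_comp => //; exact: measurable_funB.
rewrite EFinD EFinM -Qv -integral_cst//.
apply: (le_trans _ (leeD2r _ fw)); rewrite -ge0_integralD//; last first.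
  by move=> x _; rewrite lee_fin.
apply: ge0_le_integral => //.
- by apply/measurable_EFinP; exact: measurableT_comp.
- by apply: emeasurable_funD => //; exact: measurable_cst.
- by move=> x _ /=; rewrite -EFinD lee_fin -[X in `|X| <= _](subrK c) ler_normD.
Qed.

(** Together with [integral_le_osc] this compares the integrals of [|f|] over a cube and over a
    subcube through a constant [c] that need not be the mean. *)
Lemma osc_le_integral (Q P : set T) (f : T -> R) (c v w : R) :
  measurable Q -> measurable P -> P `<=` Q ->
  measurable_fun Q f ->
  mu P = v%:E ->
  (\int[mu]_(x in Q) `|f x - c|%:E <= w%:E)%E ->
  ((`|c| * v)%:E <= w%:E + \int[mu]_(x in P) `|f x|%:E)%E.
Proof.
move=> mQ mP PQ mf Pv fw.
have mfc : measurable_fun Q (fun x : T => `|f x - c|%:E).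
  by apply/measurable_EFinP; apply: measurableT_comp => //; exact: measurable_funB.
have mfP : measurable_fun P f by exact: measurable_funS PQ mf.
have mfcP : measurable_fun P (fun x : T => `|f x - c|%:E).
  exact: measurable_funS PQ mfc.
have nfP : measurable_fun P (fun x : T => `|f x|%:E).
  by apply/measurable_EFinP; exact: measurableT_comp.
rewrite EFinM -Pv -integral_cst//.
apply: (@le_trans _ _ (\int[mu]_(x in P) (`|f x - c|%:E + `|f x|%:E))%E).
  apply: ge0_le_integral => //.
  - by move=> x _; rewrite lee_fin.
  - exact: emeasurable_funD.
  - move=> x _ /=; rewrite -EFinD lee_fin distrC.
    by rewrite -[X in `|X| <= _](subrK (f x)) ler_normD.
rewrite ge0_integralD//; apply: leeD => //.
by apply: (le_trans _ fw); apply: ge0_subset_integral.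
Qed.

Lemma abs_powN_ge0 (alpha y : R) : (0 <= abs_powN alpha y)%E.
Proof. by rewrite /abs_powN; case: ifP => // _; rewrite lee_fin powR_ge0. Qed.

(** If [|y| >= M], the first term is at least 1; otherwise the second is, being infinite for
    [y = 0]. *)
Lemma one_le_abs_powN (alpha M y : R) : 0 < alpha -> 0 < M ->
  (1 <= (M^-1)%:E * `|y|%:E + (M `^ alpha)%:E * abs_powN alpha y)%E.
Proof.
move=> a0 M0; have Ma : 0 < M `^ alpha by rewrite powR_gt0.
rewrite /abs_powN; case: ifPn => [/eqP ->|y0].
  by rewrite normr0 mule0 add0e gt0_muley ?lte_fin// leey.
rewrite -!EFinM -EFinD lee_fin.
have [My|yM] := leP M `|y|.
  rewrite -[X in X <= _]addr0 lerD ?mulr_ge0 ?powR_ge0//.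
  by rewrite mulrC ler_pdivlMr// mul1r.
rewrite -[X in X <= _]add0r lerD ?mulr_ge0 ?invr_ge0// ?(ltW M0)//.
rewrite powRN ler_pdivlMr ?powR_gt0 ?normr_gt0// mul1r.
by apply: ge0_ler_powR; rewrite ?nnegrE// ltW.
Qed.

Lemma volume_le (Q : set T) (f : T -> R) (h : T -> \bar R)
    (alpha M v a b : R) : 0 < alpha -> 0 < M ->
  measurable Q -> measurable_fun Q f -> measurable_fun Q h ->
  (forall x, Q x -> (abs_powN alpha (f x) <= h x)%E) ->
  mu Q = v%:E ->
  (\int[mu]_(x in Q) `|f x|%:E <= a%:E)%E ->
  (\int[mu]_(x in Q) h x <= b%:E)%E ->
  v <= M^-1 * a + M `^ alpha * b.
Proof.
move=> a0 M0 mQ mf mh hf Qv fa hb.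
have h0 x : Q x -> (0 <= h x)%E.
  by move=> Qx; apply: le_trans (hf x Qx); exact: abs_powN_ge0.
have M1 : 0 <= M^-1 by rewrite invr_ge0 ltW.
have nf : measurable_fun Q (fun x : T => `|f x|%:E).
  by apply/measurable_EFinP; exact: measurableT_comp.
rewrite -lee_fin -Qv -[X in (X <= _)%E]mul1e -integral_cst//.
rewrite EFinD !EFinM.
apply: (@le_trans _ _ (\int[mu]_(x in Q)
    ((M^-1)%:E * `|f x|%:E + (M `^ alpha)%:E * h x))%E).
  apply: ge0_le_integral => //.
  - by apply: emeasurable_funD; exact: measurable_funeM.
  - move=> x Qx; apply: (le_trans (one_le_abs_powN (f x) a0 M0)).
    by rewrite leeD2l// lee_pmul2l ?hf// lte_fin powR_gt0.
rewrite ge0_integralD//.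
- rewrite !ge0_integralZl ?lee_fin ?powR_ge0//.
  by rewrite leeD// lee_wpmul2l ?lee_fin ?powR_ge0.
- by move=> x Qx; rewrite mule_ge0.
- exact: measurable_funeM.
- by move=> x Qx; rewrite mule_ge0 ?lee_fin ?powR_ge0// h0.
- exact: measurable_funeM.
Qed.

End mean_oscillation.

(** * The covering argument *)

Section covering.
Context {R : realType} {n : nat}.
Implicit Types (Omega : set 'rV[R]_n) (f : 'rV[R]_n -> R).

Lemma powR_small (C s eps : R) : 0 <= C -> 0 < s -> 0 < eps ->
  exists K, forall k, (K <= k)%N -> C * (2 ^- k) `^ s < eps.
Proof.
move=> C0 s0 eps0; pose r : R := 2^-1 `^ s.
have r0 : 0 < r by rewrite powR_gt0 ?invr_gt0.
have r1 : r < 1 by exact: powR_half_lt1.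
have : `|r| < 1 by rewrite gtr0_norm.
move=> /(cvg_geometric C) /cvgrPdist_lt /(_ _ eps0)[K _ hK].
exists K => k Kk; rewrite powR_expVn; have := hK k Kk.
by rewrite /= sub0r normrN; apply: le_lt_trans; exact: ler_norm.
Qed.

(** The closure of [dyadic_box]. Requiring it to lie in [Omega] gives test functions supported on
    the box a compact support in [Omega], and makes locally integrable functions integrable on the
    box. *)
Definition closed_box (e : 'I_n -> nat) (z : 'I_n -> int) : set 'rV[R]_n :=
  [set y | forall i, (z i)%:~R / 2 ^+ e i <= y 0 i <= (z i + 1)%:~R / 2 ^+ e i].

Lemma dyadic_box_closed e z : dyadic_box e z `<=` closed_box e z.
Proof.
move=> x xe i; have := xe i; rewrite dyadic_itvE /= in_itv /=.
by case/andP => -> /ltW.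
Qed.

Lemma sum_cube_integral (D : set (leb_rV R n)) (h : leb_rV R n -> \bar R)
    k (s : seq 'rV[int]_n) : measurable D -> measurable_fun D h ->
  (forall x, D x -> 0 <= h x)%E -> uniq s ->
  (\sum_(z <- s) \int[lebesgue_rV]_(x in D `&` (cube k z : set (leb_rV R n))) h x
    <= \int[lebesgue_rV]_(x in D) h x)%E.
Proof.
move=> mD mh h0 us.
have mU (A : set (leb_rV R n)) : A `<=` D -> measurable_fun D h -> measurable A ->
    measurable_fun A h.
  by move=> AD mhD mA; exact: measurable_funS AD mhD.
have sub : \big[setU/set0]_(z <- s) (D `&` (cube k z : set (leb_rV R n))) `<=` D.
  by rewrite -bigcup_seq => x [z _ []].
have mC (z : 'rV[int]_n) : measurable (D `&` (cube k z : set (leb_rV R n))).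
  by apply: measurableI => //; exact: measurable_dyadic_box.
rewrite -ge0_integral_bigsetU//.
- apply: ge0_subset_integral => //.
  by apply: bigsetU_measurable => z _; exact: mC.
- apply/trivIsetP => z z' _ _ zz'; rewrite -subset0 => x [[_ /cubeP xz] [_ /cubeP xz']].
  by move: zz'; rewrite -xz -xz' eqxx.
- by apply: mU => //; apply: bigsetU_measurable => z _; exact: mC.
- by move=> x /sub; exact: h0.
Qed.

Lemma enorm_lt_coord (v : 'rV[R]_n) (r : R) i : enorm v < r -> `|v 0 i| < r.
Proof.
apply: le_lt_trans; rewrite /enorm -sqrtr_sqr ler_wsqrtr//.
by rewrite (bigD1 i)//= lerDl sumr_ge0// => j _; exact: sqr_ge0.
Qed.

Lemma measurable_enormB (x : 'rV[R]_n) :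
  measurable_fun [set: leb_rV R n] (fun y : leb_rV R n => enorm (y - x) : R).
Proof.
apply: (measurableT_comp (f := @Num.sqrt R)).
  by apply: continuous_measurable_fun; exact: sqrt_continuous.
apply: measurable_sum => i; apply: measurable_funX.
rewrite (_ : (fun y : leb_rV R n => _) = (fun y => rV_coord i y - x 0 i)); last first.
  by apply/funext => y; rewrite !mxE.
by apply: measurable_funB => //; exact: measurable_leb_rV_coord.
Qed.

Lemma measurable_eball (x : 'rV[R]_n) r : measurable (eball x r : set (leb_rV R n)).
Proof.
have -> : eball x r = setT `&` (fun y : leb_rV R n => enorm (y - x) : R) @^-1` `]-oo, r[%classic.
  by rewrite setTI; apply/seteqP; split => y; rewrite /eball /= in_itv.
by apply: measurable_enormB => //; exact: measurable_itv.
Qed.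

Lemma lebesgue_eball_le (x : 'rV[R]_n) r : 0 <= r ->
  (lebesgue_rV (eball x r : set (leb_rV R n)) <= ((2 * r) ^+ n)%:E)%E.
Proof.
move=> r0; pose A i : set R := `]x 0 i - r, x 0 i + r[%classic.
have mA i : measurable (A i) by exact: measurable_itv.
have sub : eball x r `<=` [set v : 'rV[R]_n | forall i, A i (v 0 i)].
  move=> y /enorm_lt_coord yr i; have := yr i.
  by rewrite !mxE /A /= in_itv /= ltr_distl.
apply: (@le_trans _ _ (lebesgue_rV ([set v : 'rV[R]_n | forall i, A i (v 0 i)] : set (leb_rV R n)))).
  apply: le_measure => //; rewrite inE; first exact: measurable_eball.
  by apply: measurable_leb_rV; exact: measurable_rV_box.
rewrite lebesgue_rV_box// (eq_bigr (fun=> (2 * r)%:E)).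
  by rewrite prodEFin prodr_const card_ord.
move=> i _; rewrite lebesgue_measure_itv/= lte_fin.
case: ifPn => [_|]; first by rewrite -EFinB; congr EFin; ring.
rewrite -leNgt => h; congr EFin; lra.
Qed.

Lemma zero_average_cubes Omega f x : (0 < n)%N -> open Omega ->
  measurable_fun (Omega : set (leb_rV R n)) (f : leb_rV R n -> R) ->
  zero_average_set Omega f x -> forall eps : R, 0 < eps ->
  exists K, forall k, (K <= k)%N ->
    (\int[lebesgue_rV]_(y in (cube k (dyadic_index k x) : set (leb_rV R n)))
      `|f y|%:E <= (eps * 2 ^- (k * n))%:E)%E.
Proof.
move=> n0 oO mf [Ox fx0] eps eps0.
have n0R : 0 < n%:R :> R by rewrite ltr0n.
(* The ball used below has radius [2 n] times the side of the cube, so it lies in a box whose volume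
   is [(4 n) ^ n] times that of the cube. *)
pose e := eps / (4 * n%:R) ^+ n.
have e0 : 0 < e by rewrite divr_gt0// exprn_gt0// mulr_gt0.
have [d [d0 dO]] := open_cube_sub oO Ox.
have [r1 r10 r1P] : exists2 r1 : R, 0 < r1 &
    forall r, 0 < r < r1 -> (abs_average f (eball x r) <= e%:E)%E.
  have : \forall r \near (0 : R)^'+, (abs_average f (eball x r) < e%:E)%E.
    by apply: (fx0 [set y | (y < e%:E)%E]); apply: open_ereal_lt'; rewrite lte_fin.
  case=> r1 /= r10 h; exists r1 => // r /andP[r0 rr1]; apply: ltW; apply: h => //=.
  by rewrite sub0r normrN gtr0_norm.
have rd : 0 < Num.min r1 d / (2 * n%:R) by rewrite divr_gt0 ?lt_min ?r10 ?d0// mulr_gt0.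
have [K hK] := exp2V_lt rd; exists K => k /hK.
rewrite ltr_pdivlMr ?mulr_gt0// lt_min; set r := 2 ^- k * (2 * n%:R).
have r0 : 0 < r by rewrite mulr_gt0 ?mulr_gt0// invr_gt0 exprn_gt0.
move=> /andP[rr1 rd1].
set B := eball x r : set (leb_rV R n).
have BO : B `<=` Omega.
  move=> y yB; apply: dO => i; rewrite distrC.
  by have := enorm_lt_coord i yB; rewrite !mxE => /lt_trans; apply.
have mB : measurable B by exact: measurable_eball.
have QB : (cube k (dyadic_index k x) : set (leb_rV R n)) `<=` B.
  move=> y yk; rewrite /B /eball /=.
  apply: (@le_lt_trans _ _ (n%:R * 2 ^- k)).
    apply: enorm_le => [|i]; first by rewrite invr_ge0 exprn_ge0.
    by rewrite !mxE; apply: ltW; apply: (cube_coord_lt i yk); exact/cubeP.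
  by rewrite /r mulrA mulrC ltr_pM2r// ltr_pMr ?invr_gt0 ?exprn_gt0// ltr1n.
(* The average is a product with an extended inverse, which can be moved across the inequality once
   the measure is known to be finite and positive. *)
have Bfin : lebesgue_rV B \is a fin_num.
  by rewrite ge0_fin_numE// (le_lt_trans (lebesgue_eball_le _ (ltW r0)))// ltry.
have Bpos : (0 < lebesgue_rV B)%E.
  apply: (@lt_le_trans _ _ (lebesgue_rV (cube k (dyadic_index k x) : set (leb_rV R n)))).
    by rewrite lebesgue_cube lte_fin invr_gt0 exprn_gt0.
  by apply: le_measure; rewrite ?inE//; exact: measurable_dyadic_box.
have := r1P r; rewrite r0 rr1 => /(_ isT); rewrite /abs_average -/B => fB.
have mfB : measurable_fun B (fun x : leb_rV R n => `|f x|%:E).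
  apply/measurable_EFinP; apply: measurableT_comp => //.
  by apply: measurable_funS BO mf; exact: open_measurable_leb_rV.
apply: (@le_trans _ _ (\int[lebesgue_rV]_(y in B) `|f y|%:E)%E).
  by apply: ge0_subset_integral => //; exact: measurable_dyadic_box.
have {fB} : (\int[lebesgue_rV]_(y in B) `|f y|%:E <= lebesgue_rV B * e%:E)%E.
  move: fB; move: (integral _ _ _) => I.
  rewrite -(fineK Bfin) inver; case: ifPn => [/eqP B0|B0].
    by move: Bpos; rewrite -(fineK Bfin) B0 ltxx.
  by rewrite lee_pdivrMl// -lte_fin fineK.
move=> /le_trans; apply.
apply: (le_trans (lee_wpmul2r _ (lebesgue_eball_le _ (ltW r0)))).
  by rewrite lee_fin ltW.
rewrite -EFinM lee_fin /e /r exprM.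
have -> : (2 * (2 ^- k * (2 * n%:R))) ^+ n = (4 * n%:R) ^+ n * ((2 ^+ k) ^+ n)^-1 :> R.
  by rewrite -(exprVn (2 ^+ k) n) -exprMn; congr (_ ^+ n); ring.
by rewrite mulrAC mulrCA divff ?mulr1// expf_neq0// mulf_neq0// lt0r_neq0.
Qed.

(** The steps sum to a geometric series with factor [D = C / (1 - rho)]. The claim [H] carries its
    exact partial sum, and the remaining term [a (k + j)] is made at most [eps] by the third
    hypothesis. *)
Lemma telescope_decay (a : nat -> R) (C beta : R) (K : nat) : 0 < beta ->
  (forall k, (K <= k)%N -> a k <= C * (2 ^- k) `^ beta + a k.+1) ->
  (forall eps, 0 < eps -> exists K', forall k, (K' <= k)%N -> a k <= eps) ->
  0 <= C ->
  forall k, (K <= k)%N -> a k <= C / (1 - 2^-1 `^ beta) * (2 ^- k) `^ beta.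
Proof.
move=> b0 step lim C0 k Kk; pose rho : R := 2^-1 `^ beta.
have rho1 : rho < 1 by exact: powR_half_lt1.
have rho0 : 0 <= rho by exact: powR_ge0.
have r1 : 0 < 1 - rho by rewrite subr_gt0.
pose D := C / (1 - rho); have D0 : 0 <= D by rewrite divr_ge0// ltW.
have DE : D * (1 - rho) = C by rewrite /D divfK// lt0r_neq0.
rewrite -/rho -/D.
have H j : a k <= a (k + j)%N + D * ((2 ^- k) `^ beta - (2 ^- (k + j)) `^ beta).
  elim: j => [|j IH]; first by rewrite addn0 subrr mulr0 addr0.
  have := step (k + j)%N (leq_trans Kk (leq_addr _ _)).
  move: IH; rewrite addnS !powR_expVn -/rho exprS -DE.
  move: (a (k + j)%N) (a (k + j).+1) (rho ^+ k) (rho ^+ (k + j)) => x y u v.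
  nra.
apply/ler_addgt0Pr => eps /lim [K' hK'].
have := H K'; have := hK' (k + K')%N (leq_addl _ _).
have : 0 <= D * (2 ^- (k + K')) `^ beta by rewrite mulr_ge0// powR_ge0.
rewrite mulrBr; lra.
Qed.

(** The seminorm enters only through the last hypothesis, an oscillation bound on good cubes whose
    closure lies in [Omega]; all the seminorms share this argument. *)
Lemma hausdorff_zero_average Omega f (h : leb_rV R n -> \bar R)
    (C beta gamma alpha t' t : R) :
  (0 < n)%N -> open Omega ->
  measurable_fun (Omega : set (leb_rV R n)) (f : leb_rV R n -> R) ->
  measurable_fun (Omega : set (leb_rV R n)) h ->
  (forall x : 'rV[R]_n, Omega x -> (abs_powN alpha (f x) <= h x)%E) ->
  (\int[lebesgue_rV]_(x in (Omega : set (leb_rV R n))) h x < +oo)%E ->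
  0 < alpha -> 0 <= C -> 0 < beta -> gamma < beta -> n%:R - t' < alpha * gamma ->
  0 < t -> t' < t ->
  (forall k (z : 'rV[int]_n), closed_box (fun=> k) (fun i => z 0 i) `<=` Omega ->
    (\int[lebesgue_rV]_(x in (cube k z : set (leb_rV R n))) h x
       <= ((2 ^- k) `^ t')%:E)%E ->
    exists c : R,
    (\int[lebesgue_rV]_(x in (cube k z : set (leb_rV R n))) `|f x - c|%:E
       <= (C * (2 ^- k) `^ beta * 2 ^- (k * n))%:E)%E) ->
  hausdorff_measure t (zero_average_set Omega f) = 0%E.
Proof.
move=> n0 oO mf mh hf hoo a0 C0 b0 gb gn t0 tt' osc.
have mO : measurable (Omega : set (leb_rV R n)) by exact: open_measurable_leb_rV.
have h0 x : Omega x -> (0 <= h x)%E.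
  by move=> /hf; apply: le_trans; exact: abs_powN_ge0.
(* Nothing is known about [h] outside [Omega], which a cube may leave; for the small cubes at a
   point of [Omega] the intersection changes nothing. *)
pose m k (z : 'rV[int]_n) := (\int[lebesgue_rV]_(x in
  (Omega : set (leb_rV R n)) `&` (cube k z : set (leb_rV R n))) h x)%E.
have Ifin : (\int[lebesgue_rV]_(x in (Omega : set (leb_rV R n))) h x)%E \is a fin_num.
  by rewrite ge0_fin_numE//; apply: integral_ge0.
apply: (@hausdorff_measure_null _ _ _ t t'
  (fine (\int[lebesgue_rV]_(x in (Omega : set (leb_rV R n))) h x)%E) m) => //.
- by move=> k z; apply: integral_ge0 => x [/h0].
- by move=> k s us; rewrite fineK//; exact: sum_cube_integral.
move=> x Sx K0; apply: contrapT => Nbad.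
have [Ox _] := Sx.
pose Q k := cube k (dyadic_index k x) : set (leb_rV R n).
have mQ k : measurable (Q k) by exact: measurable_dyadic_box.
have [K1 inside] := open_cubes oO Ox.
have insideQ k : (K1 <= k)%N ->
    closed_box (fun=> k) (fun i => dyadic_index k x 0 i) `<=` Omega.
  move=> Kk y yk; apply: (inside k Kk) => i.
  have /andP[y1 y2] := yk i.
  have xQ : cube k (dyadic_index k x) x by exact/cubeP.
  have /andP[x1 x2] := dyadic_box_closed xQ i.
  move: x1 x2 y1 y2; rewrite intrD mulrDl mul1r ler_norml; lra.
have QO k : (K1 <= k)%N -> Q k `<=` Omega.
  by move=> Kk; apply: subset_trans (insideQ _ Kk); exact: dyadic_box_closed.
have mfQ k : (K1 <= k)%N -> measurable_fun (Q k) (f : leb_rV R n -> R).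
  by move=> Kk; apply: measurable_funS (QO _ Kk) mf.
have hQ k : (maxn K0 K1 <= k)%N ->
    (\int[lebesgue_rV]_(y in Q k) h y <= ((2 ^- k) `^ t')%:E)%E.
  rewrite geq_max => /andP[k0 k1]; rewrite leNgt; apply/negP => hk.
  apply: Nbad; exists k => //; apply: ltW.
  by rewrite /m (_ : _ `&` _ = Q k)//; apply/setIidr/QO.
pose I k := (\int[lebesgue_rV]_(y in Q k) `|f y|%:E)%E.
have vQ k : lebesgue_rV (Q k) = (2 ^- (k * n) : R)%:E by exact: lebesgue_cube.
have QS k : Q k.+1 `<=` Q k.
  move=> y /cubeP yk; apply/cubeP/rowP => i.
  move/rowP : yk => /(_ i); rewrite !mxE; exact: floor_coarse.
(* With [w] the oscillation bound, [I k <= w + |c| |Q k|], and [|c| |Q k.+1| <= w + I k.+1]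
   eliminates [c]. The child has [2 ^+ n] times less volume, hence the factor [1 + 2 ^+ n].
   Finiteness of [I k] also comes from the oscillation bound. *)
have key k : (maxn K0 K1 <= k)%N -> (I k < +oo)%E /\
    (I k <= (C * (2 ^- k) `^ beta * 2 ^- (k * n) * (1 + 2 ^+ n))%:E +
       (2 ^+ n)%:E * I k.+1)%E.
  move=> kk; have /andP[k0 k1] : (K0 <= k)%N && (K1 <= k)%N by rewrite -geq_max.
  have [c cQ] := osc k _ (insideQ k k1) (hQ k kk).
  have I1 := integral_le_osc (mQ k) (mfQ k k1) (vQ k) cQ.
  split; first by apply: (le_lt_trans I1); rewrite ltry.
  have I2 := osc_le_integral (mQ k) (mQ k.+1) (@QS k) (mfQ k k1) (vQ k.+1) cQ.
  apply: (le_trans I1).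
  have vE : 2 ^- (k * n) = 2 ^+ n * 2 ^- (k.+1 * n) :> R.
    by rewrite mulSn exprD invfM mulVKf// expf_neq0.
  have : (0 <= I k.+1)%E by apply: integral_ge0.
  move: I2; rewrite -/(I k.+1).
  move: (C * (2 ^- k) `^ beta * 2 ^- (k * n)) => w; rewrite {}vE.
  move: (2 ^- (k.+1 * n)) => v; move: (I k.+1) => [r||] //= + _.
    rewrite -EFinM -!EFinD !lee_fin => cw.
    have : 0 <= 2 ^+ n :> R by rewrite exprn_ge0.
    by move=> /ler_wpM2l /(_ _ _ cw); lra.
  by move=> _; rewrite gt0_muley ?lte_fin ?exprn_gt0// addey// leey.
have kp k : 0 < 2 ^+ (k * n) :> R by rewrite exprn_gt0.
(* The average of [|f|] over [Q k], as a real number. *)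
pose a k := fine (I k) * 2 ^+ (k * n).
have I0 k : (0 <= I k)%E by apply: integral_ge0.
have Ik k : (maxn K0 K1 <= k)%N -> I k = (a k * 2 ^- (k * n))%:E.
  by move=> /key[Ioo _]; rewrite /a mulfK ?lt0r_neq0// fineK// ge0_fin_numE.
have decay := @telescope_decay a (C * (1 + 2 ^+ n)) beta (maxn K0 K1) b0.
have {}decay k : (maxn K0 K1 <= k)%N ->
    a k <= C * (1 + 2 ^+ n) / (1 - 2^-1 `^ beta) * (2 ^- k) `^ beta.
  apply: decay; last by rewrite mulr_ge0// addr_ge0.
    move=> {}k kk; have [_] := key k kk.
    rewrite Ik// Ik ?(leqW kk)// -EFinM -EFinD lee_fin.
    rewrite -(ler_pM2r (kp k)) mulfVK ?lt0r_neq0//.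
    move=> /le_trans; apply; rewrite le_eqVlt; apply/orP; left; apply/eqP.
    rewrite mulSn exprD; field.
    by rewrite !expf_neq0.
  move=> eps eps0; have [K2 hK2] := zero_average_cubes n0 oO mf Sx eps0.
  exists (maxn (maxn K0 K1) K2) => {}k; rewrite geq_max => /andP[kk k2].
  by have := hK2 k k2; rewrite -/(Q k) -/(I k) Ik// lee_fin ler_pM2r ?invr_gt0.
set C' := C * (1 + 2 ^+ n) / (1 - 2^-1 `^ beta) in decay.
have C'0 : 0 <= C'.
  apply: divr_ge0; first by rewrite mulr_ge0// addr_ge0// exprn_ge0.
  by rewrite subr_ge0 ltW// powR_half_lt1.
(* After division by the volume, the right-hand side of [volume_le] with [M = l ^ gamma] consists of
   two terms; each is made smaller than one half. *)
have [K2 hK2] : exists K, forall k, (K <= k)%N -> C' * (2 ^- k) `^ (beta - gamma) < 2^-1.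
  by apply: powR_small; rewrite ?subr_gt0 ?invr_gt0.
have [K3 hK3] : exists K, forall k, (K <= k)%N ->
    1 * (2 ^- k) `^ (alpha * gamma + t' - n%:R) < 2^-1 :> R.
  by apply: powR_small => //; lra.
pose k := maxn (maxn K0 K1) (maxn K2 K3).
have kk : (maxn K0 K1 <= k)%N by exact: leq_maxl.
have k2 : (K2 <= k)%N by rewrite /k !leq_max leqnn !orbT.
have k3 : (K3 <= k)%N by rewrite /k !leq_max leqnn !orbT.
have k1 : (K1 <= k)%N by rewrite /k !leq_max leqnn !orbT.
have l0 : 0 < 2 ^- k :> R by rewrite invr_gt0 exprn_gt0.
have M0 : 0 < (2 ^- k) `^ gamma :> R by rewrite powR_gt0.
have Ia : (\int[lebesgue_rV]_(y in Q k) `|f y|%:E <= (a k * 2 ^- (k * n))%:E)%E.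
  by rewrite -Ik.
have mhQ : measurable_fun (Q k) h by exact: measurable_funS (QO _ k1) mh.
have := volume_le a0 M0 (mQ k) (mfQ k k1) mhQ (fun y Qy => hf y (QO k k1 y Qy))
  (vQ k) Ia (hQ k kk).
apply/negP; rewrite -ltNge.
have := hK2 k k2; have := hK3 k k3; have := decay k kk.
have lne : forall r s : R, (r == s) ==> (2 ^- k != 0 :> R).
  by move=> r s; apply/implyP => _; rewrite lt0r_neq0.
rewrite mul1r !powRB// powRD; last by apply/implyP => _; rewrite lt0r_neq0.
have -> : (2 ^- k) `^ n%:R = 2 ^- (k * n) :> R.
  by rewrite powR_mulrn ?(ltW l0)// exprVn -exprM.
rewrite -powRrM (mulrC gamma).
have P0 : 0 < 2 ^- (k * n) :> R by rewrite invr_gt0.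
move: M0 P0; move: (2 ^- (k * n)) (a k) => P ak.
move: (_ `^ gamma) (_ `^ beta) (_ `^ (alpha * gamma)) (_ `^ t') => M B A T M0 P0.
rewrite ltr_pdivrMr// => aB ATP; rewrite mulrA ltr_pdivrMr// => BM.
rewrite mulrA -(ltr_pM2l M0) mulrDr !mulrA divff ?lt0r_neq0// mul1r.
have : ak * P <= C' * B * P by rewrite ler_pM2r.
have : C' * B * P < 2^-1 * M * P by rewrite ltr_pM2r.
have : M * (A * T) < M * (2^-1 * P) by rewrite ltr_pM2l.
lra.
Qed.

End covering.

(** * Fractional seminorms *)

(** Extending the kernel by 0 off [D] reduces the claim to Tonelli's theorem on the whole space. *)
Lemma measurable_partial_integral d (T : measurableType d) (R : realType)
    (mu : {sigma_finite_measure set T -> \bar R}) (D : set T)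
    (K : T * T -> \bar R) :
  measurable D -> measurable_fun [set: T * T] K -> (forall p, 0 <= K p)%E ->
  measurable_fun [set: T] (fun y => \int[mu]_(x in D) K (y, x))%E.
Proof.
move=> mD mK K0.
have mKD : measurable_fun [set: T * T] (K \_ (setT `*` D)).
  apply/(measurable_restrictT K) => //; first exact: measurableX.
  exact: measurable_funTS.
have KD0 p : (0 <= (K \_ (setT `*` D)) p)%E by rewrite patchE; case: ifP.
have := measurable_fun_fubini_tonelli_F (m2 := mu) _ mKD KD0.
congr (measurable_fun _ _); apply/funext => y.
rewrite /fubini_F [RHS]integral_mkcond; apply: eq_integral => x _.
by rewrite !patchE in_setX in_setT.
Qed.

(** If [h] exceeded [2 b] throughout [Q], its integral would be at least [2 b v > b v]; the factor 2
    provides the strict inequality. *)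
Lemma exists_le_average d (T : measurableType d) (R : realType)
    (mu : {measure set T -> \bar R}) (Q : set T) (h : T -> \bar R) (b v : R) :
  measurable Q -> measurable_fun Q h -> mu Q = v%:E -> 0 < v -> 0 < b ->
  (\int[mu]_(x in Q) h x <= (b * v)%:E)%E ->
  exists2 z, Q z & (h z <= (2 * b)%:E)%E.
Proof.
move=> mQ mh Qv v0 b0 hb; apply: contrapT => /forall2NP N.
have : (\int[mu]_(x in Q) (cst (2 * b)%:E) x <= \int[mu]_(x in Q) h x)%E.
  apply: ge0_le_integral => //.
  - by move=> x _; rewrite lee_fin mulr_ge0// ltW.
  - by move=> x Qx; case: (N x) => // /negP; rewrite -ltNge => /ltW.
rewrite integral_cst// Qv -EFinM => /le_trans /(_ hb); apply/negP.
by rewrite -ltNge lte_fin ltr_pM2r// ltr_pMl// ltr1n.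
Qed.

(** The integrated form of a Young bound: [G] is an energy density, and [u] is an oscillation or the
    length of a gradient. *)
Lemma integral_affine_le d (T : measurableType d) (R : realType)
    (mu : {measure set T -> \bar R}) (Q : set T) (u G : T -> R) (A B v w : R) :
  measurable Q -> measurable_fun Q u -> measurable_fun Q G -> mu Q = v%:E ->
  0 <= A -> 0 <= B -> (forall x, Q x -> 0 <= G x) ->
  (forall x, Q x -> 0 <= u x <= A + B * G x) ->
  (\int[mu]_(x in Q) (G x)%:E <= w%:E)%E ->
  (\int[mu]_(x in Q) (u x)%:E <= (A * v + B * w)%:E)%E.
Proof.
move=> mQ mu_ mG Qv A0 B0 G0 uG Gw.
have mG' : measurable_fun Q (EFin \o G) by exact/measurable_EFinP.
apply: (@le_trans _ _ (\int[mu]_(x in Q) (A%:E + B%:E * (G x)%:E))%E).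
  apply: ge0_le_integral => //.
  - by move=> x /uG /andP[].
  - exact/measurable_EFinP.
  - by apply: emeasurable_funD => //; exact: measurable_funeM.
  - by move=> x /uG /andP[].
rewrite ge0_integralD//; last 2 first.
- by move=> x /G0 Gx; rewrite mule_ge0 ?lee_fin.
- exact: measurable_funeM.
rewrite integral_cst// Qv ge0_integralZl//.
by rewrite EFinD !EFinM leeD2l// lee_wpmul2l.
Qed.

Lemma measurable_dist_cst d (T : measurableType d) (R : realType) (D Q : set T)
    (f : T -> R) (c : R) : measurable D -> Q `<=` D -> measurable_fun D f ->
  measurable_fun Q (fun x => `|f x - c|).
Proof.
move=> mD QD mf; apply: measurableT_comp => //; apply: measurable_funB => //.
exact: measurable_funS QD mf.
Qed.

Section fractional.
Context {R : realType} {n : nat}.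
Implicit Types (Omega : set 'rV[R]_n) (f : 'rV[R]_n -> R).

(* Used instead of Hoelder's inequality: the choice [M = l^((t' - n) / q)] gives
   the same powers of [l]. *)
Lemma le_young (M q b : R) : 0 < M -> 1 <= q -> 0 <= b ->
  b <= M + M `^ (1 - q) * b `^ q.
Proof.
move=> M0 q1 b0; have [bM|Mb] := leP b M.
  by rewrite -[leLHS]addr0 lerD// mulr_ge0 ?powR_ge0.
rewrite -[leLHS]add0r lerD ?(ltW M0)//.
have bp : 0 < b by exact: lt_trans Mb.
have -> : M `^ (1 - q) = M / M `^ q.
  by rewrite powRB ?powRr1 ?(ltW M0)//; apply/implyP; rewrite lt0r_neq0.
have -> : b `^ q = b * b `^ (q - 1) by rewrite mulr_powRB1//; lra.
have -> : M `^ q = M * M `^ (q - 1) by rewrite mulr_powRB1 ?(ltW M0)//; lra.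
rewrite invfM mulVKf ?lt0r_neq0// mulrCA.
rewrite -[leLHS]mulr1 ler_pM2l// mulrC ler_pdivlMr ?powR_gt0// mul1r.
by apply: ge0_ler_powR; rewrite ?nnegrE ?subr_ge0// ltW.
Qed.

Lemma enorm_ge0 (v : 'rV[R]_n) : 0 <= enorm v.
Proof. exact: sqrtr_ge0. Qed.

Lemma enorm_eq0 (v : 'rV[R]_n) : enorm v = 0 -> v = 0.
Proof.
move=> /eqP; rewrite sqrtr_eq0 => v0.
have {v0} /eqP : \sum_(i < n) v 0 i ^+ 2 = 0.
  by apply/eqP; rewrite eq_le v0 sumr_ge0// => i _; exact: sqr_ge0.
rewrite psumr_eq0 => [/allP v0|i _]; last exact: sqr_ge0.
apply/rowP => i; rewrite mxE; have := v0 i (mem_index_enum _).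
by rewrite sqrf_eq0 => /eqP.
Qed.

Lemma cube_enorm_le k (z : 'rV[int]_n) (x y : 'rV[R]_n) :
  cube k z x -> cube k z y -> enorm (x - y) <= n%:R * 2 ^- k.
Proof.
move=> xk yk; apply: enorm_le => [|i]; first by rewrite invr_ge0 exprn_ge0.
by rewrite !mxE; apply: ltW; exact: (cube_coord_lt i xk yk).
Qed.

Lemma cube_nonempty k (z : 'rV[int]_n) : (cube k z : set 'rV[R]_n) !=set0.
Proof.
exists (\row_i ((z 0 i)%:~R / 2 ^+ k)); apply/cubeP/rowP => i.
by rewrite !mxE mulrC divfK ?expf_neq0// intrKfloor.
Qed.

Lemma hoelder_le Omega sigma f : 0 < sigma ->
  (holder_seminorm Omega sigma f < +oo)%E ->
  exists2 L : R, 0 <= L & forall x y, Omega x -> Omega y ->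
    `|f x - f y| <= L * enorm (x - y) `^ sigma.
Proof.
move=> s0; rewrite /holder_seminorm; set E := maxe _ _ => Eoo.
have E0 : (0 <= E)%E by rewrite /E le_max lexx.
have Ef : E \is a fin_num by rewrite ge0_fin_numE.
exists (fine E); first exact: fine_ge0.
move=> x y Ox Oy; have [->|xy] := eqVneq x y.
  by rewrite subrr normr0 mulr_ge0 ?fine_ge0 ?powR_ge0.
have e0 : 0 < enorm (x - y).
  rewrite lt_def enorm_ge0 andbT; apply: contra xy => /eqP /enorm_eq0 /eqP.
  by rewrite subr_eq0.
rewrite -ler_pdivrMr ?powR_gt0// -lee_fin fineK// /E le_max; apply/orP; right.
by apply: ereal_sup_ubound; exists (x, y) => //=; split => //; exact/eqP.
Qed.

Lemma integral_le_cst d (T : measurableType d) (mu : {measure set T -> \bar R})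
    (Q : set T) (g : T -> R) (b v : R) :
  measurable Q -> measurable_fun Q g -> (forall x, Q x -> 0 <= g x <= b) ->
  mu Q = v%:E -> (\int[mu]_(x in Q) (g x)%:E <= (b * v)%:E)%E.
Proof.
move=> mQ mg gb Qv; rewrite EFinM -Qv -integral_cst//; apply: ge0_le_integral => //.
- by move=> x /gb /andP[].
- exact/measurable_EFinP.
- by move=> x /gb /andP[].
Qed.

Lemma hoelder_oscillation Omega sigma f (L : R) k (z : 'rV[int]_n) :
  0 < sigma -> 0 <= L ->
  measurable (Omega : set (leb_rV R n)) ->
  measurable_fun (Omega : set (leb_rV R n)) (f : leb_rV R n -> R) ->
  (forall x y, Omega x -> Omega y -> `|f x - f y| <= L * enorm (x - y) `^ sigma) ->
  cube k z `<=` Omega ->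
  exists c : R,
    (\int[lebesgue_rV]_(x in (cube k z : set (leb_rV R n))) `|f x - c|%:E
       <= (L * n%:R `^ sigma * (2 ^- k) `^ sigma * 2 ^- (k * n))%:E)%E.
Proof.
move=> s0 L0 mO mf fL QO; have [z0 z0Q] := cube_nonempty k z.
exists (f z0); apply: (integral_le_cst (g := fun x : leb_rV R n => `|f x - f z0|)).
- exact: measurable_dyadic_box.
- exact: (measurable_dist_cst (T := leb_rV R n) _ mO QO mf).
- move=> x Qx; rewrite normr_ge0 /=.
  apply: (le_trans (fL x z0 (QO _ Qx) (QO _ z0Q))).
  rewrite -mulrA ler_wpM2l// -powRM ?invr_ge0 ?exprn_ge0//.
  apply: ge0_ler_powR; rewrite ?nnegrE ?enorm_ge0 ?mulr_ge0 ?invr_ge0 ?exprn_ge0 ?(ltW s0)//.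
  exact: cube_enorm_le z0Q.
- exact: lebesgue_cube.
Qed.

Definition gagliardo_kernel (sigma q : R) f (x y : 'rV[R]_n) : R :=
  (`|f x - f y| / enorm (x - y) `^ sigma) `^ q / enorm (x - y) ^+ n.

Lemma gagliardo_kernel_ge0 sigma q f x y : 0 <= gagliardo_kernel sigma q f x y.
Proof. by rewrite divr_ge0 ?powR_ge0// exprn_ge0// enorm_ge0. Qed.

(** With [b] the difference quotient, [|f x - f y| = |x - y| ^ sigma * b]. Apply [le_young] to [b]
    and use that [b ^ q] is the kernel times [|x - y| ^ n], hence at most [D ^ n] times the kernel.
    The diagonal is separate, since [b] is a division by 0 there. *)
Lemma le_gagliardo_kernel (sigma q M D : R) f x y : 0 < sigma -> 1 <= q -> 0 < M ->
  enorm (x - y) <= D ->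
  `|f x - f y| <= D `^ sigma * (M + M `^ (1 - q) * D ^+ n * gagliardo_kernel sigma q f x y).
Proof.
move=> s0 q1 M0 xyD; have D0 : 0 <= D by apply: le_trans xyD; exact: enorm_ge0.
have [->|xy] := eqVneq x y.
  rewrite subrr normr0 mulr_ge0 ?powR_ge0// addr_ge0 ?(ltW M0)//.
  apply: mulr_ge0; last exact: gagliardo_kernel_ge0.
  by rewrite mulr_ge0 ?powR_ge0// exprn_ge0.
have e0 : 0 < enorm (x - y).
  rewrite lt_def enorm_ge0 andbT; apply: contra xy => /eqP /enorm_eq0 /eqP.
  by rewrite subr_eq0.
rewrite /gagliardo_kernel; set b := `|f x - f y| / _.
have b0 : 0 <= b by rewrite divr_ge0 ?powR_ge0.
have -> : `|f x - f y| = enorm (x - y) `^ sigma * b.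
  by rewrite /b mulrC divfK// lt0r_neq0// powR_gt0.
apply: ler_pM => //; first exact: powR_ge0.
  by apply: ge0_ler_powR; rewrite ?nnegrE ?(ltW s0) ?enorm_ge0.
apply: (le_trans (le_young M0 q1 b0)); rewrite lerD2l -mulrA ler_wpM2l ?powR_ge0//.
rewrite mulrCA -[leLHS]mulr1 ler_wpM2l ?powR_ge0// ler_pdivlMr ?exprn_gt0// mul1r.
by rewrite lerXn2r ?nnegrE ?enorm_ge0.
Qed.

(** The map [X] is there because points range over [leb_rV], whose sigma-algebra differs from that
    of ['rV[R]_n]; it is applied with [X = id]. *)
Lemma measurable_quotient_kernel d (T : measurableType d) (X : T -> 'rV[R]_n)
    (F : T -> R) (sigma q : R) :
  (forall i, measurable_fun [set: T] (fun x => X x 0 i)) ->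
  measurable_fun [set: T] F ->
  measurable_fun [set: T * T] (fun p =>
    (`|F p.2 - F p.1| / enorm (X p.2 - X p.1) `^ sigma) `^ q
      / enorm (X p.2 - X p.1) ^+ n).
Proof.
move=> mX mF.
have me : measurable_fun [set: T * T] (fun p : T * T => enorm (X p.2 - X p.1)).
  apply: (measurableT_comp (f := @Num.sqrt R)).
    by apply: continuous_measurable_fun; exact: sqrt_continuous.
  apply: measurable_sum => i; apply: measurable_funX.
  rewrite (_ : (fun p : T * T => _) =
      (fun p => ((fun x => X x 0 i) \o snd) p - ((fun x => X x 0 i) \o fst) p)).
    by apply: measurable_funB; apply: measurableT_comp.
  by apply/funext => p; rewrite !mxE.
(* Inverses become powers with exponent -1, which agree with them on nonnegative bases and are
   covered by the measurability of real powers. *)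
rewrite (_ : (fun _ => _) = (fun p : T * T =>
    (`|F p.2 - F p.1| * (enorm (X p.2 - X p.1) `^ sigma) `^ (- 1)) `^ q *
    (enorm (X p.2 - X p.1) ^+ n) `^ (- 1))); last first.
  by apply/funext => p; rewrite !powR_inv1 ?exprn_ge0 ?powR_ge0 ?enorm_ge0.
apply: measurable_funM.
  apply: (measurableT_comp (measurable_powR _)); apply: measurable_funM.
    apply: measurableT_comp => //.
    by apply: measurable_funB; apply: measurableT_comp.
  by do 2 apply: (measurableT_comp (measurable_powR _)) => //.
by apply: (measurableT_comp (measurable_powR _)) => //; exact: measurable_funX.
Qed.

Lemma measurable_gagliardo Omega sigma q f :
  measurable (Omega : set (leb_rV R n)) ->
  measurable_fun (Omega : set (leb_rV R n)) (f : leb_rV R n -> R) ->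
  (forall y : 'rV[R]_n, Omega y -> measurable_fun (Omega : set (leb_rV R n))
    (fun x : leb_rV R n => gagliardo_kernel sigma q f x y)) /\
  measurable_fun (Omega : set (leb_rV R n)) (fun y : leb_rV R n =>
    \int[lebesgue_rV]_(x in (Omega : set (leb_rV R n)))
      (gagliardo_kernel sigma q f x y)%:E)%E.
Proof.
move=> mO mf.
(* Only the restriction of [f] to [Omega] is measurable; the extension by 0 is measurable everywhere
   and has the same kernel on [Omega]. *)
pose F : leb_rV R n -> R := (f : leb_rV R n -> R) \_ Omega.
have mF : measurable_fun [set: leb_rV R n] F by apply/(measurable_restrictT _ mO).
have mK := @measurable_quotient_kernel _ (leb_rV R n) id F sigma q
  measurable_leb_rV_coord mF.
split.
  move=> y Oy; apply: (eq_measurable_fun (fun x : leb_rV R n =>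
      gagliardo_kernel sigma q F x y)).
    by move=> x xO; rewrite /gagliardo_kernel /F !patchE xO mem_set.
  apply: measurable_funTS.
  have -> : (fun x : leb_rV R n => gagliardo_kernel sigma q F x y) =
      (fun p : leb_rV R n * leb_rV R n => gagliardo_kernel sigma q F p.2 p.1) \o
        pair y by [].
  apply: measurableT_comp; first exact: mK.
  exact: measurable_pair1.
have K0 (p : leb_rV R n * leb_rV R n) : (0 <= (gagliardo_kernel sigma q F p.2 p.1)%:E)%E.
  by rewrite lee_fin gagliardo_kernel_ge0.
have mKE : measurable_fun [set: leb_rV R n * leb_rV R n]
    (fun p => (gagliardo_kernel sigma q F p.2 p.1)%:E).
  by apply/measurable_EFinP; exact: mK.
have mI := @measurable_partial_integral _ _ R (@lebesgue_rV R n) _ _ mO mKE K0.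
apply: (eq_measurable_fun (fun y : leb_rV R n => (\int[lebesgue_rV]_(x in (Omega : set (leb_rV R n)))
  (gagliardo_kernel sigma q F x y)%:E)%E)).
  move=> y; rewrite inE => Oy; apply: eq_integral => x xO.
  by rewrite /gagliardo_kernel /F !patchE xO mem_set.
exact: measurable_funTS.
Qed.

(** The constant is the value of [f] at a point [z0] whose inner integral is at most twice the
    average allowed on a good cube. This removes one of the two integrations, and
    [le_gagliardo_kernel] with [y = z0] bounds the other. *)
Lemma gagliardo_oscillation Omega sigma q (t' : R) f (h : leb_rV R n -> \bar R)
    k (z : 'rV[int]_n) :
  0 < sigma -> 1 <= q ->
  measurable (Omega : set (leb_rV R n)) ->
  measurable_fun (Omega : set (leb_rV R n)) (f : leb_rV R n -> R) ->
  measurable_fun (Omega : set (leb_rV R n)) h ->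
  (forall y : 'rV[R]_n, Omega y ->
    (\int[lebesgue_rV]_(x in (Omega : set (leb_rV R n)))
      (gagliardo_kernel sigma q f x y)%:E <= h y)%E) ->
  cube k z `<=` Omega ->
  (\int[lebesgue_rV]_(x in (cube k z : set (leb_rV R n))) h x
       <= ((2 ^- k) `^ t')%:E)%E ->
  exists c : R,
    (\int[lebesgue_rV]_(x in (cube k z : set (leb_rV R n))) `|f x - c|%:E
       <= (n%:R `^ sigma * (1 + 2 * n%:R ^+ n) *
          (2 ^- k) `^ (sigma - (n%:R - t') / q) * 2 ^- (k * n))%:E)%E.
Proof.
move=> s0 q1 mO mf mh Hh QO hQ.
set l : R := 2 ^- k; have l0 : 0 < l by rewrite invr_gt0 exprn_gt0.
have q0 : 0 < q by lra.
pose Q := cube k z : set (leb_rV R n).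
have mQ : measurable Q by exact: measurable_dyadic_box.
have vQ : lebesgue_rV Q = (2 ^- (k * n) : R)%:E by exact: lebesgue_cube.
have vE : 2 ^- (k * n) = l ^+ n by rewrite /l exprVn -exprM.
pose H (y : leb_rV R n) := (\int[lebesgue_rV]_(x in (Omega : set (leb_rV R n)))
      (gagliardo_kernel sigma q f x y)%:E)%E.
have H0 y : (0 <= H y)%E.
  by apply: integral_ge0 => x _; rewrite lee_fin gagliardo_kernel_ge0.
have [mG mH] := measurable_gagliardo sigma q mO mf.
have mHQ : measurable_fun Q H := measurable_funS mO QO mH.
have mhQ : measurable_fun Q h := measurable_funS mO QO mh.
have [z0 z0Q Hz0] : exists2 z0, Q z0 & (H z0 <= (2 * l `^ (t' - n%:R))%:E)%E.
  apply: (exists_le_average mQ mHQ vQ); rewrite ?powR_gt0 ?invr_gt0 ?exprn_gt0//.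
  have -> : l `^ (t' - n%:R) * 2 ^- (k * n) = l `^ t'.
    rewrite vE powRB; last by apply/implyP; rewrite lt0r_neq0.
    by rewrite powR_mulrn ?(ltW l0)// divfK// expf_neq0// lt0r_neq0.
  apply: le_trans hQ; apply: ge0_le_integral => //.
  by move=> y /QO Oy; exact: Hh.
exists (f z0).
set M := l `^ ((t' - n%:R) / q).
have M0 : 0 < M by rewrite powR_gt0.
set D := n%:R * l; have D0 : 0 <= D by rewrite mulr_ge0// ltW.
have Oz0 := QO _ z0Q.
have mGQ := measurable_funS mO QO (mG _ Oz0).
have Gw : (\int[lebesgue_rV]_(x in Q) (gagliardo_kernel sigma q f x z0)%:E <=
    (2 * l `^ (t' - n%:R))%:E)%E.
  have mGE : measurable_fun (Omega : set (leb_rV R n))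
      (fun x : leb_rV R n => (gagliardo_kernel sigma q f x z0)%:E).
    by apply/measurable_EFinP; exact: mG.
  apply: le_trans Hz0; apply: (ge0_subset_integral lebesgue_rV mQ mO mGE _ QO).
  by move=> x _; rewrite lee_fin gagliardo_kernel_ge0.
have := @integral_affine_le _ (leb_rV R n) R lebesgue_rV Q
  (fun x => `|f x - f z0|) (fun x => gagliardo_kernel sigma q f x z0)
  (D `^ sigma * M) (D `^ sigma * (M `^ (1 - q) * D ^+ n)) _ _
  mQ (measurable_dist_cst (T := leb_rV R n) _ mO QO mf) mGQ vQ.
move=> /(_ _ _ _ _ _ Gw) /le_trans; apply.
- by rewrite mulr_ge0 ?powR_ge0.
- by rewrite mulr_ge0 ?powR_ge0// mulr_ge0 ?powR_ge0// exprn_ge0.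
- by move=> x _; exact: gagliardo_kernel_ge0.
- move=> x Qx; rewrite normr_ge0 /= -mulrA -mulrDr.
  by apply: le_gagliardo_kernel => //; exact: cube_enorm_le z0Q.
rewrite lee_fin vE.
have lD r s : l `^ (r + s) = l `^ r * l `^ s.
  by rewrite powRD//; apply/implyP; rewrite lt0r_neq0.
have -> : sigma - (n%:R - t') / q = sigma + (t' - n%:R) / q by ring.
(* The choice of [M] balances the two terms of the Young bound: both become multiples of [M]. *)
have ME : M `^ (1 - q) * l `^ (t' - n%:R) = M.
  rewrite /M -powRrM -lD; congr (_ `^ _); field; exact: lt0r_neq0.
rewrite (lD sigma) -/M /D powRM ?(ltW l0)// exprMn.
move: (n%:R `^ sigma) (l `^ sigma) (l ^+ n) (n%:R ^+ n : R) => a b c d.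
rewrite le_eqVlt; apply/orP; left; apply/eqP.
move: ME; move: (M `^ (1 - q)) (l `^ (t' - n%:R)) => u v ME.
transitivity (a * b * (M + (u * v) * (2 * d)) * c); first by ring.
by rewrite ME; ring.
Qed.

End fractional.

(** * Smooth functions of one variable *)

Section smooth1.
Context {R : realType}.
Implicit Types (u v w : R -> R) (x a b : R).

(* [x ^- k * exp (- 1 / x)], extended by 0: a family closed under
   differentiation up to linear combinations *)
Definition flat (k : nat) x : R :=
  if 0 < x then x^-1 ^+ k * expR (- x^-1) else 0.

(** A syntactic class closed under differentiation, so that the smoothness of a test function
    follows from the way it is built and no higher derivative is computed. The last constructor
    admits the primitives from which the tents are made. *)
Inductive smooth1 : (R -> R) -> Prop :=
| smooth1_cst c : smooth1 (fun=> c)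
| smooth1_id : smooth1 id
| smooth1_flat k : smooth1 (flat k)
| smooth1_expR : smooth1 expR
| smooth1D u v : smooth1 u -> smooth1 v -> smooth1 (fun x => u x + v x)
| smooth1M u v : smooth1 u -> smooth1 v -> smooth1 (fun x => u x * v x)
| smooth1_comp u v : smooth1 u -> smooth1 v -> smooth1 (fun x => v (u x))
| smooth1_primitive u v : (forall x, is_derive x 1 v (u x)) -> smooth1 u ->
    smooth1 v.

Lemma is_derive_comp1 u v x (du dv : R) : is_derive x 1 u du ->
  is_derive (u x) 1 v dv -> is_derive x 1 (fun y => v (u y)) (dv * du).
Proof.
move=> [du' <-] [dv' <-]; split; last first.
  rewrite -!derive1E; exact: (derive1_comp du' dv').
move/derivable1_diffP : du' => du'; move/derivable1_diffP : dv' => dv'.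
apply/derivable1_diffP; exact: (differentiable_comp du' dv').
Qed.

Lemma is_derive_sq_bound u (C : R) : (forall h, `|u h| <= C * h ^+ 2) ->
  is_derive (0 : R) 1 u 0.
Proof.
move=> uC.
have u0 : u 0 = 0.
  by apply/eqP; have := uC 0; rewrite expr0n mulr0 normr_le0.
suff H : (fun h => h^-1 *: ((u \o shift 0) (h *: 1) - u 0)) @ 0^' --> (0 : R).
  by split; [apply/cvg_ex; exists 0|exact: cvg_lim].
have C0 : 0 <= C by have := uC 1; rewrite expr1n mulr1; apply: le_trans.
have C1 : 0 < C + 1 by lra.
apply/cvgrPdist_lt => eps eps0; near=> h.
have h0 : h != 0 by near: h; exact: nbhs_dnbhs_neq.
rewrite sub0r normrN u0 subr0 /= addr0 /GRing.scale /= mulr1 normrM.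
apply: (@le_lt_trans _ _ (C * `|h|)).
  rewrite normfV ler_pdivrMl ?normr_gt0// mulrC -mulrA -expr2 real_normK ?num_real//.
apply: (@le_lt_trans _ _ ((C + 1) * `|h|)); first by rewrite ler_wpM2r// lerDl.
rewrite mulrC -ltr_pdivlMr//.
by near: h; apply: dnbhs0_lt; rewrite divr_gt0.
Unshelve. all: by end_near. Qed.

Lemma flat_sq_bound k : exists C, forall h : R, `|flat k h| <= C * h ^+ 2.
Proof.
(* The constant comes from [y ^ (k + 2) / (k + 2)! <= exp y] at [y = 1 / h]. *)
exists (k.+2)`!%:R => h; rewrite /flat; case: ifPn => [h0|_]; last first.
  by rewrite normr0 mulr_ge0// sqr_ge0.
have hi : 0 <= h^-1 by rewrite invr_ge0 ltW.
rewrite ger0_norm; last by rewrite mulr_ge0 ?exprn_ge0 ?expR_ge0.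
rewrite expRN ler_pdivrMr ?expR_gt0//.
have f0 : 0 < (k.+2)`!%:R :> R by rewrite ltr0n fact_gt0.
apply: (@le_trans _ _ ((k.+2)`!%:R * h ^+ 2 * (h^-1 ^+ k.+2 / (k.+2)`!%:R))).
  rewrite le_eqVlt; apply/orP; left; apply/eqP.
  rewrite !exprS expr0 !mulrA mulr1.
  field.
  by rewrite !lt0r_neq0.
apply: ler_wpM2l; first by rewrite mulr_ge0 ?sqr_ge0// ltW.
apply: le_trans (expR_ge1Dxn k.+1 hi); by rewrite lerDr.
Qed.

(** To the right of 0 this is the product rule, to the left the function vanishes, and at 0 the
    quadratic bound forces the derivative 0. *)
Lemma is_derive_flat k x : is_derive x 1 (flat k) (flat k.+2 x - k%:R * flat k.+1 x).
Proof.
have [x0|x0|->] := ltgtP x 0.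
- rewrite /flat ltNge (ltW x0) /= mulr0 subr0.
  apply: (@near_eq_is_derive _ _ _ (cst 0)).
  near=> y; rewrite /flat ltNge ifF//; apply/negbTE; rewrite negbK ltW//.
  by near: y; exact: lt_nbhsl.
- have H : is_derive x 1 (fun y : R => y^-1) (- x ^- 2).
    split; first by apply: derivableV => //; rewrite lt0r_neq0.
    by rewrite deriveV ?lt0r_neq0// derive_id scaler1.
  have HE : is_derive x 1 (fun y : R => expR (- y^-1)) (expR (- x^-1) * x ^- 2).
    apply: (@is_derive_comp1 (fun y => - y^-1) expR).
    by rewrite -[X in is_derive _ _ _ X]opprK; exact: is_deriveN.
  have HX := is_deriveX k H.
  have := is_deriveM HX HE => HM.
  apply: (@near_eq_is_derive _ _ _ ((fun y => y^-1) ^+ k * (fun y : R => expR (- y^-1)))).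
    near=> y; rewrite /flat ifT ?fctE//; near: y; exact: lt_nbhsr.
  apply: is_derive_eq HM _; rewrite /flat x0 /GRing.scale /= fctE.
  rewrite -exprVn; move: (x^-1) (expR _) => y E.
  by case: (k) => [|m] /=; rewrite !exprS ?expr0; ring.
- have [C hC] := flat_sq_bound k.
  rewrite /flat ltxx mulr0 subr0; exact: is_derive_sq_bound hC.
Unshelve. all: by end_near. Qed.

Lemma smooth1_derive u : smooth1 u -> exists2 u', smooth1 u' &
  forall x, is_derive x 1 u (u' x).
Proof.
elim=> {u} [c||k||u v su [u' su' du] sv [v' sv' dv]|u v su [u' su' du] sv [v' sv' dv]
  |u v su [u' su' du] sv [v' sv' dv]|u v du su [u' su' du']].
- by exists (fun=> 0) => [|x]; [exact: smooth1_cst|exact: is_derive_cst].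
- by exists (fun=> 1) => [|x]; [exact: smooth1_cst|exact: is_derive_id].
- exists (fun x => flat k.+2 x + - k%:R * flat k.+1 x).
    by apply: smooth1D; [|apply: smooth1M; [exact: smooth1_cst|]]; exact: smooth1_flat.
  by move=> x; rewrite mulNr; exact: is_derive_flat.
- by exists expR => [|x]; [exact: smooth1_expR|exact: is_derive_expR].
- by exists (fun x => u' x + v' x) => [|x]; [exact: smooth1D|exact: is_deriveD].
- exists (fun x => u x * v' x + v x * u' x) => [|x]; last exact: is_deriveM.
  by apply: smooth1D; exact: smooth1M.
- exists (fun x => v' (u x) * u' x) => [|x]; last exact: is_derive_comp1.
  by apply: smooth1M => //; exact: smooth1_comp.
- by exists u.
Qed.

Lemma smooth1_continuous u : smooth1 u -> continuous u.
Proof.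
move=> /smooth1_derive [u' _ du] x.
by apply/differentiable_continuous/derivable1_diffP; case: (du x).
Qed.

End smooth1.

(** * Cut-offs and tents on the line *)

Section bumps.
Context {R : realType}.
Implicit Types (u v w : R -> R) (x a b h : R).

(** The product of the two flat functions is positive exactly on []a, b[]; there the exponential
    tends to 0 as [k] grows, and elsewhere it is 1. The limit is the indicator of the open
    interval. *)
Definition bump a b (k : nat) x : R :=
  1 - expR (- k%:R * (flat 0 (x - a) * flat 0 (b - x))).

Lemma flat_ge0 k x : 0 <= flat k x.
Proof.
rewrite /flat; case: ifPn => // x0.
by rewrite mulr_ge0 ?expR_ge0// exprn_ge0// invr_ge0 ltW.
Qed.

Lemma flat_gt0 k x : 0 < x -> 0 < flat k x.
Proof.
by move=> x0; rewrite /flat x0 mulr_gt0 ?expR_gt0// exprn_gt0// invr_gt0.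
Qed.

Lemma flat_le0 k x : x <= 0 -> flat k x = 0.
Proof. by move=> x0; rewrite /flat ltNge x0. Qed.

Lemma smooth1_bump a b k : smooth1 (bump a b k).
Proof.
apply: smooth1D; first exact: smooth1_cst.
rewrite (_ : (fun x => _) = (fun x =>
    -1 * expR (- k%:R * (flat 0 (x + - a) * flat 0 (b + -1 * x))))); last first.
  by apply/funext => x; rewrite !mulN1r.
apply: smooth1M; first exact: smooth1_cst.
apply: (smooth1_comp (v := expR)); last exact: smooth1_expR.
apply: smooth1M; first exact: smooth1_cst.
apply: smooth1M; apply: (smooth1_comp (v := flat 0)); try exact: smooth1_flat.
  by apply: smooth1D; [exact: smooth1_id|exact: smooth1_cst].
apply: smooth1D; first exact: smooth1_cst.
by apply: smooth1M; [exact: smooth1_cst|exact: smooth1_id].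
Qed.

Lemma bump_itv a b k x : 0 <= bump a b k x <= 1.
Proof.
rewrite /bump subr_ge0 gerBl expR_ge0 andbT expR_le1 mulNr oppr_le0.
by rewrite mulr_ge0// mulr_ge0// flat_ge0.
Qed.

Lemma bump_out a b k x : x <= a \/ b <= x -> bump a b k x = 0.
Proof.
rewrite /bump; case=> h.
  by rewrite (flat_le0 _ (x := x - a)) ?subr_le0// mul0r mulr0 expR0 subrr.
by rewrite (flat_le0 _ (x := b - x)) ?subr_le0// !mulr0 expR0 subrr.
Qed.

Lemma bump_cvg a b x : a < x < b -> bump a b k x @[k --> \oo] --> (1 : R).
Proof.
move=> /andP[ax xb]; rewrite -[X in _ --> X]subr0.
apply: cvgB; first exact: cvg_cst.
set c := flat 0 _ * _.
have c0 : 0 < c by rewrite mulr_gt0 ?flat_gt0 ?subr_gt0.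
rewrite (_ : (fun k : nat => _) = geometric 1 (expR (- c))); last first.
  apply/funext => k /=; rewrite mul1r -expRM_natl; congr expR; ring.
by apply: cvg_geometric; rewrite gtr0_norm ?expR_gt0// expR_lt1 oppr_lt0.
Qed.

Lemma exists_primitive w a : continuous w -> (forall x, x <= a -> w x = 0) ->
  exists W : R -> R, forall x, is_derive x 1 W (w x).
Proof.
move=> cw w0.
(* Starting at [a - 1] leaves every [x >= a] strictly to the right of the lower end, as the
   fundamental theorem requires; for [x < a] the integral vanishes near [x]. *)
pose W x := (\int[lebesgue_measure]_(t in `[a - 1, x]) w t)%R.
exists W => x; have [xa|ax] := ltP x a.
  rewrite w0 ?(ltW xa)//; apply: (@near_eq_is_derive _ _ _ (cst 0)).
  near=> y; rewrite /W /= /Rintegral integral0_eq// => z /=.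
  rewrite in_itv /= => /andP[_ zy]; rewrite w0//.
  by apply: (le_trans zy); apply: ltW; near: y; exact: lt_nbhsl.
have ax' : a - 1 < x by apply: lt_le_trans ax; rewrite ltrBlDr ltrDl.
have := @continuous_FTC1_closed R w (a - 1) x (x + 1).
rewrite ltrDl ltr01 => /(_ isT) [].
- apply: continuous_compact_integrable; first exact: segment_compact.
  exact: continuous_subspaceT.
- exact: ax'.
- exact: cw.
- by move=> dW; rewrite derive1E => <-; split.
Unshelve. all: by end_near. Qed.

(** The tent is the integral of [w] over [[x - h, x]], written with a primitive. By the mean value
    theorem it equals [w c * h] with [c] in that window, which gives both its support and its
    bound. *)
Lemma exists_tent w a h : 0 < h -> smooth1 w ->
  (forall x, 0 <= w x <= 1) -> (forall x, x <= a \/ a + h <= x -> w x = 0) ->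
  exists2 tau : R -> R, smooth1 tau & [/\
    forall x, is_derive x 1 tau (w x - w (x - h)),
    forall x, x <= a \/ a + 2 * h <= x -> tau x = 0 &
    forall x, `|tau x| <= h].
Proof.
move=> h0 sw w01 w0.
have [W dW] := @exists_primitive w a (smooth1_continuous sw) (fun x xa => w0 x (or_introl xa)).
have sW : smooth1 W := smooth1_primitive dW sw.
have sS : smooth1 (fun x : R => x - h).
  by apply: smooth1D; [exact: smooth1_id|exact: smooth1_cst].
have E x : exists2 c, x - h < c < x & W x - W (x - h) = w c * h.
  have := @MVT R W w (x - h) x; rewrite gtrBl h0 => /(_ isT (fun y _ => dW y)).
  case=> [|c]; first exact/continuous_subspaceT/smooth1_continuous.
  by rewrite in_itv /= subKr => xc ->; exists c.
exists (fun x => W x + -1 * W (x - h)).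
  apply: smooth1D => //; apply: smooth1M; first exact: smooth1_cst.
  exact: (smooth1_comp sS sW).
split=> x.
- have dS : is_derive x 1 (fun y : R => y - h) 1.
    by apply: is_derive_eq; rewrite subr0.
  rewrite (_ : (fun y => _) = W - (fun y => W (y - h))); last first.
    by apply/funext => y; rewrite mulN1r.
  apply: is_deriveB; rewrite -[X in is_derive _ _ _ X]mulr1.
  exact: is_derive_comp1.
- rewrite mulN1r => xa; have [c /andP[c1 c2] ->] := E x.
  rewrite w0 ?mul0r//; case: xa => xa; [left|right]; lra.
- rewrite mulN1r; have [c _ ->] := E x; have /andP[wc0 wc1] := w01 c.
  by rewrite ger0_norm ?mulr_ge0 ?(ltW h0)// ler_piMl// ltW.
Qed.

End bumps.

(** * Test functions of product form *)

Section product_functions.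
Context {R : realType} {n : nat}.
Implicit Types (u v : 'I_n -> R -> R) (x : 'rV[R]_n) (i : 'I_n).

(** Such products are closed under [partial], which differentiates one factor and keeps the others,
    so smoothness reduces to one variable. *)
Definition prodfun u x : R := \prod_j u j (x 0 j).

Lemma is_derive_prodfun u i (d : R -> R) x :
  (forall t : R, is_derive t 1 (u i) (d t)) ->
  is_derive x (delta_mx 0 i) (prodfun u)
    (prodfun (fun j => if j == i then d else u j) x).
Proof.
move=> du; pose C := \prod_(j | j != i) u j (x 0 j).
have E (w : 'I_n -> R -> R) (y : 'rV[R]_n) : (forall j, j != i -> w j (y 0 j) = u j (x 0 j)) ->
    prodfun w y = w i (y 0 i) * C.
  by move=> wy; rewrite /prodfun (bigD1 i)//=; congr (_ * _); apply: eq_bigr.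
rewrite E; last by move=> j /negPf ->.
rewrite eqxx mulrC.
have [/cvg_ex[/= l cl] dE] := du (x 0 i).
have {}cl : (fun h : R => h^-1 *: ((u i \o shift (x 0 i)) (h *: 1) - u i (x 0 i)))
    @ 0^' --> d (x 0 i).
  by rewrite -dE /derive (cvg_lim _ cl).
suff H : (fun h : R => h^-1 *: ((prodfun u \o shift x) (h *: delta_mx 0 i) - prodfun u x))
    @ 0^' --> C * d (x 0 i).
  by split; [apply/cvg_ex; exists (C * d (x 0 i))|exact: cvg_lim].
rewrite (_ : (fun h => _) = (fun h : R =>
    C * (h^-1 *: ((u i \o shift (x 0 i)) (h *: 1) - u i (x 0 i))))).
  by apply: cvgM => //; exact: cvg_cst.
apply/funext => h /=; rewrite (E u x)// (E u).
  rewrite !mxE !eqxx /GRing.scale /=; ring.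
by move=> j ji; rewrite !mxE (negPf ji) andbF mulr0 add0r.
Qed.

Lemma partial_prodfun u i (d : R -> R) :
  (forall t : R, is_derive t 1 (u i) (d t)) ->
  partial i (prodfun u) = prodfun (fun j => if j == i then d else u j).
Proof.
by move=> du; apply/funext => x; rewrite /partial; case: (is_derive_prodfun x du).
Qed.

Lemma foldr_partial_prodfun u (s : seq 'I_n) : (forall j, smooth1 (u j)) ->
  exists2 v, forall j, smooth1 (v j) & foldr partial (prodfun u) s = prodfun v.
Proof.
move=> su; elim: s => [|i s [v sv E]] /=; first by exists u.
have [d sd dv] := smooth1_derive (sv i).
exists (fun j => if j == i then d else v j); first by move=> j; case: ifP.
by rewrite E; exact: partial_prodfun.
Qed.

Lemma continuous_prodfun u : (forall j, smooth1 (u j)) -> continuous (prodfun u).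
Proof.
move=> su; rewrite /prodfun; move: (index_enum _) => s; elim: s => [|i s IH].
  rewrite (_ : (fun x => _) = cst 1); last by apply/funext => x; rewrite big_nil.
  exact: cst_continuous.
rewrite (_ : (fun x => _) = (fun x => u i (x 0 i) * \prod_(j <- s) u j (x 0 j))).
  move=> x; apply: continuousM; last exact: IH.
  apply: (@continuous_comp _ _ _ (fun x : 'rV[R]_n => x 0 i) (u i)).
    exact: coord_continuous.
  exact: smooth1_continuous.
by apply/funext => x; rewrite big_cons.
Qed.

Lemma smooth_prodfun u : (forall j, smooth1 (u j)) -> smooth (prodfun u).
Proof.
move=> su s; have [v sv ->] := foldr_partial_prodfun s su.
split; first exact: continuous_prodfun.
move=> i x; have [d _ dv] := smooth1_derive (sv i).
by case: (is_derive_prodfun x dv).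
Qed.

Lemma compact_box (a b : 'I_n -> R) :
  compact [set y : 'rV[R]_n | forall i, a i <= y 0 i <= b i].
Proof.
have := @rV_compact R n (fun i => `[a i, b i]%classic)
  (fun i => @segment_compact R (a i) (b i)).
congr compact; apply/seteqP; split => y h i; have := h i; rewrite /= in_itv //.
Qed.

End product_functions.

(** * Halving inequality for the weak gradient *)

Section integral_tools.
Context d (T : measurableType d) (R : realType) (mu : {measure set T -> \bar R}).

Lemma integral_support (B D : set T) (F : T -> \bar R) : B `<=` D ->
  (forall x, D x -> ~ B x -> F x = 0%E) ->
  (\int[mu]_(x in D) F x = \int[mu]_(x in B) F x)%E.
Proof.
move=> BD F0; rewrite [LHS]integral_mkcond [RHS]integral_mkcond.
apply: eq_integral => x _; rewrite !patchE.
case: ifPn => [|/negP xD]; case: ifPn => [xB|/negP xB] //.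
  by rewrite inE => Dx; apply: F0 => // Bx; apply: xB; rewrite inE.
by exfalso; apply: xD; rewrite inE; apply: BD; rewrite inE in xB.
Qed.

Lemma le_integral_EFin (B : set T) (u w : T -> R) : measurable B ->
  measurable_fun B u -> measurable_fun B w ->
  (forall x, B x -> 0 <= u x <= w x) ->
  (\int[mu]_(x in B) (u x)%:E <= \int[mu]_(x in B) (w x)%:E)%E.
Proof.
move=> mB mu_ mw uw; apply: ge0_le_integral => //.
- by move=> x /uw /andP[].
- exact/measurable_EFinP.
- exact/measurable_EFinP.
- by move=> x /uw /andP[].
Qed.

Lemma integrable_cst (B : set T) (c : R) : measurable B -> (mu B < +oo)%E ->
  mu.-integrable B (EFin \o (fun=> c)).
Proof.
move=> mB Boo; apply/integrableP; split; first exact: measurable_cst.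
by rewrite /= integral_cst// lte_mul_pinfty.
Qed.

(** Transfers the estimate from derivatives of test functions to their almost everywhere limit, a
    difference of indicators; [|f|] dominates. *)
Lemma dominated_bound (B : set T) (f s : T -> R) (u : nat -> T -> R) (M : \bar R) :
  measurable B -> mu.-integrable B (EFin \o f) ->
  (forall k, measurable_fun B (u k)) -> measurable_fun B s ->
  (forall k x, B x -> `|u k x| <= 1) ->
  {ae mu, forall x, B x -> u k x @[k --> \oo] --> s x} ->
  (forall k, `|\int[mu]_(x in B) (f x * u k x)%:E| <= M)%E ->
  (`|\int[mu]_(x in B) (f x * s x)%:E| <= M)%E.
Proof.
move=> mB fi mu_ ms u1 us uM.
have mf : measurable_fun B f by case/integrableP : fi => /measurable_EFinP.
have [] := @dominated_convergence _ T R mu B mB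
  (fun k x => (f x * u k x)%:E) (fun x => (f x * s x)%:E) (abse \o EFin \o f).
- by move=> k; apply/measurable_EFinP; exact: measurable_funM.
- by apply/measurable_EFinP; exact: measurable_funM.
- apply: filterS us => x us Bx.
  apply: cvg_EFin; first exact: nearW.
  by apply: cvgM; [exact: cvg_cst|exact: us].
- exact: integrable_abse.
- apply: aeW => x k Bx /=; rewrite lee_fin normrM.
  by rewrite -[leRHS]mulr1 ler_wpM2l// u1.
move=> _ _ /cvg_abse H; apply: (cvge_to_le H); exact: nearW.
Qed.

Lemma abs_integral_mul_le (B : set T) (g u : T -> R) (h : R) :
  measurable B -> measurable_fun B g -> measurable_fun B u -> 0 <= h ->
  (forall x, B x -> `|u x| <= h) ->
  (`|\int[mu]_(x in B) (g x * u x)%:E| <= h%:E * \int[mu]_(x in B) `|g x|%:E)%E.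
Proof.
move=> mB mg mu_ h0 uh.
have mgu : measurable_fun B (fun x => (g x * u x)%:E).
  by apply/measurable_EFinP; exact: measurable_funM.
have mag : measurable_fun B (fun x => `|g x|%:E).
  by apply/measurable_EFinP; exact: measurableT_comp.
rewrite -ge0_integralZl//; apply: (le_trans (le_abse_integral _ _ _)) => //.
apply: ge0_le_integral => //.
- exact: measurableT_comp.
- exact: measurable_funeM.
- move=> x Bx /=; rewrite -EFinM lee_fin normrM mulrC.
  by rewrite ler_wpM2r// uh.
Qed.

Lemma integral_sign (A B : set T) (f : T -> R) : measurable A -> measurable B ->
  [disjoint A & B] -> mu.-integrable (A `|` B) (EFin \o f) ->
  (\int[mu]_(x in A `|` B) (f x * (\1_A x - \1_B x))%:E =
   \int[mu]_(x in A) (f x)%:E - \int[mu]_(x in B) (f x)%:E)%E.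
Proof.
move=> mA mB AB fi.
have mAB : measurable (A `|` B) by exact: measurableU.
have fB : mu.-integrable B (EFin \o f).
  by apply: integrableS fi => //; exact: subsetUr.
have mf : measurable_fun (A `|` B) f by case/integrableP : fi => /measurable_EFinP.
rewrite integral_setU//; last first.
  apply/measurable_EFinP; apply: measurable_funM => //.
  by apply: measurable_funTS; apply: measurable_funB; exact: measurable_indic.
rewrite -integralN; last exact: integrable_add_def.
congr (_ + _)%E; apply: eq_integral => x; rewrite inE => xAB.
- rewrite !indicE mem_set// memNset ?subr0 ?mulr1// => xB.
  by move/disj_setPS : AB => /(_ x); apply.
- rewrite !indicE memNset ?mem_set// ?sub0r ?mulrN1// => xA.
  by move/disj_setPS : AB => /(_ x); apply.
Qed.

End integral_tools.

Section halving.
Context {R : realType} {n : nat}.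
Implicit Types (Omega : set 'rV[R]_n) (f : 'rV[R]_n -> R) (e : 'I_n -> nat)
  (z : 'I_n -> int) (i : 'I_n).

Definition halve e i : 'I_n -> nat := fun j => if j == i then (e j).+1 else e j.
Definition lower z i : 'I_n -> int := fun j => if j == i then z j * 2 else z j.
Definition upper z i : 'I_n -> int := fun j => if j == i then z j * 2 + 1 else z j.

Lemma dyadic_box_halve e z i : dyadic_box e z =
  dyadic_box (halve e i) (lower z i) `|` dyadic_box (halve e i) (upper z i)
  :> set 'rV[R]_n.
Proof.
apply/seteqP; split => x.
  move=> xB; have := xB i; rewrite dyadic_itv_split => -[xi|xi]; [left|right];
    move=> j; rewrite /halve ?/lower ?/upper; by case: eqP => [->|_].
case=> xB j; have := xB j; rewrite /halve ?/lower ?/upper; case: eqP => // _ xj;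
  rewrite (dyadic_itv_split (e j)); first by left.
by right.
Qed.

Lemma dyadic_box_halve_disj e z i :
  [disjoint (dyadic_box (halve e i) (lower z i) : set 'rV[R]_n) &
     dyadic_box (halve e i) (upper z i)].
Proof.
apply/disj_setPS => x [/= /(_ i) xl /(_ i) xu].
move: xl xu; rewrite /halve /lower /upper eqxx /dyadic_itv /= => -> /eqP.
by rewrite -subr_eq0 opprD addrA subrr sub0r.
Qed.

(** The cut-offs reach their limit only in the interior of the two half boxes; the exceptional
    points lie on finitely many hyperplanes. *)
Lemma negligible_hyperplane i (c : R) :
  lebesgue_rV.-negligible ([set x : 'rV[R]_n | x 0 i = c] : set (leb_rV R n)).
Proof.
pose A j : set R := if j == i then [set c] else setT.
have mA j : measurable (A j).
  by rewrite /A; case: ifP => _ //; exact: measurable_set1.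
have E : [set x : 'rV[R]_n | x 0 i = c] = [set x : 'rV[R]_n | forall j, A j (x 0 j)].
  apply/seteqP; split => x /=; last by move=> /(_ i); rewrite /A eqxx.
  by move=> xc j; rewrite /A; case: eqP => // ->.
rewrite E; apply/negligibleP; first by apply: measurable_leb_rV; exact: measurable_rV_box.
apply: etrans (lebesgue_rV_box mA) _.
by rewrite (bigD1 i)//= {1}/A eqxx lebesgue_measure_set1 mul0e.
Qed.

Lemma norm_sub_le1 (p q : R) : 0 <= p <= 1 -> 0 <= q <= 1 -> `|p - q| <= 1.
Proof. by rewrite ler_norml; lra. Qed.

Lemma cvg_prod1 (F : 'I_n -> nat -> R) (P : pred 'I_n) :
  (forall j, P j -> F j k @[k --> \oo] --> (1 : R)) ->
  \prod_(j | P j) F j k @[k --> \oo] --> (1 : R).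
Proof.
move=> F1; elim: (index_enum _) => [|i s IH].
  rewrite (_ : (fun k => _) = cst 1); first exact: cvg_cst.
  by apply/funext => k; rewrite big_nil.
have [Pi|Pi] := boolP (P i).
  rewrite (_ : (fun k => _) = (fun k => F i k * \prod_(j <- s | P j) F j k)).
    by rewrite -[X in _ --> X]mulr1; apply: cvgM => //; exact: F1.
  by apply/funext => k; rewrite big_cons Pi.
rewrite (_ : (fun k => _) = (fun k => \prod_(j <- s | P j) F j k)) //.
by apply/funext => k; rewrite big_cons (negPf Pi).
Qed.

Lemma measurable_prodfun (u : 'I_n -> R -> R) : (forall j, continuous (u j)) ->
  measurable_fun [set: leb_rV R n] (prodfun u : leb_rV R n -> R).
Proof.
move=> cu; apply: measurable_prod => j _.
apply: (measurableT_comp (f := u j)); first exact: continuous_measurable_fun.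
exact: measurable_leb_rV_coord.
Qed.

Lemma measurable_closed_box e z :
  measurable (closed_box e z : set (leb_rV R n)).
Proof.
apply: measurable_leb_rV.
exact: (@measurable_rV_box R n
  (fun j => `[(z j)%:~R / 2 ^+ e j, (z j + 1)%:~R / 2 ^+ e j]%classic)
  (fun j => measurable_itv _)).
Qed.

Lemma loc_integrable_box Omega f e z : loc_integrable_on Omega f ->
  measurable (Omega : set (leb_rV R n)) -> closed_box e z `<=` Omega ->
  lebesgue_rV.-integrable (dyadic_box e z : set (leb_rV R n)) (EFin \o f).
Proof.
move=> [mf fint] mO BO; set B := dyadic_box e z : set (leb_rV R n).
have mB : measurable B by exact: measurable_dyadic_box.
have BK : B `<=` (closed_box e z : set (leb_rV R n)) by exact: dyadic_box_closed.
have BO' : B `<=` Omega by exact: subset_trans BO.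
apply/integrableP; split.
  by apply/measurable_EFinP; exact: measurable_funS mO BO' mf.
have cK : compact (closed_box e z : set 'rV[R]_n).
  exact: (@compact_box R n (fun j => (z j)%:~R / 2 ^+ e j)
    (fun j => (z j + 1)%:~R / 2 ^+ e j)).
apply: le_lt_trans (fint _ cK BO).
have mK : measurable (closed_box e z : set (leb_rV R n)).
  exact: measurable_closed_box.
have mfK : measurable_fun (closed_box e z : set (leb_rV R n))
    (fun x : leb_rV R n => `|f x|%:E).
  apply/measurable_EFinP; apply: measurableT_comp => //.
  exact: measurable_funS mO BO mf.
exact: (ge0_subset_integral lebesgue_rV mB mK mfK (fun x _ => normr_ge0 (f x)) BK).
Qed.

(* The test functions are [tau_k (x_i) * prod_(j <> i) eta_k (x_j)], where [eta_k]
   increases to the indicator of the j-th side and [tau_k' = w_k - w_k (. - h)]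
   with [w_k] increasing to the indicator of the lower half of the i-th side. *)
Lemma halving_le Omega f g e z i : weak_gradient Omega f g ->
  measurable (Omega : set (leb_rV R n)) ->
  closed_box e z `<=` Omega ->
  (`| \int[lebesgue_rV]_(x in (dyadic_box (halve e i) (lower z i) : set (leb_rV R n))) (f x)%:E
    - \int[lebesgue_rV]_(x in (dyadic_box (halve e i) (upper z i) : set (leb_rV R n))) (f x)%:E |
   <= (2 ^- (e i).+1)%:E *
     \int[lebesgue_rV]_(x in (dyadic_box e z : set (leb_rV R n))) `|g x 0 i|%:E)%E.
Proof.
move=> [lf gint weak] mO BO.
set B := dyadic_box e z : set (leb_rV R n).
pose a j : R := (z j)%:~R / 2 ^+ e j.
pose b j : R := (z j + 1)%:~R / 2 ^+ e j.
have ab j : b j = a j + 2 ^- e j by rewrite /b /a intrD mulrDl mul1r.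
set h : R := 2 ^- (e i).+1.
have h0 : 0 < h by rewrite invr_gt0 exprn_gt0.
have bi : b i = a i + 2 * h.
  rewrite ab /h exprS invfM mulrA divff ?mul1r//.
pose w k := bump (a i) (a i + h) k.
have /choice[tau tauP] : forall k, exists tau : R -> R, smooth1 tau /\ [/\
    forall x : R, is_derive x 1 tau (w k x - w k (x - h)),
    forall x, x <= a i \/ a i + 2 * h <= x -> tau x = 0 &
    forall x, `|tau x| <= h].
  move=> k; have [|tau st Ht] := exists_tent (a := a i) h0 (smooth1_bump (a i) (a i + h) k)
    (bump_itv _ _ k).
    by move=> x; exact: bump_out.
  by exists tau.
pose u k j := if j == i then tau k else bump (a j) (b j) k.
pose v k j := if j == i then (fun x => w k x - w k (x - h)) else bump (a j) (b j) k.
have su k j : smooth1 (u k j).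
  by rewrite /u; case: eqP => _; [case: (tauP k)|exact: smooth1_bump].
have dE k : partial i (prodfun (u k)) = prodfun (v k).
  have [_ [dt _ _]] := tauP k.
  have du : forall x : R, is_derive x 1 (u k i) (w k x - w k (x - h)).
    by move=> x; rewrite /u eqxx; exact: dt.
  rewrite (partial_prodfun du).
  by congr prodfun; apply/funext => j; rewrite /v /u; case: eqP.
have outB x : ~ B x -> exists j, x 0 j <= a j \/ b j <= x 0 j.
  move=> /existsNP [j xj]; exists j; move: xj; rewrite dyadic_itvE /= in_itv /=.
  by move=> /negP; rewrite negb_and -ltNge -leNgt => /orP[/ltW|]; [left|right].
have u_out k x : ~ B x -> prodfun (u k) x = 0.
  move=> /outB [j xj]; rewrite /prodfun (bigD1 j)//= /u; case: eqP => ji.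
    by case: (tauP k) => _ [_ -> //]; rewrite ?mul0r// -bi -ji.
  by rewrite bump_out// mul0r.
have v_out k x : ~ B x -> prodfun (v k) x = 0.
  move=> /outB [j xj]; rewrite /prodfun (bigD1 j)//= /v; case: eqP => ji.
    rewrite ji in xj *; rewrite /w !bump_out ?subrr ?mul0r//.
      by rewrite bi in xj; case: xj => xj; [left|right]; lra.
    by rewrite bi in xj; case: xj => xj; [left|right]; lra.
  by rewrite bump_out// mul0r.
have test k : test_function Omega (prodfun (u k)).
  split; first exact: smooth_prodfun.
  exists (closed_box e z); split => //; first exact: (@compact_box R n a b).
  by move=> x xB; apply: u_out => /dyadic_box_closed.
have u_le k x : `|prodfun (u k) x| <= h.
  rewrite /prodfun (bigD1 i)//= normrM -[leRHS]mulr1 ler_pM//.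
    by rewrite /u eqxx; case: (tauP k) => _ [].
  rewrite normr_prod prodr_ile1// => j ji; rewrite /u (negPf ji).
  by have /andP[? ?] := bump_itv (a j) (b j) k (x 0 j); rewrite normr_ge0 ger0_norm.
have v_le k x : `|prodfun (v k) x| <= 1.
  rewrite /prodfun normr_prod prodr_ile1// => j _; rewrite normr_ge0 /= /v.
  case: eqP => _; last first.
    by have /andP[? ?] := bump_itv (a j) (b j) k (x 0 j); rewrite ger0_norm.
  by apply: norm_sub_le1; exact: bump_itv.
have mB : measurable B by exact: measurable_dyadic_box.
have BO' : B `<=` Omega.
  by move=> x xB; apply: BO; exact: dyadic_box_closed.
set Bl := dyadic_box (halve e i) (lower z i) : set (leb_rV R n).
set Bu := dyadic_box (halve e i) (upper z i) : set (leb_rV R n).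
have mBl : measurable Bl by exact: measurable_dyadic_box.
have mBu : measurable Bu by exact: measurable_dyadic_box.
have BE : B = Bl `|` Bu by exact: dyadic_box_halve.
have Bdisj : [disjoint Bl & Bu] by exact: dyadic_box_halve_disj.
have fB : lebesgue_rV.-integrable B (EFin \o f) := loc_integrable_box lf mO BO.
(* The limit of the derivatives of the test functions: 1 on the lower half and -1 on the upper
   half. *)
pose s (x : leb_rV R n) : R := \1_Bl x - \1_Bu x.
have ms : measurable_fun B s.
  by apply: measurable_funTS; apply: measurable_funB; exact: measurable_indic.
have mv k : measurable_fun B (prodfun (v k) : leb_rV R n -> R).
  apply: measurable_funTS; apply: measurable_prodfun => j; rewrite /v.
  case: eqP => _; last by apply: smooth1_continuous; exact: smooth1_bump.
  move=> x; apply: continuousB.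
    by apply: smooth1_continuous; exact: smooth1_bump.
  apply: (@continuous_comp _ _ _ (fun y : R => y - h)).
    by apply: cvgB; [exact: cvg_id|exact: cvg_cst].
  by apply: smooth1_continuous; exact: smooth1_bump.
have vs : {ae lebesgue_rV, forall x : leb_rV R n, B x ->
    prodfun (v k) x @[k --> \oo] --> s x}.
  (* The half-open box contains its lower faces, where cut-offs vanish, and the middle hyperplane,
     where both copies of [w k] vanish. *)
  have A1 : {ae lebesgue_rV, forall x : leb_rV R n, forall j, x 0 j <> a j}.
    apply: filter_forall => j; apply: negligibleS (negligible_hyperplane j (a j)).
    by move=> x /= /contrapT.
  have A2 : {ae lebesgue_rV, forall x : leb_rV R n, x 0 i <> a i + h}.
    apply: negligibleS (negligible_hyperplane i (a i + h)).
    by move=> x /= /contrapT.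
  apply: filterS2 A1 A2 => x xa xi Bx.
  have xab j : a j < x 0 j < b j.
    have := Bx j; rewrite dyadic_itvE /= in_itv /= -/(a j) -/(b j) => /andP[ax ->].
    by rewrite andbT lt_neqAle ax andbT; apply/eqP => /esym; exact: xa.
  have side (y : R) : (dyadic_itv (e i).+1 (z i * 2) y -> y < a i + h) /\
      (dyadic_itv (e i).+1 (z i * 2 + 1) y -> a i + h <= y).
    have ah : (z i * 2 + 1)%:~R / 2 ^+ (e i).+1 = a i + h.
      by rewrite /a /h exprS intrD intrM; field; rewrite expf_neq0.
    by split; rewrite dyadic_itvE /= in_itv /= ah => /andP[].
  have HE : (fun k => prodfun (v k) x) = (fun k => (w k (x 0 i) - w k (x 0 i - h)) *
      \prod_(j | j != i) bump (a j) (b j) k (x 0 j)).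
    apply/funext => k; rewrite /prodfun (bigD1 i)//= {1}/v eqxx; congr (_ * _).
    by apply: eq_bigr => j ji; rewrite /v (negPf ji).
  rewrite HE -[s x]mulr1; apply: cvgM; last first.
    by apply: cvg_prod1 => j _; exact: bump_cvg.
  have /andP[xai xbi] := xab i.
  have : (Bl `|` Bu) x by rewrite -BE.
  case=> [xl|xu].
    have xi' : x 0 i < a i + h.
      by apply: (side _).1; have := xl i; rewrite /halve /lower eqxx.
    have -> : s x = 1 - 0.
      rewrite /s !indicE mem_set// memNset// => xu.
      by have /disj_setPS/(_ x) := Bdisj; apply.
    apply: cvgB; first by apply: bump_cvg; rewrite xai.
    rewrite (_ : (fun k => _) = cst 0); first exact: cvg_cst.
    by apply/funext => k; rewrite /w bump_out//; left; lra.
  have xi' : a i + h < x 0 i.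
    rewrite lt_neqAle; apply/andP; split; first by apply/eqP => /esym.
    by apply: (side _).2; have := xu i; rewrite /halve /upper eqxx.
  have -> : s x = 0 - 1.
    rewrite /s !indicE memNset ?mem_set// => xl.
    by have /disj_setPS/(_ x) := Bdisj; apply.
  apply: cvgB; last by apply: bump_cvg; rewrite bi in xbi; lra.
  rewrite (_ : (fun k => _) = cst 0); first exact: cvg_cst.
  by apply/funext => k; rewrite /w bump_out//; right; exact: ltW.
(* The weak gradient identity moves the derivative to [g], against a test function bounded by the
   height [h] of the tent, half the side. *)
have bound k : (`|\int[lebesgue_rV]_(x in B) (f x * prodfun (v k) x)%:E| <=
    h%:E * \int[lebesgue_rV]_(x in B) `|g x 0 i|%:E)%E.
  have H1 : (\int[lebesgue_rV]_(x in (Omega : set (leb_rV R n))) (f x * prodfun (v k) x)%:E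
    = \int[lebesgue_rV]_(x in B) (f x * prodfun (v k) x)%:E)%E.
    by apply: integral_support => // x _ /v_out ->; rewrite mulr0.
  have H2 : (\int[lebesgue_rV]_(x in (Omega : set (leb_rV R n))) (g x 0 i * prodfun (u k) x)%:E
    = \int[lebesgue_rV]_(x in B) (g x 0 i * prodfun (u k) x)%:E)%E.
    by apply: integral_support => // x _ /u_out ->; rewrite mulr0.
  have := weak _ i (test k); rewrite dE H1 H2 => ->; rewrite abseN.
  have mg : measurable_fun B (fun x : leb_rV R n => g x 0 i).
    by apply: measurable_funS mO BO' _; case: (gint i).
  have mu_ : measurable_fun B (prodfun (u k) : leb_rV R n -> R).
    apply: measurable_funTS; apply: measurable_prodfun => j.
    exact: smooth1_continuous.
  exact: (abs_integral_mul_le lebesgue_rV mB mg mu_ (ltW h0) (fun x _ => u_le k x)).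
have := dominated_bound mB fB mv ms (fun k x _ => v_le k x) vs bound.
by rewrite BE in fB *; rewrite (integral_sign mBl mBu Bdisj fB).
Qed.

End halving.

(** * Poincare inequality on cubes *)

Section box_recursion.
Context {R : realType} {n : nat}.
Implicit Types (e : 'I_n -> nat) (z : 'I_n -> int) (i : 'I_n).

Definition volume e : R := \prod_i 2 ^- e i.
(** The potential of the recursion: halving side [i] lowers it by exactly the factor [2 ^- (e i).+1]
    of the halving inequality. *)
Definition width e : R := \sum_i 2 ^- e i.

Lemma volume_gt0 e : 0 < volume e.
Proof. by rewrite prodr_gt0// => i _; rewrite invr_gt0 exprn_gt0. Qed.

Lemma volume_halve e i : volume e = 2 * volume (halve e i).
Proof.
rewrite /volume (bigD1 i)//= [in RHS](bigD1 i)//= /halve eqxx exprS invfM !mulrA.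
rewrite divff// mul1r; congr (_ * _).
by apply: eq_bigr => j /negPf ->.
Qed.

Lemma width_halve e i : width e = width (halve e i) + 2 ^- (e i).+1.
Proof.
rewrite /width (bigD1 i)//= [in RHS](bigD1 i)//= /halve eqxx addrAC; congr (_ + _).
  by rewrite exprS invfM; field; rewrite expf_neq0.
by apply: eq_bigr => j /negPf ->.
Qed.

Lemma width_ge0 e : 0 <= width e.
Proof. by rewrite sumr_ge0// => i _; rewrite invr_ge0 exprn_ge0. Qed.

(** Replacing the means of the halves by the mean of the whole adds only
    [(r1 - r2) * ((vU1 - vU2) / (2 * v))] to the sum of the deviations. The last factor is at most 1
    in absolute value, so this costs at most [h * (g1 + g2)]. *)
Lemma half_split (rU1 rU2 vU1 vU2 r1 r2 v W g1 g2 h : R) : 0 < v ->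
  0 <= vU1 <= v -> 0 <= vU2 <= v -> 0 <= h -> 0 <= g1 -> 0 <= g2 ->
  `|rU1 - r1 / v * vU1| <= 2 * W * g1 ->
  `|rU2 - r2 / v * vU2| <= 2 * W * g2 ->
  `|r1 - r2| <= h * (g1 + g2) ->
  `|rU1 + rU2 - (r1 + r2) / (2 * v) * (vU1 + vU2)| <= 2 * (W + h) * (g1 + g2).
Proof.
move=> v0 /andP[u1 u1v] /andP[u2 u2v] h0 g10 g20 T1 T2 D.
have -> : rU1 + rU2 - (r1 + r2) / (2 * v) * (vU1 + vU2) =
    (rU1 - r1 / v * vU1) + (rU2 - r2 / v * vU2) + (r1 - r2) * ((vU1 - vU2) / (2 * v)).
  by field; rewrite lt0r_neq0.
apply: (le_trans (ler_normD _ _)); apply: (le_trans (lerD (ler_normD _ _) (lexx _))).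
have uv : `|(vU1 - vU2) / (2 * v)| <= 1.
  rewrite normrM [`|(2 * v)^-1|]gtr0_norm ?invr_gt0 ?mulr_gt0// ler_pdivrMr ?mulr_gt0//.
  by rewrite mul1r ler_norml; lra.
have : `|(r1 - r2) * ((vU1 - vU2) / (2 * v))| <= h * (g1 + g2).
  by rewrite normrM; apply: le_trans D; rewrite ler_piMr.
have : 0 <= h * (g1 + g2) by rewrite mulr_ge0// addr_ge0.
have -> : 2 * (W + h) * (g1 + g2) = 2 * W * g1 + 2 * W * g2 + 2 * (h * (g1 + g2)).
  by ring.
move=> c0 zc; apply: lerD; first exact: lerD.
by apply: (le_trans zc); rewrite ler_peMl// ler1n.
Qed.

(* [r], [gam], [vU], [rU] stand for the integrals over the box of [f], of [|g|], of
   [\1_U] and of [f * \1_U], where [U] is a union of cubes of generation [K]. *)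
Lemma box_recursion (K : nat) (inside : ('I_n -> nat) -> ('I_n -> int) -> Prop)
    (rU vU r gam : ('I_n -> nat) -> ('I_n -> int) -> R) :
  let additive X := forall e z i, inside e z ->
    X e z = X (halve e i) (lower z i) + X (halve e i) (upper z i) in
  (forall e z i, inside e z ->
    inside (halve e i) (lower z i) /\ inside (halve e i) (upper z i)) ->
  additive rU -> additive vU -> additive r -> additive gam ->
  (forall e z, 0 <= gam e z) ->
  (forall e z, 0 <= vU e z <= volume e) ->
  (forall e z i, inside e z ->
    `|r (halve e i) (lower z i) - r (halve e i) (upper z i)|
      <= 2 ^- (e i).+1 * gam e z) ->
  (forall e z, inside e z -> (forall i, (K <= e i)%N) ->
    rU e z = r e z / volume e * vU e z) ->
  forall e z, inside e z ->
  `|rU e z - r e z / volume e * vU e z| <= 2 * width e * gam e z.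
Proof.
move=> additive Hin arU avU ar agam gam0 vU01 diff term e z.
(* Induction on the number of halvings still to be made before every exponent reaches [K]. *)
have [m] := ubnP (\sum_i (K - e i))%N; elim: m e z => // m IH e z mK ez.
have [Ke|] := boolP [forall i, K <= e i]%N.
  rewrite term//; last by move=> i; exact: (forallP Ke).
  by rewrite subrr normr0 mulr_ge0 ?mulr_ge0 ?width_ge0.
rewrite negb_forall => /existsP[i]; rewrite -ltnNge => eK.
have [e1 e2] := Hin e z i ez.
have mK' : (\sum_j (K - halve e i j) < m)%N.
  apply: leq_trans (_ : \sum_j (K - e j) <= m)%N; last by [].
  rewrite (bigD1 i)//= [in leqRHS](bigD1 i)//= {1}/halve eqxx.
  rewrite (eq_bigr (fun j => K - e j)%N); last by move=> j /negPf ji; rewrite /halve ji.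
  by rewrite -addSn leq_add2r ltn_sub2l.
rewrite (arU e z i ez) (avU e z i ez) (ar e z i ez) (agam e z i ez).
rewrite (volume_halve e i) (width_halve e i).
apply: half_split; rewrite ?volume_gt0 ?vU01 ?gam0//.
- exact: IH.
- exact: IH.
- by rewrite -agam//; exact: diff.
Qed.

End box_recursion.

(** * Approximation of measurable sets in measure *)

Section approximation.
Context d (T : measurableType d) (R : realType) (mu : {measure set T -> \bar R}).
Implicit Types (A U : set T) (G : set (set T)).

Definition symdiff A U := (A `\` U) `|` (U `\` A).

Definition approximable G (B : set T) A : Prop := measurable A /\
  forall eps : R, 0 < eps -> exists2 U, G U & (mu (B `&` symdiff A U) <= eps%:E)%E.

Lemma measurable_symdiff A U : measurable A -> measurable U ->
  measurable (symdiff A U).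
Proof. by move=> mA mU; apply: measurableU; exact: measurableD. Qed.

Lemma le_measure_setU (X Y Z : set T) (a b : R) : measurable X -> measurable Y ->
  measurable Z -> X `<=` Y `|` Z -> (mu Y <= a%:E)%E -> (mu Z <= b%:E)%E ->
  (mu X <= (a + b)%:E)%E.
Proof.
move=> mX mY mZ XYZ Ya Zb.
apply: (@le_trans _ _ (mu (Y `|` Z))).
  by apply: le_measure => //; rewrite inE//; exact: measurableU.
apply: (le_trans (measureU2 mu mY mZ)).
by rewrite EFinD leeD.
Qed.

Lemma approximable_close G (B : set T) A : measurable B -> G `<=` measurable ->
  measurable A ->
  (forall eps : R, 0 < eps -> exists2 A', approximable G B A' &
    (mu (B `&` symdiff A A') <= eps%:E)%E) ->
  approximable G B A.
Proof.
move=> mB mG mA aA; split => // eps eps0.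
have e2 : 0 < eps / 2 by rewrite divr_gt0.
have [A' [mA' aA'] AA'] := aA _ e2; have [U GU A'U] := aA' _ e2.
have mU := mG _ GU.
exists U => //; rewrite (splitr eps).
apply: (@le_measure_setU _ (B `&` symdiff A A') (B `&` symdiff A' U)) => //;
  try by apply: measurableI => //; exact: measurable_symdiff.
move=> x [Bx [[Ax Ux]|[Ux Ax]]]; have [A'x|A'x] := pselect (A' x).
- by right; split => //; left.
- by left; split => //; left.
- by left; split => //; right.
- by right; split => //; right.
Qed.

Lemma approximable_setU G (B : set T) A A' : measurable B -> G `<=` measurable ->
  (forall A U, G A -> G U -> G (A `|` U)) ->
  approximable G B A -> approximable G B A' -> approximable G B (A `|` A').
Proof.
move=> mB mG GU [mA aA] [mA' aA']; split; first exact: measurableU.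
move=> eps eps0; have e2 : 0 < eps / 2 by rewrite divr_gt0.
have [U gU AU] := aA _ e2; have [U' gU' AU'] := aA' _ e2.
have mU := mG _ gU; have mU' := mG _ gU'.
exists (U `|` U'); first exact: GU.
rewrite (splitr eps).
apply: (@le_measure_setU _ (B `&` symdiff A U) (B `&` symdiff A' U')) => //;
  try by apply: measurableI => //; apply: measurable_symdiff => //; exact: measurableU.
move=> x [Bx [[[Ax|Ax] /not_orP[Ux Ux']]|[[Ux|Ux] /not_orP[Ax Ax']]]].
- by left; split => //; left.
- by right; split => //; left.
- by left; split => //; right.
- by right; split => //; right.
Qed.

(** Complements leave the symmetric difference unchanged. For a countable union, finite unions are
    approximable, and what they miss inside [B] decreases to the empty set, hence has measure
    tending to 0 because [B] has finite measure. *)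
Lemma approximable_sigma G (B : set T) : measurable B -> (mu B < +oo)%E ->
  G `<=` measurable -> G set0 ->
  (forall A, G A -> G (~` A)) -> (forall A U, G A -> G U -> G (A `|` U)) ->
  sigma_algebra setT (approximable G B).
Proof.
move=> mB Boo mG G0 GC GU.
have a0 : approximable G B set0.
  split=> // eps eps0; exists set0 => //.
  by rewrite /symdiff !set0D setU0 setI0 measure0 lee_fin ltW.
split => //.
- move=> A [mA aA]; rewrite setTD; split; first exact: measurableC.
  move=> eps /aA [U GU' AU]; exists (~` U); first exact: GC.
  by rewrite /symdiff !setDE !setCK (setIC _ U) (setIC _ A) -!setDE setUC.
- move=> F aF.
  have mF k : measurable (F k) by case: (aF k).
  have mUF : measurable (\bigcup_k F k) by exact: bigcupT_measurable.
  pose A N := \big[setU/set0]_(i < N) F i.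
  have aA N : approximable G B (A N).
    by apply: big_ind => // X Y; exact: approximable_setU.
  have mA N : measurable (A N) by case: (aA N).
  pose D N := B `&` (\bigcup_k F k `\` A N).
  have mD N : measurable (D N) by apply: measurableI => //; exact: measurableD.
  have D0 : \bigcap_N D N = set0.
    rewrite -subset0 => x xD; have [_ [[k _ Fkx] _]] := xD 0%N I.
    have [_ [_]] := xD k.+1 I; apply.
    by rewrite /A -bigcup_mkord; exists k => /=.
  have : mu \o D @ \oo --> mu (\bigcap_N D N).
    apply: nonincreasing_cvg_mu => //.
    - by apply: le_lt_trans Boo; apply: le_measure; rewrite ?inE//; exact: subIsetl.
    - by rewrite D0.
    - move=> a b ab; apply/subsetPset; apply: setIS; apply: setDS.
      exact: subset_bigsetU.
  rewrite D0 measure0 => cD.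
  apply: approximable_close => // eps eps0.
  have : \forall N \near \oo, (mu (D N) < eps%:E)%E.
    by apply: (cD [set y | (y < eps%:E)%E]); apply: open_ereal_lt'; rewrite lte_fin.
  case=> N _ /(_ N (leqnn N)) DN; exists (A N) => //.
  apply: le_trans (ltW DN); apply: le_measure; rewrite ?inE//.
    by apply: measurableI => //; exact: measurable_symdiff.
  move=> x [Bx [//|[AN nF]]]; exfalso; apply: nF.
  by move: AN; rewrite /A -bigcup_mkord => -[k _ Fk]; exists k.
Qed.

End approximation.

Section approximation_integral.
Context d (T : measurableType d) (R : realType) (mu : {measure set T -> \bar R}).
Implicit Types (A U B : set T) (G : set (set T)).

(** By absolute continuity, the integral of [|F|] over a small symmetric difference is at most
    [eps]. *)
Lemma approximable_Rintegral_le G B A (F : T -> R) (N : R) :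
  measurable B -> mu.-integrable B (EFin \o F) -> G `<=` measurable ->
  approximable mu G B A ->
  (forall U, G U -> `|\int[mu]_(x in B `&` U) F x| <= N) ->
  `|\int[mu]_(x in B `&` A) F x| <= N.
Proof.
move=> mB iF mG [mA aA] FN; apply/ler_addgt0Pr => eps eps0.
have iF' : mu.-integrable setT (EFin \o (F \_ B)).
  by rewrite -restrict_EFin; apply/integrable_restrict => //; rewrite setTI.
have [del [del0 Hdel]] := integral_normr_continuous iF' eps0.
have del2 : 0 < del / 2 by rewrite divr_gt0.
have [U GU AU] := aA _ del2; have mU := mG _ GU.
have iS X : measurable X -> X `<=` B -> mu.-integrable X (EFin \o F).
  by move=> mX XB; exact: integrableS iF.
have mBI X : measurable X -> measurable (B `&` X) by exact: measurableI.
have split2 X Y : measurable X -> measurable Y ->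
    \int[mu]_(x in B `&` X) F x = \int[mu]_(x in B `&` (X `&` Y)) F x +
      \int[mu]_(x in B `&` (X `\` Y)) F x.
  move=> mX mY; rewrite -Rintegral_setU.
  - by rewrite -setIUr setUIDK.
  - by apply: mBI; exact: measurableI.
  - by apply: mBI; exact: measurableD.
  - apply: iS; last by move=> x [] [].
    by apply: measurableU; apply: mBI; [exact: measurableI|exact: measurableD].
  - by apply/disj_setPS => x [[_ [_ Yx]] [_ [_ nY]]].
have D1 := split2 A U mA mU; have D2 := split2 U A mU mA.
have mAU : measurable (B `&` (A `\` U)) by apply: mBI; exact: measurableD.
have mUA : measurable (B `&` (U `\` A)) by apply: mBI; exact: measurableD.
have small : \int[mu]_(x in B `&` (A `\` U)) `|F x| +
    \int[mu]_(x in B `&` (U `\` A)) `|F x| < eps.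
  have mS : measurable (B `&` symdiff A U) by apply: mBI; exact: measurable_symdiff.
  have := Hdel _ mS; rewrite (le_lt_trans AU); last first.
    by rewrite lte_fin ltr_pdivrMr// ltr_pMr// ltr1n.
  move=> /(_ isT); apply: le_lt_trans.
  rewrite le_eqVlt; apply/orP; left; apply/eqP.
  transitivity (\int[mu]_(x in B `&` symdiff A U) `|F x|); last first.
    apply: eq_Rintegral => x; rewrite inE => -[Bx _].
    by rewrite patchE mem_set.
  rewrite /symdiff setIUr Rintegral_setU//.
    apply: integrableS (integrable_abse iF) => //; first exact: measurableU.
    by move=> x [] [].
  by apply/disj_setPS => x [[_ [Ax _]] [_ [_ nA]]].
have n1 : `|\int[mu]_(x in B `&` (A `\` U)) F x| <=
    \int[mu]_(x in B `&` (A `\` U)) `|F x|.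
  by apply: le_normr_Rintegral => //; apply: iS => // x [].
have n2 : `|\int[mu]_(x in B `&` (U `\` A)) F x| <=
    \int[mu]_(x in B `&` (U `\` A)) `|F x|.
  by apply: le_normr_Rintegral => //; apply: iS => // x [].
have := FN _ GU; rewrite D1 D2 (setIC U A).
move: n1 n2 small.
move: (Rintegral _ (B `&` (A `\` U)) F) (Rintegral _ (B `&` (U `\` A)) F) => a b.
move: (Rintegral _ _ _) (Rintegral _ _ _) (Rintegral _ _ _) => p q r.
rewrite !ler_norml; lra.
Qed.

(** The integral of [|F|] is that of [F] over the set where it is positive minus that over the
    complement; each has absolute value at most [N]. *)
Lemma integral_abs_le G B (F : T -> R) (N : R) :
  measurable B -> mu.-integrable B (EFin \o F) -> G `<=` measurable ->
  (forall A, measurable A -> approximable mu G B A) ->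
  (forall U, G U -> `|\int[mu]_(x in B `&` U) F x| <= N) ->
  (\int[mu]_(x in B) `|F x|%:E <= (2 * N)%:E)%E.
Proof.
move=> mB iF mG aG FN.
have mF : measurable_fun B F by case/integrableP : iF => /measurable_EFinP.
pose A := B `&` F @^-1` `]0, +oo[%classic.
have mA : measurable A by apply: mF => //; exact: measurable_itv.
have N1 := approximable_Rintegral_le mB iF mG (aG _ mA) FN.
have N2 := approximable_Rintegral_le mB iF mG (aG _ (measurableC mA)) FN.
have iaF : mu.-integrable B (EFin \o (fun x => `|F x|)) := integrable_abse iF.
have fin : (\int[mu]_(x in B) `|F x|%:E)%E \is a fin_num by exact: integrable_fin_num iaF.
rewrite -(fineK fin) lee_fin -[X in X <= _]/(\int[mu]_(x in B) `|F x|).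
have -> : B = (B `&` A) `|` (B `&` ~` A) by rewrite -setIUr setUv setIT.
rewrite Rintegral_setU//; last 4 first.
- exact: measurableI.
- by apply: measurableI => //; exact: measurableC.
- by rewrite -setIUr setUv setIT.
- by apply/disj_setPS => x [[_ Ax] [_ nA]].
have -> : \int[mu]_(x in B `&` A) `|F x| = \int[mu]_(x in B `&` A) F x.
  apply: eq_Rintegral => x; rewrite inE => -[_ [_]] /=.
  by rewrite in_itv /= andbT => /ltW/ger0_norm.
have -> : \int[mu]_(x in B `&` ~` A) `|F x| = - \int[mu]_(x in B `&` ~` A) F x.
  rewrite /Rintegral -fineN -integralN; last first.
    apply: integrable_add_def; first by apply: measurableI => //; exact: measurableC.
    apply: integrableS iF => //.
    by apply: measurableI => //; exact: measurableC.
  congr fine; apply: eq_integral => x; rewrite inE => -[Bx nA].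
  rewrite -EFinN ler0_norm// leNgt; apply/negP => Fx; apply: nA.
  by split => //=; rewrite in_itv /= andbT.
by move: N1 N2; rewrite !ler_norml; lra.
Qed.

End approximation_integral.

(** * Unions of dyadic cubes and the Poincare inequality *)

Section poincare.
Context {R : realType} {n : nat}.
Implicit Types (Omega : set 'rV[R]_n) (f : 'rV[R]_n -> R).

(** A union of cubes of generation [K], expressed by invariance so that complements and unions are
    immediate. *)
Definition saturated K (U : set 'rV[R]_n) :=
  forall x y : 'rV[R]_n, dyadic_index K x = dyadic_index K y -> U x -> U y.

Definition dyadic_sets : set (set (leb_rV R n)) :=
  [set U | exists K, saturated K U].

Lemma dyadic_index_coarse K L (x y : 'rV[R]_n) : (K <= L)%N ->
  dyadic_index L x = dyadic_index L y -> dyadic_index K x = dyadic_index K y.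
Proof.
move=> KL /rowP xy; apply/rowP => i; have := xy i.
by rewrite !mxE; exact: floor_coarse.
Qed.

Lemma saturatedS K L (U : set 'rV[R]_n) : (K <= L)%N -> saturated K U -> saturated L U.
Proof. by move=> KL sU x y xy; apply: sU; exact: dyadic_index_coarse xy. Qed.

Lemma saturatedC K (U : set 'rV[R]_n) : saturated K U -> saturated K (~` U).
Proof. by move=> sU x y xy nUx Uy; apply: nUx; apply: sU Uy. Qed.

Lemma saturatedU K (U V : set 'rV[R]_n) : saturated K U -> saturated K V ->
  saturated K (U `|` V).
Proof. by move=> sU sV x y xy [Ux|Vx]; [left; apply: sU Ux|right; apply: sV Vx]. Qed.

Lemma measurable_dyadic_sets : dyadic_sets `<=` measurable.
Proof.
move=> U [K sU].
have -> : U = \bigcup_z (if z \in (dyadic_index K @` U : set 'rV[int]_n)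
    then cube K z else set0).
  apply/seteqP; split => [x Ux|x [z _]].
    exists (dyadic_index K x) => //; rewrite mem_set; last by exists x.
    exact/cubeP.
  by case: ifPn => //; rewrite inE => -[y Uy <-] /cubeP xy; apply: sU Uy.
apply: countable_bigcupT_measurable => [|z]; first exact: countableP.
by case: ifP => // _; exact: measurable_dyadic_box.
Qed.

Section approx.
Context (B : set (leb_rV R n)).
Context (mB : measurable B) (Boo : (lebesgue_rV B < +oo)%E).

Let approx := approximable (@lebesgue_rV R n) dyadic_sets B.

Let approx_sigma : sigma_algebra setT approx.
Proof.
apply: approximable_sigma => //.
- exact: measurable_dyadic_sets.
- by exists 0%N.
- by move=> A [K sA]; exists K; exact: saturatedC.
- move=> A U [K sA] [L sU]; exists (maxn K L); apply: saturatedU.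
    by apply: saturatedS sA; exact: leq_maxl.
  by apply: saturatedS sU; exact: leq_maxr.
Qed.

Let approx_dyadic (U : set (leb_rV R n)) : dyadic_sets U -> approx U.
Proof.
move=> GU; split; first exact: measurable_dyadic_sets.
move=> eps eps0; exists U => //.
by rewrite /symdiff setDv setU0 setI0 measure0 lee_fin ltW.
Qed.

(** A coordinate lies below [c] exactly when the upper end of its cell, which it never attains, is
    at most [c] for some generation. *)
Let approx_ray i (c : R) : approx [set x : 'rV[R]_n | x 0 i < c].
Proof.
have -> : [set x : 'rV[R]_n | x 0 i < c] =
    \bigcup_k [set x : 'rV[R]_n | (dyadic_index k x 0 i + 1)%:~R / 2 ^+ k <= c].
  apply/seteqP; split => x /=.
    move=> xc; have : 0 < c - x 0 i by rewrite subr_gt0.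
    move=> /exp2V_lt [k /(_ k (leqnn k)) kc]; exists k => //=.
    have k0 : 0 < 2 ^+ k :> R by rewrite exprn_gt0.
    rewrite mxE intrD mulrDl mul1r.
    have : (Num.floor (2 ^+ k * x 0 i))%:~R / 2 ^+ k <= x 0 i.
      by rewrite ler_pdivrMr// mulrC; exact: floor_le.
    lra.
  move=> [k _] /=; apply: lt_le_trans; rewrite mxE.
  by rewrite ltr_pdivlMr ?exprn_gt0// mulrC; exact: floorD1_gt.
case: approx_sigma => _ _ sU; apply: sU => k; apply: approx_dyadic.
by exists k => x y /= ->.
Qed.

Let approx_borel (A : set 'rV[R]_n) : measurable A -> approx A.
Proof.
case: approx_sigma => s0 sC sU.
move=> mA; apply: mA; split.
  split => //.
have coord i (Y : set R) : measurable Y -> approx (rV_coord i @^-1` Y).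
  move=> mY; have {mY} mY : (@ocitv R).-sigma.-measurable Y by exact: mY.
  move: mY; rewrite RGenInftyO.measurableE => mY.
  apply: (mY [set Y | approx (rV_coord i @^-1` Y)]); split.
    split.
    - by rewrite /= preimage_set0.
    - by move=> X aX; rewrite /= setTD preimage_setC -setTD; exact: sC.
    - by move=> F aF; rewrite /= preimage_bigcup; exact: sU.
  by move=> _ [c ->] /=; exact: approx_ray.
move=> X; rewrite -bigcup_seq => -[i _ [Y mY <-]].
by rewrite setTI; exact: coord.
Qed.

(** The measure is an infimum over countable Borel covers, so [A] intersected with [B] lies in a
    Borel set [C] of nearly the same measure; Borel sets are already approximable. *)
Lemma approximable_lebesgue (A : set (leb_rV R n)) : measurable A ->
  approximable (@lebesgue_rV R n) dyadic_sets B A.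
Proof.
move=> mA; apply: approximable_close => //; first exact: measurable_dyadic_sets.
move=> eps eps0.
have mX : measurable (A `&` B) by exact: measurableI.
have Xfin : lebesgue_rV (A `&` B) \is a fin_num.
  rewrite ge0_fin_numE//; apply: le_lt_trans Boo.
  by apply: le_measure; rewrite ?inE//; exact: subIsetr.
have [_ [F [mF XF] <-] Feps] := lb_ereal_inf_adherent eps0 Xfin.
pose C := \bigcup_k F k.
have mC : measurable C by exact: bigcupT_measurable.
have mC' : measurable (C : set (leb_rV R n)) by exact: measurable_leb_rV.
exists C; first exact: approx_borel.
have CX : (lebesgue_rV (C : set (leb_rV R n)) <= lebesgue_rV (A `&` B) + eps%:E)%E.
  apply: le_trans (ltW Feps).
  by apply: ereal_inf_lbound; exists F => //; split => // x.
have mCX : measurable ((C : set (leb_rV R n)) `\` (A `&` B)) by exact: measurableD.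
apply: (@le_trans _ _ (lebesgue_rV ((C : set (leb_rV R n)) `\` (A `&` B)))).
  apply: le_measure; rewrite ?inE//.
    by apply: measurableI => //; exact: measurable_symdiff.
  move=> x [Bx [[Ax nC]|[Cx nA]]]; last by split => // -[].
  by exfalso; apply: nC; apply: XF.
have CE : (C : set (leb_rV R n)) =
    (A `&` B) `|` ((C : set (leb_rV R n)) `\` (A `&` B)).
  by rewrite setDUK.
move: CX; rewrite {1}CE measureU//; last by rewrite setDIK.
by rewrite leeD2lE.
Qed.

End approx.

Lemma closed_box_halve (e : 'I_n -> nat) (z : 'I_n -> int) i :
  (closed_box (halve e i) (lower z i) `<=` (closed_box e z : set 'rV[R]_n)) /\
  (closed_box (halve e i) (upper z i) `<=` (closed_box e z : set 'rV[R]_n)).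
Proof.
have e2 j : 2 ^+ (e j).+1 = 2 * 2 ^+ e j :> R by rewrite exprS.
have ej j : 0 < 2 ^+ e j :> R by rewrite exprn_gt0.
have el j : 0 < (2 ^+ e j)^-1 :> R by rewrite invr_gt0.
by split => x xB j; have := xB j; rewrite /halve ?/lower ?/upper; case: eqP => // _;
  rewrite e2 invfM !mulrA !intrD ?intrM;
  have := el j; move: (_^-1 : R) (z j)%:~R => u v; nra.
Qed.

Lemma measurable_enorm_comp (D : set (leb_rV R n)) (g : leb_rV R n -> 'rV[R]_n) :
  (forall i, measurable_fun D (fun x => g x 0 i)) ->
  measurable_fun D (fun x => enorm (g x)).
Proof.
move=> mg; apply: (measurableT_comp (f := @Num.sqrt R)).
  by apply: continuous_measurable_fun; exact: sqrt_continuous.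
by apply: measurable_sum => i; exact: measurable_funX.
Qed.

Lemma coord_le_enorm (v : 'rV[R]_n) i : `|v 0 i| <= enorm v.
Proof.
rewrite /enorm -sqrtr_sqr ler_wsqrtr// (bigD1 i)//= lerDl sumr_ge0// => j _.
exact: sqr_ge0.
Qed.

(** The constant [c] is the mean of [f]. The factor 4 combines the 2 of [box_recursion] with the 2
    of [integral_abs_le], and [n 2^-k] is the sum of the sides. *)
Lemma poincare_cube Omega f g k (z : 'rV[int]_n) : weak_gradient Omega f g ->
  measurable (Omega : set (leb_rV R n)) ->
  closed_box (fun=> k) (fun i => z 0 i) `<=` Omega ->
  (\int[lebesgue_rV]_(x in (cube k z : set (leb_rV R n))) (enorm (g x))%:E < +oo)%E ->
  exists c : R,
  (\int[lebesgue_rV]_(x in (cube k z : set (leb_rV R n))) `|f x - c|%:E <=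
   (4 * (n%:R * 2 ^- k))%:E *
    \int[lebesgue_rV]_(x in (cube k z : set (leb_rV R n))) (enorm (g x))%:E)%E.
Proof.
move=> wg mO BO goo; have [lf gint _] := wg.
set Q := cube k z : set (leb_rV R n).
have mQ : measurable Q by exact: measurable_dyadic_box.
have QO : Q `<=` Omega.
  by move=> x xQ; apply: BO; exact: dyadic_box_closed.
have mg : measurable_fun Q (fun x : leb_rV R n => enorm (g x)).
  apply: measurable_funS mO QO _; apply: measurable_enorm_comp => i.
  by case: (gint i).
have ig : lebesgue_rV.-integrable Q (EFin \o (fun x : leb_rV R n => enorm (g x))).
  apply/integrableP; split; first exact/measurable_EFinP.
  apply: le_lt_trans goo; rewrite le_eqVlt; apply/orP; left; apply/eqP.
  by apply: eq_integral => x _ /=; rewrite ger0_norm// enorm_ge0.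
have if_ : lebesgue_rV.-integrable Q (EFin \o f).
  exact: loc_integrable_box lf mO BO.
have Qoo : (lebesgue_rV Q < +oo)%E by rewrite lebesgue_cube ltry.
pose e0 : 'I_n -> nat := fun=> k; pose z0 i := z 0 i.
pose box e y : set (leb_rV R n) := dyadic_box e y.
have mbox e y : measurable (box e y) by exact: measurable_dyadic_box.
pose inside e y := box e y `<=` Q /\ closed_box e y `<=` Omega.
have boxE e y i : box e y = box (halve e i) (lower y i) `|` box (halve e i) (upper y i).
  exact: dyadic_box_halve.
have boxD e y i : [disjoint box (halve e i) (lower y i) & box (halve e i) (upper y i)].
  exact: dyadic_box_halve_disj.
have vbox e y : lebesgue_rV (box e y) = (volume e)%:E by exact: lebesgue_dyadic_box.
have Qin : inside e0 z0 by split.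
have insideS e y i : inside e y ->
    inside (halve e i) (lower y i) /\ inside (halve e i) (upper y i).
  move=> [bQ cO]; have [c1 c2] := closed_box_halve e y i.
  split; split; try exact: subset_trans cO.
    by apply: subset_trans bQ; rewrite (boxE e y i); exact: subsetUl.
  by apply: subset_trans bQ; rewrite (boxE e y i); exact: subsetUr.
pose r e y := \int[lebesgue_rV]_(x in box e y) f x.
pose gam e y := \int[lebesgue_rV]_(x in box e y) (enorm (g x)).
pose c := r e0 z0 / volume e0.
have iS (F : leb_rV R n -> R) X : lebesgue_rV.-integrable Q (EFin \o F) ->
    measurable X -> X `<=` Q -> lebesgue_rV.-integrable X (EFin \o F).
  by move=> iF mX XQ; exact: integrableS iF.
have addR (F : leb_rV R n -> R) e y i : lebesgue_rV.-integrable Q (EFin \o F) ->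
    inside e y -> \int[lebesgue_rV]_(x in box e y) F x =
    \int[lebesgue_rV]_(x in box (halve e i) (lower y i)) F x +
    \int[lebesgue_rV]_(x in box (halve e i) (upper y i)) F x.
  move=> iF [bQ _]; rewrite (boxE e y i) Rintegral_setU//.
  by apply: iS => //; [exact: measurableU|rewrite -boxE].
have diff e y i : inside e y ->
    `|r (halve e i) (lower y i) - r (halve e i) (upper y i)|
      <= 2 ^- (e i).+1 * gam e y.
  move=> ey; have [[bl _] [bu _]] := insideS _ _ i ey; have [bQ cO] := ey.
  have fl : (\int[lebesgue_rV]_(x in box (halve e i) (lower y i)) (f x)%:E)%E \is a fin_num.
    by apply: integrable_fin_num => //; exact: iS.
  have fu : (\int[lebesgue_rV]_(x in box (halve e i) (upper y i)) (f x)%:E)%E \is a fin_num.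
    by apply: integrable_fin_num => //; exact: iS.
  have fg : (\int[lebesgue_rV]_(x in box e y) (enorm (g x))%:E)%E \is a fin_num.
    by apply: integrable_fin_num => //; exact: iS.
  rewrite -lee_fin EFinM /gam /Rintegral fineK//.
  rewrite -[X in (X <= _)%E]/(`|(r (halve e i) (lower y i) - r (halve e i) (upper y i))%:E|)%E.
  rewrite EFinB /r /Rintegral !fineK//.
  apply: (le_trans (halving_le i wg mO cO)).
  apply: lee_wpmul2l; first by rewrite lee_fin invr_ge0 exprn_ge0.
  have bO : box e y `<=` Omega by exact: subset_trans QO.
  have mgi : measurable_fun (box e y) (fun x : leb_rV R n => g x 0 i).
    by apply: measurable_funS mO bO _; case: (gint i).
  have mgi' : measurable_fun (box e y) (fun x : leb_rV R n => `|g x 0 i|).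
    by apply: (measurableT_comp (f := @Num.norm R R)).
  have mge : measurable_fun (box e y) (fun x : leb_rV R n => enorm (g x)).
    exact: measurable_funS mQ bQ mg.
  apply: (le_integral_EFin lebesgue_rV (mbox e y) mgi' mge) => x _.
  by rewrite normr_ge0 coord_le_enorm.
have icst : lebesgue_rV.-integrable Q (EFin \o (fun=> c)).
  exact: (integrable_cst c mQ Qoo).
have main U : dyadic_sets U ->
   `|\int[lebesgue_rV]_(x in Q `&` U) (f x - c)| <= 2 * width e0 * gam e0 z0.
  move=> GU; have mU := measurable_dyadic_sets GU; have [K sU] := GU.
  have mbU e y : measurable (box e y `&` U) by exact: measurableI.
  pose rU e y := \int[lebesgue_rV]_(x in box e y `&` U) f x.
  pose vU e y := fine (lebesgue_rV (box e y `&` U)).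
  have vUfin e y : lebesgue_rV (box e y `&` U) \is a fin_num.
    rewrite ge0_fin_numE//; apply: (@le_lt_trans _ _ (lebesgue_rV (box e y))).
      by apply: le_measure; rewrite ?inE//; exact: subIsetl.
    by rewrite vbox ltry.
  have disjU e y i : [disjoint box (halve e i) (lower y i) `&` U
      & box (halve e i) (upper y i) `&` U].
    apply/disj_setPS => x [[xl _] [xu _]].
    by have /disj_setPS/(_ x) := boxD e y i; apply.
  have inQ e y : inside e y -> forall X, X `<=` box e y -> X `<=` Q.
    by case=> bQ _ X Xb; exact: subset_trans bQ.
  have arU e y i : inside e y -> rU e y =
      rU (halve e i) (lower y i) + rU (halve e i) (upper y i).
    move=> ey; rewrite /rU (boxE e y i) setIUl Rintegral_setU//.
    apply: iS => //; first exact: measurableU.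
    by apply: (inQ e y ey); rewrite -setIUl -boxE; exact: subIsetl.
  have avU e y i : inside e y -> vU e y =
      vU (halve e i) (lower y i) + vU (halve e i) (upper y i).
    move=> _; rewrite /vU (boxE e y i) setIUl measureU//; last first.
      by apply/disj_set2P.
    rewrite fineD; [by []|exact: vUfin|exact: vUfin].
  have vU01 e y : 0 <= vU e y <= volume e.
    rewrite fine_ge0//= -lee_fin fineK// -(vbox e y).
    by apply: le_measure; rewrite ?inE//; exact: subIsetl.
  have gam0 e y : 0 <= gam e y by apply: Rintegral_ge0 => x _; exact: enorm_ge0.
  (* Such a box lies in a single cube of generation [K], so [U] contains it or misses it. *)
  have term e y : inside e y -> (forall i, (K <= e i)%N) ->
      rU e y = r e y / volume e * vU e y.
    move=> ey Ke; have [[x [xb Ux]]|N] := pselect (box e y `&` U !=set0).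
      have -> : rU e y = r e y.
        rewrite /rU /r; congr Rintegral; apply/setIidl => x' xb'.
        apply: sU Ux; apply/rowP => i; rewrite !mxE.
        by apply: floor_coarse (Ke i) _; rewrite (xb i) (xb' i).
      have -> : vU e y = volume e.
        rewrite /vU (_ : _ `&` _ = box e y) ?vbox//; apply/setIidl => x' xb'.
        apply: sU Ux; apply/rowP => i; rewrite !mxE.
        by apply: floor_coarse (Ke i) _; rewrite (xb i) (xb' i).
      by rewrite divfK// lt0r_neq0// volume_gt0.
    have E : box e y `&` U = set0 by apply/eqP/negPn/negP => /set0P.
    by rewrite /rU /vU E Rintegral_set0 measure0 /= mulr0.
  have := @box_recursion R n K inside rU vU r gam insideS arU avU
    (fun e y i => addR f e y i if_) (fun e y i => addR _ e y i ig) gam0 vU01 diff term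
    e0 z0 Qin.
  rewrite -/c; congr (`|_| <= _).
  have QUfin : lebesgue_rV (Q `&` U) \is a fin_num by exact: (vUfin e0 z0).
  rewrite (RintegralB (mbU e0 z0) (iS _ _ if_ (mbU e0 z0) (@subIsetl _ Q U))
    (iS _ _ icst (mbU e0 z0) (@subIsetl _ Q U))).
  by rewrite Rintegral_cst; last exact: (mbU e0 z0).
exists c.
have ic : lebesgue_rV.-integrable Q (EFin \o (fun x : leb_rV R n => f x - c)).
  exact: (integrableB mQ if_ icst).
have N := integral_abs_le mQ ic measurable_dyadic_sets
  (approximable_lebesgue mQ Qoo) main.
apply: (le_trans N).
have fg : (\int[lebesgue_rV]_(x in Q) (enorm (g x))%:E)%E \is a fin_num.
  exact: integrable_fin_num ig.
rewrite -(fineK fg) -EFinM lee_fin.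
have -> : width e0 = n%:R * 2 ^- k :> R.
  by rewrite /width (eq_bigr (fun=> 2 ^- k))// sumr_const card_ord mulr_natl.
rewrite /gam /Rintegral -/Q le_eqVlt; apply/orP; left; apply/eqP; ring.
Qed.

End poincare.

(** * Choice of exponents and the individual seminorms *)

Section sobolev.
Context {R : realType} {n : nat}.
Implicit Types (Omega : set 'rV[R]_n) (f : 'rV[R]_n -> R).

(** Here [u] is [1 / p], and 0 for [p = +oo]. With [d = N - t'] between [N - t] and
    [sigma / (alpha^-1 + u)], the number [gamma] is the midpoint of the window from [d / alpha] to
    [sigma - d u]. *)
Lemma exists_exponents (N sigma alpha u t : R) : 0 < alpha -> 0 <= u ->
  0 < sigma -> N - sigma / (alpha^-1 + u) < t ->
  exists t' gamma, [/\ t' < t, 0 < sigma - (N - t') * u,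
    gamma < sigma - (N - t') * u & N - t' < alpha * gamma].
Proof.
move=> a0 u0 s0 st; set v := alpha^-1 + u in st.
have v0 : 0 < v by rewrite ltr_wpDr// invr_gt0.
have w0 : 0 < sigma / v by rewrite divr_gt0.
(* The lower bound for [d] is the maximum of 0 and [N - t]; in both cases a midpoint is taken. *)
have [d [d0 dt dv]] : exists d, [/\ 0 < d, N - d < t & d < sigma / v].
  have [Nt|Nt] := leP (N - t) 0.
    by exists (sigma / v / 2); split; lra.
  by exists ((N - t + sigma / v) / 2); split; lra.
have ds : d * alpha^-1 < sigma - d * u.
  by rewrite ltrBrDr -mulrDr -ltr_pdivlMr.
have da0 : 0 < d * alpha^-1 by rewrite mulr_gt0// invr_gt0.
exists (N - d), ((d * alpha^-1 + (sigma - d * u)) / 2).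
rewrite opprB addrCA subrr addr0; split => //; [lra|lra|].
by rewrite mulrC -ltr_pdivrMr//; lra.
Qed.

(** The oscillation bound is asked for every [t'], since the proof chooses [t'] afterwards. *)
Lemma hausdorff_zero_average_le Omega f (h : leb_rV R n -> \bar R)
    (C sigma alpha u t : R) :
  (0 < n)%N -> open Omega ->
  measurable_fun (Omega : set (leb_rV R n)) (f : leb_rV R n -> R) ->
  measurable_fun (Omega : set (leb_rV R n)) h ->
  (forall x : 'rV[R]_n, Omega x -> (abs_powN alpha (f x) <= h x)%E) ->
  (\int[lebesgue_rV]_(x in (Omega : set (leb_rV R n))) h x < +oo)%E ->
  0 < alpha -> 0 <= C -> 0 <= u -> 0 < sigma -> 0 < t ->
  n%:R - sigma / (alpha^-1 + u) < t ->
  (forall t' k (z : 'rV[int]_n), closed_box (fun=> k) (fun i => z 0 i) `<=` Omega ->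
    (\int[lebesgue_rV]_(x in (cube k z : set (leb_rV R n))) h x
       <= ((2 ^- k) `^ t')%:E)%E ->
    exists c : R,
    (\int[lebesgue_rV]_(x in (cube k z : set (leb_rV R n))) `|f x - c|%:E
       <= (C * (2 ^- k) `^ (sigma - (n%:R - t') * u) * 2 ^- (k * n))%:E)%E) ->
  hausdorff_measure t (zero_average_set Omega f) = 0%E.
Proof.
move=> n0 oO mf mh hf hoo a0 C0 u0 s0 t0 st osc.
have [t' [gamma [tt' b0 gb ga]]] := exists_exponents a0 u0 s0 st.
exact: (hausdorff_zero_average n0 oO mf mh hf hoo a0 C0 b0 gb ga t0 tt' (osc t')).
Qed.

Lemma measurable_abs_powN d (T : measurableType d) (D : set T) alpha (f : T -> R) :
  measurable_fun D f -> measurable_fun D (fun x => abs_powN alpha (f x)).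
Proof.
apply: (measurableT_comp (f := @abs_powN R alpha)).
apply: measurable_fun_ifT => //.
- apply: (measurable_fun_bool true).
  rewrite (_ : _ @^-1` _ = [set 0]) ?setTI//.
  by apply/seteqP; split => [_ /eqP ->//|_ -> /=]; rewrite eqxx.
- apply/measurable_EFinP.
  by apply: (measurableT_comp (measurable_powR (- alpha))).
Qed.

Lemma closed_box_cube Omega k (z : 'rV[int]_n) :
  closed_box (fun=> k) (fun i => z 0 i) `<=` Omega -> cube k z `<=` Omega.
Proof. by apply: subset_trans; exact: dyadic_box_closed. Qed.

Lemma exists_weak_gradient Omega p f : (gradient_seminorm Omega p f < +oo)%E ->
  exists2 g, weak_gradient Omega f g & (Lnorm_on Omega p (enorm \o g) < +oo)%E.
Proof. by move=> /ereal_inf_lt[_ [g wg <-] goo]; exists g. Qed.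

Lemma Lnorm_on_finite Omega (q : R) (F : 'rV[R]_n -> R) : 0 < q ->
  (Lnorm_on Omega q%:E F < +oo)%E ->
  (\int[lebesgue_rV]_(x in (Omega : set (leb_rV R n))) (`|F x| `^ q)%:E < +oo)%E.
Proof.
move=> q0; rewrite /Lnorm_on unlock => /lty_poweRy; rewrite invr_neq0 ?lt0r_neq0//.
move=> /(_ isT); congr (_ < _)%E; rewrite [RHS]integral_mkcond.
apply: eq_integral => x _; rewrite !patchE; case: ifPn => //= _.
by rewrite normr0 powR0// lt0r_neq0.
Qed.

Lemma Lnorm_on_pinfty Omega (F : 'rV[R]_n -> R) : (Lnorm_on Omega +oo%E F < +oo)%E ->
  exists2 L : R, 0 <= L &
    {ae lebesgue_rV, forall x : leb_rV R n, Omega x -> `|F x| <= L}.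
Proof.
rewrite /Lnorm_on unlock; case: ifPn => [T0|]; last first.
  (* If the whole space is null, any bound holds almost everywhere. *)
  rewrite -leNgt => T0 _; exists 0 => //; exists setT; split => //.
  by apply/eqP; rewrite eq_le T0 measure_ge0.
set E := ess_sup _ _ => Eoo.
have E0 : (0 <= E)%E by apply: ess_sup_gee => //; apply: nearW => x /=.
exists (fine E); first exact: fine_ge0.
have := ess_sup_ge lebesgue_rV (abse \o (EFin \o F) \_ Omega); apply: filterS => x.
rewrite /= patchE => + Ox; rewrite mem_set//= -/E -{1}[E]fineK ?lee_fin//.
by rewrite ge0_fin_numE.
Qed.

Lemma gradient_oscillation_le Omega f g k (z : 'rV[int]_n) (b : R) :
  weak_gradient Omega f g -> measurable (Omega : set (leb_rV R n)) ->
  closed_box (fun=> k) (fun i => z 0 i) `<=` Omega ->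
  (\int[lebesgue_rV]_(x in (cube k z : set (leb_rV R n))) (enorm (g x))%:E
     <= b%:E)%E ->
  exists c : R,
  (\int[lebesgue_rV]_(x in (cube k z : set (leb_rV R n))) `|f x - c|%:E <=
     (4 * (n%:R * 2 ^- k) * b)%:E)%E.
Proof.
move=> wg mO QO gb.
have [c cf] := poincare_cube wg mO QO (le_lt_trans gb (ltry b)); exists c.
apply: (le_trans cf); rewrite [leRHS]EFinM; exact: lee_wpmul2l.
Qed.

Lemma measurable_weak_gradient Omega f g : weak_gradient Omega f g ->
  measurable_fun (Omega : set (leb_rV R n)) (fun x : leb_rV R n => enorm (g x)).
Proof. by case=> _ mg _; apply: measurable_enorm_comp => i; have [] := mg i. Qed.

Lemma gradient_oscillation Omega q (t' : R) f g (h : leb_rV R n -> \bar R)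
    k (z : 'rV[int]_n) :
  1 <= q -> weak_gradient Omega f g ->
  measurable (Omega : set (leb_rV R n)) ->
  measurable_fun (Omega : set (leb_rV R n)) h ->
  (forall x : 'rV[R]_n, Omega x -> ((enorm (g x) `^ q)%:E <= h x)%E) ->
  closed_box (fun=> k) (fun i => z 0 i) `<=` Omega ->
  (\int[lebesgue_rV]_(x in (cube k z : set (leb_rV R n))) h x
       <= ((2 ^- k) `^ t')%:E)%E ->
  exists c : R,
    (\int[lebesgue_rV]_(x in (cube k z : set (leb_rV R n))) `|f x - c|%:E
       <= (8 * n%:R * (2 ^- k) `^ (1 - (n%:R - t') * q^-1) * 2 ^- (k * n))%:E)%E.
Proof.
move=> q1 wg mO mh gh BO hQ; have QO := closed_box_cube BO.
set l : R := 2 ^- k; have l0 : 0 < l by rewrite invr_gt0 exprn_gt0.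
have q0 : 0 < q by lra.
pose Q := cube k z : set (leb_rV R n).
have mQ : measurable Q by exact: measurable_dyadic_box.
have vQ : lebesgue_rV Q = (2 ^- (k * n) : R)%:E by exact: lebesgue_cube.
have vE : 2 ^- (k * n) = l ^+ n by rewrite /l exprVn -exprM.
have mhQ : measurable_fun Q h := measurable_funS mO QO mh.
have mgQ := measurable_funS mO QO (measurable_weak_gradient wg).
have mgq : measurable_fun Q (fun x : leb_rV R n => enorm (g x) `^ q).
  exact: (measurableT_comp (measurable_powR q) mgQ).
have gq0 (x : 'rV[R]_n) : (0 <= (enorm (g x) `^ q)%:E)%E by rewrite lee_fin powR_ge0.
have gQ : (\int[lebesgue_rV]_(x in Q) (enorm (g x) `^ q)%:E <= (l `^ t')%:E)%E.
  apply: (le_trans _ hQ).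
  have mgqE : measurable_fun Q (EFin \o (fun x : leb_rV R n => enorm (g x) `^ q)).
    exact/measurable_EFinP.
  apply: (ge0_le_integral lebesgue_rV mQ (fun x _ => gq0 x) mgqE mhQ) => x /QO.
  exact: gh.
set M := l `^ ((t' - n%:R) / q).
have M0 : 0 < M by rewrite powR_gt0.
have gi : (\int[lebesgue_rV]_(x in Q) (enorm (g x))%:E <=
    (M * l ^+ n + M `^ (1 - q) * l `^ t')%:E)%E.
  rewrite -vE.
  apply: (integral_affine_le mQ mgQ mgq vQ (ltW M0) (powR_ge0 _ _) _ _ gQ) => x _.
    exact: powR_ge0.
  by rewrite enorm_ge0 le_young// enorm_ge0.
have [c cf] := gradient_oscillation_le wg mO BO gi; exists c.
apply: (le_trans cf); rewrite lee_fin vE.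
have lD r s : l `^ (r + s) = l `^ r * l `^ s.
  by rewrite powRD//; apply/implyP; rewrite lt0r_neq0.
have -> : 1 - (n%:R - t') * q^-1 = 1 + (t' - n%:R) / q by ring.
(* Both terms of the Young bound equal [M l ^ n], so the 4 of the Poincare inequality becomes 8. *)
have ME : M `^ (1 - q) * l `^ t' = M * l ^+ n.
  rewrite -powR_mulrn ?(ltW l0)// /M -powRrM -!lD; congr (_ `^ _); field.
  exact: lt0r_neq0.
by rewrite lD powRr1 ?(ltW l0)// -/M ME -/l le_eqVlt; apply/orP; left; apply/eqP; ring.
Qed.

Lemma bounded_gradient_oscillation Omega f g (L : R) k (z : 'rV[int]_n) :
  0 <= L -> weak_gradient Omega f g ->
  measurable (Omega : set (leb_rV R n)) ->
  {ae lebesgue_rV, forall x : leb_rV R n, Omega x -> enorm (g x) <= L} ->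
  closed_box (fun=> k) (fun i => z 0 i) `<=` Omega ->
  exists c : R,
    (\int[lebesgue_rV]_(x in (cube k z : set (leb_rV R n))) `|f x - c|%:E
       <= (4 * n%:R * L * (2 ^- k) * 2 ^- (k * n))%:E)%E.
Proof.
move=> L0 wg mO gL BO; have QO := closed_box_cube BO.
pose Q := cube k z : set (leb_rV R n).
have mQ : measurable Q by exact: measurable_dyadic_box.
have mgE : measurable_fun Q (EFin \o (fun x : leb_rV R n => enorm (g x))).
  apply/measurable_EFinP; exact: measurable_funS mO QO (measurable_weak_gradient wg).
have gi : (\int[lebesgue_rV]_(x in Q) (enorm (g x))%:E <= (L * 2 ^- (k * n))%:E)%E.
  rewrite EFinM -(lebesgue_cube k z) -(integral_cst _ mQ).
  apply: (ae_ge0_le_integral mQ _ mgE _ (measurable_cst _)).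
  - by move=> x _; rewrite lee_fin enorm_ge0.
  - by move=> x _ /=; rewrite lee_fin.
  - by apply: filterS gL => x xL /QO Ox; rewrite lee_fin xL.
have [c cf] := gradient_oscillation_le wg mO BO gi; exists c.
by apply: (le_trans cf); rewrite lee_fin le_eqVlt; apply/orP; left; apply/eqP; ring.
Qed.

Lemma gradient_hausdorff Omega f (alpha t : R) (p : \bar R) :
  (0 < n)%N -> open Omega ->
  measurable_fun (Omega : set (leb_rV R n)) (f : leb_rV R n -> R) ->
  0 < alpha -> (1 <= p)%E -> (gradient_seminorm Omega p f < +oo)%E ->
  (\int[lebesgue_rV]_(x in (Omega : set (leb_rV R n))) abs_powN alpha (f x)
     < +oo)%E ->
  0 < t -> n%:R - integrability_quotient p alpha < t ->
  hausdorff_measure t (zero_average_set Omega f) = 0%E.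
Proof.
move=> n0 oO mf a0 p1 /exists_weak_gradient[g wg goo] foo t0 st.
have mO : measurable (Omega : set (leb_rV R n)) by exact: open_measurable_leb_rV.
have ma := measurable_abs_powN alpha mf.
case: p p1 goo st => [q|_|//]; last first.
  move=> /Lnorm_on_pinfty[L L0 gL] st.
  apply: (@hausdorff_zero_average_le Omega f _ (4 * n%:R * L) 1 alpha 0 t
    n0 oO mf ma) => //.
  - by rewrite mulr_ge0// mulr_ge0.
  - by rewrite addr0 invrK mul1r.
  move=> t' k z BO _; rewrite mulr0 subr0 powRr1 ?invr_ge0 ?exprn_ge0//.
  apply: (bounded_gradient_oscillation L0 wg mO _ BO).
  by apply: filterS gL => x gx /gx /=; rewrite ger0_norm// enorm_ge0.
rewrite lee_fin => q1; have q0 : 0 < q by lra.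
move=> /(Lnorm_on_finite q0) goo st.
have mg : measurable_fun (Omega : set (leb_rV R n))
    (EFin \o (fun x : leb_rV R n => enorm (g x) `^ q)).
  apply/measurable_EFinP.
  exact: (measurableT_comp (measurable_powR q) (measurable_weak_gradient wg)).
have g0 (x : 'rV[R]_n) : (0 <= (enorm (g x) `^ q)%:E)%E by rewrite lee_fin powR_ge0.
pose h (x : leb_rV R n) := (abs_powN alpha (f x) + (enorm (g x) `^ q)%:E)%E.
have mh : measurable_fun (Omega : set (leb_rV R n)) h := emeasurable_funD ma mg.
apply: (@hausdorff_zero_average_le Omega f h (8 * n%:R) 1 alpha q^-1 t
  n0 oO mf mh) => //.
- by move=> x _; exact: leeDl.
- rewrite (ge0_integralD lebesgue_rV mO (fun x _ => abs_powN_ge0 _ _) ma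
    (fun x _ => g0 x) mg).
  apply: (lte_add_pinfty foo); apply: le_lt_trans goo.
  rewrite le_eqVlt; apply/orP; left; apply/eqP; apply: eq_integral => x _.
  by rewrite /= ger0_norm// enorm_ge0.
- by rewrite invr_ge0 ltW.
- suff -> : 1 / (alpha^-1 + q^-1) = q * alpha / (q + alpha) by [].
  by field; rewrite ?lt0r_neq0 ?addr_gt0.
move=> t' k z BO; apply: (gradient_oscillation q1 wg mO mh _ BO) => x _.
by rewrite leeDr// abs_powN_ge0.
Qed.

Lemma hoelder_hausdorff Omega f (sigma alpha t : R) :
  (0 < n)%N -> open Omega ->
  measurable_fun (Omega : set (leb_rV R n)) (f : leb_rV R n -> R) ->
  0 < sigma -> 0 < alpha -> (holder_seminorm Omega sigma f < +oo)%E ->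
  (\int[lebesgue_rV]_(x in (Omega : set (leb_rV R n))) abs_powN alpha (f x)
     < +oo)%E ->
  0 < t -> n%:R - sigma * alpha < t ->
  hausdorff_measure t (zero_average_set Omega f) = 0%E.
Proof.
move=> n0 oO mf s0 a0 /(hoelder_le s0)[L L0 fL] foo t0 st.
have mO : measurable (Omega : set (leb_rV R n)) by exact: open_measurable_leb_rV.
apply: (@hausdorff_zero_average_le Omega f _ (L * n%:R `^ sigma) sigma alpha 0 t
  n0 oO mf (measurable_abs_powN alpha mf)) => //.
- by rewrite mulr_ge0// powR_ge0.
- by rewrite addr0 invrK.
move=> t' k z /closed_box_cube QO _; rewrite mulr0 subr0.
exact: (hoelder_oscillation s0 L0 mO mf fL QO).
Qed.

Lemma gagliardo_hausdorff Omega f (sigma q alpha t : R) :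
  (0 < n)%N -> open Omega ->
  measurable_fun (Omega : set (leb_rV R n)) (f : leb_rV R n -> R) ->
  0 < sigma -> 1 <= q -> 0 < alpha ->
  (gagliardo_seminorm Omega sigma q f < +oo)%E ->
  (\int[lebesgue_rV]_(x in (Omega : set (leb_rV R n))) abs_powN alpha (f x)
     < +oo)%E ->
  0 < t -> n%:R - sigma * (q * alpha / (q + alpha)) < t ->
  hausdorff_measure t (zero_average_set Omega f) = 0%E.
Proof.
move=> n0 oO mf s0 q1 a0 + foo t0 st; have q0 : 0 < q by lra.
move=> /lty_poweRy; rewrite invr_neq0 ?lt0r_neq0// => /(_ isT) Hoo.
have mO : measurable (Omega : set (leb_rV R n)) by exact: open_measurable_leb_rV.
have ma := measurable_abs_powN alpha mf.
have [_ mH] := measurable_gagliardo sigma q mO mf.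
pose H (y : leb_rV R n) := (\int[lebesgue_rV]_(x in (Omega : set (leb_rV R n)))
  (gagliardo_kernel sigma q f x y)%:E)%E.
have H0 y : (0 <= H y)%E.
  by apply: integral_ge0 => x _; rewrite lee_fin gagliardo_kernel_ge0.
pose h (y : leb_rV R n) := (abs_powN alpha (f y) + H y)%E.
have mh : measurable_fun (Omega : set (leb_rV R n)) h := emeasurable_funD ma mH.
apply: (@hausdorff_zero_average_le Omega f h
  (n%:R `^ sigma * (1 + 2 * n%:R ^+ n)) sigma alpha q^-1 t n0 oO mf mh) => //.
- by move=> x _; exact: leeDl.
- rewrite (ge0_integralD lebesgue_rV mO (fun x _ => abs_powN_ge0 _ _) ma
    (fun x _ => H0 x) mH).
  exact: lte_add_pinfty foo Hoo.
- by rewrite invr_ge0 ltW.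
- suff -> : sigma / (alpha^-1 + q^-1) = sigma * (q * alpha / (q + alpha)) by [].
  by field; rewrite ?lt0r_neq0 ?addr_gt0.
move=> t' k z /closed_box_cube QO.
apply: (gagliardo_oscillation s0 q1 mO mf mh _ QO) => y _.
by rewrite leeDr// abs_powN_ge0.
Qed.

End sobolev.

Theorem corollary3p1 (R : realType) (n : nat) (Omega : set 'rV[R]_n)
    (sigma alpha : R) (p : \bar R) (f : 'rV[R]_n -> R) :
  (1 <= n)%N ->
  open Omega ->
  0 < sigma <= 1 ->
  (1 <= p)%E ->
  0 < alpha ->
  sobolev_space Omega sigma p f ->
  (\int[lebesgue_rV]_(x in (Omega : set (leb_rV R n))) abs_powN alpha (f x)
     < +oo)%E ->
  forall t : R, critical_dim n sigma p alpha < t ->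
    hausdorff_measure t (zero_average_set Omega f) = 0%E.
Proof.
move=> n0 oO /andP[s0 s1] p1 a0 [mf foo] aoo t.
rewrite /critical_dim gt_max => /andP[t0 st].
have {foo} : (sobolev_seminorm Omega sigma p f < +oo)%E.
  apply: le_lt_trans foo; apply: leeDr; exact: Lnorm_ge0.
rewrite /sobolev_seminorm; case: eqP => [s|_].
  move: st; rewrite s mul1r => st goo.
  exact: gradient_hausdorff n0 oO mf a0 p1 goo aoo t0 st.
case: p p1 st => [q|_|//] /=.
  rewrite lee_fin => q1 st goo.
  exact: gagliardo_hausdorff n0 oO mf s0 q1 a0 goo aoo t0 st.
by move=> st hoo; exact: hoelder_hausdorff n0 oO mf s0 a0 hoo aoo t0 st.
Qed.
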